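(* Let $G$ be a discrete group. For any functor $\mathscr{X} : \mathscr{O}_G^{\mathrm{op}} \to \mathbf{Cat}$, Thomason's map $$|\eta| : C_{top}(B\mathscr{X}) \to B(C_{cat}\mathscr{X})$$ is a weak $G$-equivalence.
   Context: Notation. $\mathscr{O}_G$ is the orbit category: objects are the coset spaces $G/H$ for $H \subset G$ a subgroup, morphisms are $G$-equivariant maps. $N : \mathbf{Cat} \to \mathbf{sSet}$ is the nerve, and $B = |\cdot| \circ N$ is the classifying space functor; $q$-simplices of nerves are written as chains $x_0 \leftarrow \cdots \leftarrow x_q$. A weak $G$-equivalence of $G$-spaces is a $G$-map $f : X \to Y$ such that $f^H : X^H \to Y^H$ is a weak homotopy equivalence for every subgroup $H \subset G$. The category $\mathscr{O}_{G,+}$ has objects the pairs $(G/H,aH)$ with $G/H \in \mathscr{O}_G$ and $aH \in G/H$; morphisms $(G/H,aH) \to (G/K,bK)$ are $G$-maps $f : G/H \to G/K$ with $f(aH) = bK$. $G$ acts by $g\cdot(G/H,aH) = (G/H,gaH)$, $g\cdot f = f$, and $p : \mathscr{O}_{G,+} \to \mathscr{O}_G$ is the forgetful functor. Grothendieck construction. For $F : \mathscr{D} \to \mathbf{Cat}$ with $\mathscr{D}$ small, $\int_{\mathscr{D}} F$ has objects $(c,x)$ with $c \in \mathscr{D}$, $x \in Fc$; morphisms $(c,x) \to (d,y)$ are pairs $(f,h)$ with $f : c \to d$ and $h : Ff(x) \to y$; composition is $(f',h')\circ(f,h) = (f'\circ f, h'\circ Ff'(h))$. Categorical Elmendorf construction.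 $C_{cat}\mathscr{X} = \int_{\mathscr{O}_{G,+}^{\mathrm{op}}} (\mathscr{X} \circ p)$. Its objects are triples $(G/H,aH,x)$ with $x \in \mathscr{X}(G/H)$, and $G$ acts by $g\cdot(G/H,aH,x) = (G/H,gaH,x)$ and $g\cdot(f,h) = (f,h)$. Topological Elmendorf construction. For $\mathscr{Y} : \mathscr{O}_G^{\mathrm{op}} \to \mathbf{Top}$, $C_{top}\mathscr{Y} = B(\mathscr{Y},\mathscr{O}_G,J)$, with $J : \mathscr{O}_G \to \mathbf{Top}^G$ the inclusion, is the realization of the simplicial $G$-space (two-sided bar construction) with $q$-simplices $$\coprod_{G/H_0,\dots,G/H_q} \mathscr{Y}(G/H_q) \times \mathscr{O}_G(G/H_{q-1},G/H_q) \times \cdots \times \mathscr{O}_G(G/H_0,G/H_1) \times G/H_0,$$ with $G$ acting through $G/H_0$. Since $G$ is discrete, $C_{top}\mathscr{Y}$ is $G$-homeomorphic to $B(\mathscr{Y}\circ p,\mathscr{O}_{G,+},* )$, the realization of the simplicial space with $q$-simplices $\coprod \mathscr{Y}(G/H_q)$, the coproduct running over chains $(G/H_0,a_0H_0) \to \cdots \to (G/H_q,a_qH_q)$ in $\mathscr{O}_{G,+}$, with $G$ permuting summands. For $\mathscr{Y} = B\mathscr{X}$ this is identified, $G$-equivariantly, with the realization of the simplicial set $\mathrm{hocolim}_{\mathscr{O}_{G,+}^{\mathrm{op}}} (N \circ \mathscr{X} \circ p)$. Thomason's map. For $F : \mathscr{D} \to \mathbf{Cat}$, $\mathrm{hocolim}_{\mathscr{D}}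 NF$ is the diagonal of the bisimplicial set whose $q$-th simplicial set is $\coprod_{c_0 \leftarrow \cdots \leftarrow c_q \text{ in } \mathscr{D}} NF(c_q)$. Thomason's map $\eta : \mathrm{hocolim}_{\mathscr{D}} NF \to N(\int_{\mathscr{D}} F)$ sends the $q$-simplex $$(c_0 \xleftarrow{f_1} \cdots \xleftarrow{f_q} c_q \text{ in } \mathscr{D},\ \ x_0 \xleftarrow{h_1} \cdots \xleftarrow{h_q} x_q \text{ in } F(c_q))$$ to $$(c_0,F(f_1\cdots f_q)(x_0)) \xleftarrow{k_1} (c_1,F(f_2\cdots f_q)(x_1)) \xleftarrow{k_2} \cdots \xleftarrow{k_q} (c_q,x_q), \qquad k_i = (f_i, F(f_i\cdots f_q)(h_i)).$$ The map $|\eta|$ of the claim is the geometric realization of $\eta$ for $\mathscr{D} = \mathscr{O}_{G,+}^{\mathrm{op}}$ and $F = \mathscr{X}\circ p$, with source identified with $C_{top}(B\mathscr{X})$ as described. *)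

(* Defs.v *)
From HB Require Import structures.
From mathcomp Require Import all_boot all_order all_algebra generic_quotient.
From mathcomp Require Import all_classical reals topology.
From Stdlib Require Import Relation_Operators.

Set Implicit Arguments.
Unset Strict Implicit.
Unset Printing Implicit Defensive.

Import Order.TTheory GRing.Theory Num.Theory.

Local Open Scope classical_set_scope.

Lemma UIP_pi (T : Type) (x : T) (e : x = x) : e = erefl.
Proof. exact: Prop_irrelevance. Qed.

Lemma existT_inj (T : Type) (P : T -> Type) (x : T) (a b : P x) :
  existT P x a = existT P x b -> a = b.
Proof. by move=> e; have := projT2_eq e; rewrite (UIP_pi (projT1_eq e)). Qed.

Record category := Category {
  obj :> Type;
  hom : obj -> obj -> Type;
  idc : forall a, hom a a;
  cmp : forall a b c, hom b c -> hom a b -> hom a c;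
  cmp1f : forall a b (f : hom a b), cmp (idc b) f = f;
  cmpf1 : forall a b (f : hom a b), cmp f (idc a) = f;
  cmpA : forall a b c d (h : hom c d) (g : hom b c) (f : hom a b),
    cmp h (cmp g f) = cmp (cmp h g) f }.
Arguments hom {c} _ _ : rename.
Arguments idc {c} _ : rename.
Arguments cmp {c a b c0} _ _ : rename.

Notation "g \oc f" := (cmp g f) (at level 50, left associativity).

Definition opp_cat (C : category) : category :=
  @Category C (fun a b => @hom C b a) (@idc C) (fun a b c g f => cmp f g)
    (fun a b f => cmpf1 f) (fun a b f => cmp1f f)
    (fun a b c d h g f => esym (cmpA f g h)).

Record functor (C D : category) := Functor {
  fobj :> C -> D;
  fmor : forall a b, hom a b -> hom (fobj a) (fobj b);
  fmor1 : forall a, fmor (idc a) = idc (fobj a);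
  fmorM : forall a b c (g : hom b c) (f : hom a b),
    fmor (g \oc f) = fmor g \oc fmor f }.
Arguments fmor {C D} f {a b} _ : rename.

Definition functor_id (C : category) : functor C C :=
  @Functor C C id (fun a b f => f) (fun=> erefl) (fun _ _ _ _ _ => erefl).

Lemma functor_comp_id (C D E : category) (G : functor D E) (F : functor C D)
  a : fmor G (fmor F (idc a)) = idc _.
Proof. by rewrite !fmor1. Qed.

Lemma functor_comp_cmp (C D E : category) (G : functor D E) (F : functor C D)
  a b c (g : hom b c) (f : hom a b) :
  fmor G (fmor F (g \oc f)) = fmor G (fmor F g) \oc fmor G (fmor F f).
Proof. by rewrite !fmorM. Qed.

Definition functor_comp (C D E : category) (G : functor D E) (F : functor C D)
    : functor C E :=
  @Functor C E (fun a => G (F a)) (fun a b f => fmor G (fmor F f))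
    (functor_comp_id G F) (functor_comp_cmp G F).

(* Morphisms with varying endpoints are compared as elements of the total
   type of arrows. *)
Definition arrow (C : category) := {a : C & {b : C & hom a b}}.
Definition Arr (C : category) (a b : C) (f : hom a b) : arrow C :=
  existT _ a (existT _ b f).

Lemma Arr_inj (C : category) (a b : C) (f g : hom a b) : Arr f = Arr g -> f = g.
Proof. by move=> e; apply: existT_inj (existT_inj e). Qed.

Definition id_to (C : category) (a b : C) (e : a = b) : hom a b :=
  match e in _ = b return hom a b with erefl => idc a end.

Lemma Arr_id_tor (C : category) (a' a b : C) (e : a' = a) (f : hom a b) :
  Arr (f \oc id_to e) = Arr f.
Proof. by subst a' => /=; rewrite cmpf1. Qed.

Lemma Arr_id_to (C : category) (a b : C) (e : a = b) :
  Arr (id_to e) = Arr (idc b).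
Proof. by subst b. Qed.

Lemma Arr_idc (C : category) (a b : C) : a = b -> Arr (idc a) = Arr (idc b).
Proof. by move=> ->. Qed.

Lemma Arr_cmp (C : category) (a b c a' b' c' : C)
  (g : hom b c) (f : hom a b) (g' : hom b' c') (f' : hom a' b') :
  Arr g = Arr g' -> Arr f = Arr f' -> Arr (g \oc f) = Arr (g' \oc f').
Proof.
move=> eg ef.
have ea : a = a' by exact: (projT1_eq ef).
have eb : b = b' by exact: (projT1_eq eg).
have ec : c = c' by exact: (f_equal (fun z => projT1 (projT2 z)) eg).
by subst a' b' c'; rewrite (Arr_inj eg) (Arr_inj ef).
Qed.

Lemma Arr_cmpl1 (C : category) (a b c : C) (g : hom b c) (f : hom a b) :
  Arr g = Arr (idc b) -> Arr (g \oc f) = Arr f.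
Proof.
move=> eg; have ec : c = b by exact: (f_equal (fun z => projT1 (projT2 z)) eg).
by subst c; rewrite (Arr_inj eg) cmp1f.
Qed.

Lemma Arr_fmor (C D : category) (F G : functor C D) (a b a' b' : C)
  (f : hom a b) (f' : hom a' b') :
  F = G -> Arr f = Arr f' -> Arr (fmor F f) = Arr (fmor G f').
Proof.
move=> -> ef.
have ea : a = a' by exact: (projT1_eq ef).
have eb : b = b' by exact: (f_equal (fun z => projT1 (projT2 z)) ef).
by subst a' b'; rewrite (Arr_inj ef).
Qed.

Lemma functor_ext (C D : category) (F G : functor C D) :
  (forall a, F a = G a) ->
  (forall a b (f : hom a b), Arr (fmor F f) = Arr (fmor G f)) -> F = G.
Proof.
case: F G => [F F1 Fi Fc] [G G1 Gi Gc] /= e0 e1.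
have e : F = G by apply: funext.
subst G; have em : F1 = G1.
  apply: functional_extensionality_dep => a.
  apply: functional_extensionality_dep => b.
  by apply: functional_extensionality_dep => f; apply: Arr_inj.
by subst G1; congr Functor; exact: Prop_irrelevance.
Qed.

(* Functors D -> Cat, where Cat is the category of small categories and
   functors; the two laws are equalities of functors. *)
Record cat_functor (D : category) := CatFunctor {
  cf0 :> D -> category;
  cf1 : forall a b : D, hom a b -> functor (cf0 a) (cf0 b);
  cf1_id : forall a, cf1 (idc a) = functor_id (cf0 a);
  cf1_cmp : forall a b c (g : hom b c) (f : hom a b),
    cf1 (g \oc f) = functor_comp (cf1 g) (cf1 f) }.
Arguments cf1 {D} c {a b} _ : rename.

Lemma cat_precomp_id (C D : category) (F : cat_functor D) (P : functor C D) a :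
  cf1 F (fmor P (idc a)) = functor_id _.
Proof. by rewrite fmor1 cf1_id. Qed.

Lemma cat_precomp_cmp (C D : category) (F : cat_functor D) (P : functor C D)
  a b c (g : hom b c) (f : hom a b) :
  cf1 F (fmor P (g \oc f)) =
  functor_comp (cf1 F (fmor P g)) (cf1 F (fmor P f)).
Proof. by rewrite fmorM cf1_cmp. Qed.

Definition cat_precomp (C D : category) (F : cat_functor D) (P : functor C D)
    : cat_functor C :=
  @CatFunctor C (fun a => F (P a)) (fun a b f => cf1 F (fmor P f))
    (cat_precomp_id F P) (cat_precomp_cmp F P).

Section Grothendieck.
Variables (D : category) (F : cat_functor D).

Definition groth_obj := {c : D & F c}.

Definition groth_hom (u v : groth_obj) :=
  {f : hom (projT1 u) (projT1 v) & hom (cf1 F f (projT2 u)) (projT2 v)}.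

Lemma cf1_idE (c : D) (x : F c) : cf1 F (idc c) x = x.
Proof. by rewrite cf1_id. Qed.

Lemma cf1_cmpE (a b c : D) (g : hom b c) (f : hom a b) (x : F a) :
  cf1 F (g \oc f) x = cf1 F g (cf1 F f x).
Proof. by rewrite cf1_cmp. Qed.

Definition groth_id (u : groth_obj) : groth_hom u u :=
  existT _ (idc _) (id_to (cf1_idE (projT2 u))).

(* [id_to] only identifies [F (f' \oc f) x] with [F f' (F f x)]. *)
Definition groth_cmp (u v w : groth_obj) (q : groth_hom v w) (p : groth_hom u v)
    : groth_hom u w :=
  existT _ (projT1 q \oc projT1 p)
    (projT2 q \oc fmor (cf1 F (projT1 q)) (projT2 p)
       \oc id_to (cf1_cmpE (projT1 q) (projT1 p) (projT2 u))).

Lemma groth_hom_ext (u v : groth_obj) (p q : groth_hom u v) :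
  projT1 p = projT1 q -> Arr (projT2 p) = Arr (projT2 q) -> p = q.
Proof.
by case: p q => [f h] [g k] /= e; subst g => /Arr_inj ->.
Qed.

Lemma groth_cmp1f u v (p : groth_hom u v) : groth_cmp (groth_id v) p = p.
Proof.
apply: groth_hom_ext => /=; first exact: cmp1f.
rewrite Arr_id_tor Arr_cmpl1; last first.
  by rewrite Arr_id_to; apply: Arr_idc; rewrite cf1_idE.
exact: (@Arr_fmor _ _ _ (functor_id _) _ _ _ _ _ _ (cf1_id _ _) erefl).
Qed.

Lemma groth_cmpf1 u v (p : groth_hom u v) : groth_cmp p (groth_id u) = p.
Proof.
apply: groth_hom_ext => /=; first exact: cmpf1.
rewrite Arr_id_tor.
rewrite -[in RHS](cmpf1 (projT2 p)); apply: Arr_cmp => //.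
by rewrite (Arr_fmor erefl (Arr_id_to _)) fmor1.
Qed.

Lemma groth_cmpA u v w z (r : groth_hom w z) (q : groth_hom v w)
  (p : groth_hom u v) :
  groth_cmp r (groth_cmp q p) = groth_cmp (groth_cmp r q) p.
Proof.
apply: groth_hom_ext => /=; first exact: cmpA.
rewrite !Arr_id_tor.
have -> := Arr_cmp (erefl (Arr (projT2 r)))
  (Arr_fmor (erefl (cf1 F (projT1 r))) (Arr_id_tor _ _)).
rewrite fmorM cmpA; apply: Arr_cmp; first by rewrite Arr_id_tor.
by rewrite (Arr_fmor (cf1_cmp _ _ _) erefl).
Qed.

Definition groth : category :=
  Category groth_cmp1f groth_cmpf1 groth_cmpA.

Lemma groth_Arr_ext (c d : D) (x x' : F c) (y y' : F d) (f f' : hom c d)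
  (h : hom (cf1 F f x) y) (h' : hom (cf1 F f' x') y') :
  x = x' -> y = y' -> f = f' -> Arr h = Arr h' ->
  @Arr groth (existT _ c x) (existT _ d y) (existT _ f h) =
  @Arr groth (existT _ c x') (existT _ d y') (existT _ f' h').
Proof. by move=> ? ? ?; subst x' y' f' => /Arr_inj ->. Qed.

End Grothendieck.

Lemma le_ord_max q (i : 'I_q.+1) : (i <= @ord_max q)%N.
Proof. exact: leq_ord. Qed.

Lemma ord0_le q (i : 'I_q.+1) : (@ord0 q <= i)%N.
Proof. exact: leq0n. Qed.

Record monotone_map (p q : nat) := Mono {
  mono_fun :> 'I_p.+1 -> 'I_q.+1;
  monoP : forall i j : 'I_p.+1, (i <= j)%N -> (mono_fun i <= mono_fun j)%N }.

Definition mono_id p : monotone_map p p := @Mono p p id (fun _ _ le => le).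
Definition mono_comp p q r (b : monotone_map q r) (a : monotone_map p q) : monotone_map p r :=
  @Mono p r (fun i => b (a i)) (fun _ _ le => monoP b (monoP a le)).

Record sset := SSet {
  scell :> nat -> Type;
  sact : forall p q, monotone_map p q -> scell q -> scell p;
  sact_id : forall q (x : scell q), sact (mono_id q) x = x;
  sact_comp : forall p q r (b : monotone_map q r) (a : monotone_map p q) (x : scell r),
    sact (mono_comp b a) x = sact a (sact b x) }.
Arguments sact {s p q} _ _ : rename.

Record smap (S T : sset) := SMap {
  smap_fun : forall n, S n -> T n;
  smap_nat : forall p q (a : monotone_map p q) (x : S q),
    smap_fun (sact a x) = sact a (smap_fun x) }.
Arguments smap_fun {S T} s {n} _ : rename.

(* A chain x_0 <- ... <- x_q, recorded with all of its composites, that is, a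
   contravariant functor from the poset {0 <= ... <= q}; a simplicial operator
   then acts by reindexing. *)
Record chain (C : category) (q : nat) := Chain {
  cob : 'I_q.+1 -> C;
  cmor : forall i j : 'I_q.+1, (i <= j)%N -> hom (cob j) (cob i);
  cmor_id : forall (i : 'I_q.+1) (le : (i <= i)%N), cmor le = idc (cob i);
  cmor_cmp : forall (i j k : 'I_q.+1) (ij : (i <= j)%N) (jk : (j <= k)%N) (ik : (i <= k)%N),
    cmor ik = cmor ij \oc cmor jk }.
Arguments cob {C q} _ _.
Arguments cmor {C q} _ {i j} _.

HB.instance Definition _ (C : category) q := gen_eqMixin (chain C q).
HB.instance Definition _ (C : category) q := gen_choiceMixin (chain C q).

Lemma cmor_max (C : category) q (c : chain C q) (i j : 'I_q.+1)
  (le : (i <= j)%N) : cmor c (le_ord_max i) = cmor c le \oc cmor c (le_ord_max j).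
Proof. exact: cmor_cmp. Qed.

Lemma chain_ext (C : category) q (c d : chain C q) :
  (forall i, cob c i = cob d i) ->
  (forall (i j : 'I_q.+1) (le : (i <= j)%N), Arr (cmor c le) = Arr (cmor d le)) -> c = d.
Proof.
case: c d => [F F1 Fi Fc] [G G1 Gi Gc] /= e0 e1.
have e : F = G by apply: funext.
subst G; have em : F1 = G1.
  apply: functional_extensionality_dep => a.
  apply: functional_extensionality_dep => b.
  by apply: functional_extensionality_dep => f; apply: Arr_inj.
by subst G1; congr Chain; exact: Prop_irrelevance.
Qed.

Definition chain_act (C : category) p q (a : monotone_map p q) (c : chain C q)
    : chain C p :=
  @Chain C p (fun i => cob c (a i)) (fun i j le => cmor c (monoP a le))
    (fun i le => cmor_id _ _) (fun i j k ij jk ik => cmor_cmp _ _ _ _).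

Lemma chain_act_id (C : category) q (c : chain C q) :
  chain_act (mono_id q) c = c.
Proof. exact: chain_ext. Qed.

Lemma chain_act_comp (C : category) p q r (b : monotone_map q r) (a : monotone_map p q)
  (c : chain C r) :
  chain_act (mono_comp b a) c = chain_act a (chain_act b c).
Proof. exact: chain_ext. Qed.

Definition nerve (C : category) : sset :=
  SSet (@chain_act_id C) (@chain_act_comp C).

Definition chain_map (C D : category) (F : functor C D) q (c : chain C q)
    : chain D q.
Proof.
refine (@Chain D q (fun i => F (cob c i)) (fun i j le => fmor F (cmor c le)) _ _).
- abstract (by move=> i le; rewrite cmor_id fmor1).
- abstract (by move=> i j k ij jk ik; rewrite -fmorM -cmor_cmp).
Defined.

Lemma chain_map_nat (C D : category) (F : functor C D) p q (a : monotone_map p q)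
  (c : chain C q) : chain_map F (chain_act a c) = chain_act a (chain_map F c).
Proof. exact: chain_ext. Qed.

Definition nerve_map (C D : category) (F : functor C D)
    : smap (nerve C) (nerve D) := 
  @SMap (nerve C) (nerve D) (chain_map F) (@chain_map_nat C D F).

Lemma chain_map_id (C : category) q (c : chain C q) :
  chain_map (functor_id C) c = c.
Proof. exact: chain_ext. Qed.

Lemma chain_map_comp (C D E : category) (G : functor D E) (F : functor C D) q
  (c : chain C q) :
  chain_map (functor_comp G F) c = chain_map G (chain_map F c).
Proof. exact: chain_ext. Qed.

Record bisset := BiSSet {
  blevel :> nat -> sset;
  bface : forall p q, monotone_map p q -> smap (blevel q) (blevel p);
  bface_id : forall q n (x : blevel q n), smap_fun (bface (mono_id q)) x = x;
  bface_comp : forall p q r (b : monotone_map q r) (a : monotone_map p q) n (x : blevel r n),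
    smap_fun (bface (mono_comp b a)) x =
    smap_fun (bface a) (smap_fun (bface b) x) }.
Arguments bface B {p q} _ : rename.

Section Diagonal.
Variable B : bisset.

Definition diag_act p q (a : monotone_map p q) (x : B q q) : B p p :=
  sact a (smap_fun (bface B a) x).

Lemma diag_act_id q (x : B q q) : diag_act (mono_id q) x = x.
Proof. by rewrite /diag_act bface_id sact_id. Qed.

Lemma diag_act_comp p q r (b : monotone_map q r) (a : monotone_map p q) (x : B r r) :
  diag_act (mono_comp b a) x = diag_act a (diag_act b x).
Proof. by rewrite /diag_act bface_comp sact_comp !smap_nat. Qed.

Definition diag : sset := @SSet (fun n => B n n) diag_act diag_act_id diag_act_comp.

End Diagonal.

Section Hocolim.
Variables (D : category) (F : cat_functor D).

Definition hocell (q n : nat) := {c : chain D q & chain (F (cob c ord_max)) n}.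

Lemma hocell_ext q n (c c' : chain D q) (x : chain (F (cob c ord_max)) n)
    (x' : chain (F (cob c' ord_max)) n) :
  c = c' ->
  (forall i, existT (fun d => obj (F d)) _ (cob x i) =
             existT (fun d => obj (F d)) _ (cob x' i)) ->
  (forall (i j : 'I_n.+1) (le : (i <= j)%N),
    existT (fun d => arrow (F d)) _ (Arr (cmor x le)) =
    existT (fun d => arrow (F d)) _ (Arr (cmor x' le))) ->
  existT (fun c : chain D q => chain (F (cob c ord_max)) n) c x =
  existT (fun c : chain D q => chain (F (cob c ord_max)) n) c' x'.
Proof.
move=> ec; subst c' => e0 e1; congr existT; apply: chain_ext => [i|i j le].
  exact: existT_inj (e0 i).
exact: existT_inj (e1 i j le).
Qed.

Definition hocell_act q m n (a : monotone_map m n) (z : hocell q n) : hocell q m :=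
  existT _ (projT1 z) (chain_act a (projT2 z)).

Lemma hocell_act_id q n (z : hocell q n) : hocell_act (mono_id n) z = z.
Proof. by case: z => c x; rewrite /hocell_act /= chain_act_id. Qed.

Lemma hocell_act_comp q l m n (b : monotone_map m n) (a : monotone_map l m) (z : hocell q n) :
  hocell_act (mono_comp b a) z = hocell_act a (hocell_act b z).
Proof. by rewrite /hocell_act /= chain_act_comp. Qed.

Definition hocolim_level q : sset :=
  @SSet (hocell q) (@hocell_act q) (@hocell_act_id q) (@hocell_act_comp q).

(* The last vertex of a^* c is c_{a(p)}, so x in F(c_q) is pushed forward along
   c_q -> c_{a(p)}. *)
Definition hocell_face p q (a : monotone_map p q) n (z : hocell q n) : hocell p n :=
  existT (fun c : chain D p => chain (F (cob c ord_max)) n)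
    (chain_act a (projT1 z))
    (chain_map (cf1 F (cmor (projT1 z) (le_ord_max (a ord_max)))) (projT2 z)).

Lemma hocell_face_nat p q (a : monotone_map p q) m n (b : monotone_map m n) (z : hocell q n) :
  hocell_face a (hocell_act b z) = hocell_act b (hocell_face a z).
Proof. by rewrite /hocell_face /hocell_act /= chain_map_nat. Qed.

Definition hocolim_face p q (a : monotone_map p q)
    : smap (hocolim_level q) (hocolim_level p) :=
  @SMap (hocolim_level q) (hocolim_level p) (hocell_face a)
    (@hocell_face_nat p q a).

Lemma hocolim_face_id q n (z : hocolim_level q n) :
  smap_fun (hocolim_face (mono_id q)) z = z.
Proof.
case: z => c x; rewrite /hocolim_face /= /hocell_face /=.
apply: hocell_ext => [|i|i j le]; first exact: chain_act_id.
  by rewrite /= cmor_id cf1_id.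
by rewrite /= cmor_id cf1_id.
Qed.

Lemma hocolim_face_comp p q r (b : monotone_map q r) (a : monotone_map p q) n
  (z : hocolim_level r n) :
  smap_fun (hocolim_face (mono_comp b a)) z =
  smap_fun (hocolim_face a) (smap_fun (hocolim_face b) z).
Proof.
case: z => c x; rewrite /hocolim_face /= /hocell_face /=.
have e := cmor_cmp c (monoP b (le_ord_max (a ord_max))) (le_ord_max (b ord_max))
  (le_ord_max (b (a ord_max))).
apply: hocell_ext => [|i|i j le]; first exact: chain_act_comp.
  by rewrite /= e cf1_cmp.
by rewrite /= e cf1_cmp.
Qed.

Definition hocolim_bisset : bisset :=
  @BiSSet hocolim_level hocolim_face hocolim_face_id hocolim_face_comp.

Definition hocolim : sset := diag hocolim_bisset.

Section Eta.
Variables (q : nat) (z : hocolim q).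
Let c : chain D q := projT1 z.
Let x : chain (F (cob c ord_max)) q := projT2 z.

Definition eta_ob (i : 'I_q.+1) : groth F :=
  existT _ (cob c i) (cf1 F (cmor c (le_ord_max i)) (cob x i)).

Lemma eta_mor_subproof (i j : 'I_q.+1) (le : (i <= j)%N) :
  cf1 F (cmor c le) (cf1 F (cmor c (le_ord_max j)) (cob x j)) =
  cf1 F (cmor c (le_ord_max i)) (cob x j).
Proof. by rewrite -cf1_cmpE -(cmor_max c). Qed.

Definition eta_mor (i j : 'I_q.+1) (le : (i <= j)%N)
    : hom (eta_ob j) (eta_ob i) :=
  existT _ (cmor c le)
    (fmor (cf1 F (cmor c (le_ord_max i))) (cmor x le)
       \oc id_to (eta_mor_subproof le)).

Lemma eta_mor_id (i : 'I_q.+1) (le : (i <= i)%N) : eta_mor le = idc (eta_ob i).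
Proof.
apply: groth_hom_ext => /=; first exact: cmor_id.
by rewrite Arr_id_tor cmor_id fmor1 Arr_id_to.
Qed.

Lemma eta_mor_cmp (i j k : 'I_q.+1) (ij : (i <= j)%N) (jk : (j <= k)%N)
  (ik : (i <= k)%N) : eta_mor ik = eta_mor ij \oc eta_mor jk.
Proof.
apply: groth_hom_ext => /=; first exact: cmor_cmp.
rewrite !Arr_id_tor (cmor_cmp x ij jk ik) fmorM.
apply: Arr_cmp; first by rewrite Arr_id_tor.
rewrite (Arr_fmor erefl (Arr_id_tor _ _)).
have e : cf1 F (cmor c (le_ord_max i)) =
    functor_comp (cf1 F (cmor c ij)) (cf1 F (cmor c (le_ord_max j))).
  by rewrite -cf1_cmp -(cmor_max c).
exact: (Arr_fmor e erefl).
Qed.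

(* [cmor c (le_ord_max i)] is f_{i+1} ... f_q, so the (j = i+1)-components of
   [eta_mor] are the k_j = (f_j, F(f_j ... f_q)(h_j)). *)
Definition thomason_fun : chain (groth F) q := Chain eta_mor_id eta_mor_cmp.

End Eta.

Lemma eta_nat p q (a : monotone_map p q) (z : hocolim q) :
  thomason_fun (sact a z) = chain_act a (thomason_fun z).
Proof.
case: z => c x.
have e (i : 'I_p.+1) : functor_comp
    (cf1 F (cmor c (monoP a (le_ord_max i)))) (cf1 F (cmor c (le_ord_max (a ord_max))))
  = cf1 F (cmor c (le_ord_max (a i))) by rewrite -cf1_cmp -(cmor_max c).
have e0 (i : 'I_p.+1) : cf1 F (cmor c (monoP a (le_ord_max i)))
    (cf1 F (cmor c (le_ord_max (a ord_max))) (cob x (a i))) =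
    cf1 F (cmor c (le_ord_max (a i))) (cob x (a i)) by rewrite -(e i).
apply: chain_ext => [i|i j le]; first by congr existT; exact: e0.
apply: groth_Arr_ext; [exact: e0|exact: e0|by []|].
rewrite !Arr_id_tor /=.
exact: (Arr_fmor (e i) erefl).
Qed.

Definition thomason : smap hocolim (nerve (groth F)) :=
  @SMap hocolim (nerve (groth F)) thomason_fun eta_nat.

End Hocolim.

Definition functor_opp (C D : category) (F : functor C D)
    : functor (opp_cat C) (opp_cat D) :=
  @Functor (opp_cat C) (opp_cat D) (fobj F) (fun a b f => @fmor C D F b a f)
    (@fmor1 C D F) (fun a b c g f => @fmorM C D F c b a f g).

Lemma Arr_opp (C : category) (a b a' b' : C) (f : hom a b) (f' : hom a' b') :
  Arr f = Arr f' -> @Arr (opp_cat C) b a f = @Arr (opp_cat C) b' a' f'.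
Proof.
move=> ef.
have ea : a = a' by exact: (projT1_eq ef).
have eb : b = b' by exact: (f_equal (fun z => projT1 (projT2 z)) ef).
by subst a' b'; rewrite (Arr_inj ef).
Qed.

Record subgroup (G : groupType) := Subgroup {
  subgroup_set :> set G;
  subgroup1 : subgroup_set 1%g;
  subgroupM : forall x y, subgroup_set x -> subgroup_set y ->
    subgroup_set (x * y)%g;
  subgroupV : forall x, subgroup_set x -> subgroup_set (x^-1)%g }.

Section Orbit.
Variable G : groupType.

Definition translate (g : G) (A : set G) : set G := [set (g * x)%g | x in A].

Lemma translate1 A : translate 1%g A = A.
Proof.
rewrite /translate eqEsubset; split => [_ [x Ax <-]|x Ax]; first by rewrite mul1g.
by exists x => //; rewrite mul1g.
Qed.

Lemma translateM g h A : translate (g * h)%g A = translate g (translate h A).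
Proof.
rewrite /translate eqEsubset; split => [_ [x Ax <-]|_ [_ [x Ax <-] <-]].
  by exists (h * x)%g; [exists x|rewrite mulgA].
by exists x => //; rewrite mulgA.
Qed.

Record coset (H : subgroup G) := Coset {
  coset_set :> set G;
  cosetP : exists a : G, coset_set = translate a H }.

HB.instance Definition _ H := gen_eqMixin (coset H).
HB.instance Definition _ H := gen_choiceMixin (coset H).

Lemma coset_ext H (A B : coset H) : coset_set A = coset_set B -> A = B.
Proof.
case: A B => [A pA] [B pB] /= e; subst B.
by congr Coset; exact: Prop_irrelevance.
Qed.

Lemma coset_act_subproof H (g : G) (A : coset H) :
  exists a : G, translate g A = translate a H.
Proof. by have [a ->] := cosetP A; exists (g * a)%g; rewrite translateM. Qed.

Definition coset_act H (g : G) (A : coset H) : coset H :=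
  Coset (coset_act_subproof g A).

Lemma coset_act1 H (A : coset H) : coset_act 1%g A = A.
Proof. by apply: coset_ext; exact: translate1. Qed.

Lemma coset_actM H g h (A : coset H) :
  coset_act (g * h)%g A = coset_act g (coset_act h A).
Proof. by apply: coset_ext; exact: translateM. Qed.

Record orbit_map (H K : subgroup G) := OrbitMap {
  orbit_fun :> coset H -> coset K;
  orbit_equi : forall g A, orbit_fun (coset_act g A) = coset_act g (orbit_fun A) }.

Lemma orbit_map_ext H K (f f' : orbit_map H K) : f =1 f' -> f = f'.
Proof.
case: f f' => [f pf] [f' pf'] /= /funext e; subst f'.
by congr OrbitMap; exact: Prop_irrelevance.
Qed.

Definition orbit_id H : orbit_map H H := @OrbitMap H H id (fun _ _ => erefl).

Lemma orbit_cmp_equi H K L (g : orbit_map K L) (f : orbit_map H K) x A :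
  g (f (coset_act x A)) = coset_act x (g (f A)).
Proof. by rewrite !orbit_equi. Qed.

Definition orbit_cmp H K L (g : orbit_map K L) (f : orbit_map H K)
    : orbit_map H L := OrbitMap (orbit_cmp_equi g f).

Lemma orbit_cmp1f H K (f : orbit_map H K) : orbit_cmp (orbit_id K) f = f.
Proof. exact: orbit_map_ext. Qed.

Lemma orbit_cmpf1 H K (f : orbit_map H K) : orbit_cmp f (orbit_id H) = f.
Proof. exact: orbit_map_ext. Qed.

Lemma orbit_cmpA H K L M (h : orbit_map L M) (g : orbit_map K L)
  (f : orbit_map H K) :
  orbit_cmp h (orbit_cmp g f) = orbit_cmp (orbit_cmp h g) f.
Proof. exact: orbit_map_ext. Qed.

(* The object G/H is represented by the subgroup H, and its set of points is
   [coset H]. *)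
Definition orbit_cat : category := Category orbit_cmp1f orbit_cmpf1 orbit_cmpA.

Definition porbit_obj := {H : subgroup G & coset H}.

Definition porbit_hom (u v : porbit_obj) :=
  {f : orbit_map (projT1 u) (projT1 v) | f (projT2 u) = projT2 v}.

Lemma porbit_hom_ext u v (f f' : porbit_hom u v) : sval f = sval f' -> f = f'.
Proof. by apply: eq_sig_hprop => x p q; exact: Prop_irrelevance. Qed.

Definition porbit_id u : porbit_hom u u := exist _ (orbit_id _) erefl.

Lemma porbit_cmp_subproof u v w (g : porbit_hom v w) (f : porbit_hom u v) :
  orbit_cmp (sval g) (sval f) (projT2 u) = projT2 w.
Proof. by rewrite /= (svalP f) (svalP g). Qed.

Definition porbit_cmp u v w (g : porbit_hom v w) (f : porbit_hom u v)
    : porbit_hom u w := exist _ _ (porbit_cmp_subproof g f).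

Lemma porbit_cmp1f u v (f : porbit_hom u v) : porbit_cmp (porbit_id v) f = f.
Proof. by apply: porbit_hom_ext; exact: orbit_cmp1f. Qed.

Lemma porbit_cmpf1 u v (f : porbit_hom u v) : porbit_cmp f (porbit_id u) = f.
Proof. by apply: porbit_hom_ext; exact: orbit_cmpf1. Qed.

Lemma porbit_cmpA u v w z (h : porbit_hom w z) (g : porbit_hom v w)
  (f : porbit_hom u v) :
  porbit_cmp h (porbit_cmp g f) = porbit_cmp (porbit_cmp h g) f.
Proof. by apply: porbit_hom_ext; exact: orbit_cmpA. Qed.

Definition porbit_cat : category :=
  Category porbit_cmp1f porbit_cmpf1 porbit_cmpA.

Definition porbit_forget : functor porbit_cat orbit_cat :=
  @Functor porbit_cat orbit_cat (fun u => projT1 u) (fun u v f => sval f)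
    (fun=> erefl) (fun _ _ _ _ _ => erefl).

Definition porbit_act_obj (g : G) (u : porbit_obj) : porbit_obj :=
  existT _ (projT1 u) (coset_act g (projT2 u)).

Lemma porbit_act_subproof (g : G) u v (f : porbit_hom u v) :
  sval f (projT2 (porbit_act_obj g u)) = projT2 (porbit_act_obj g v).
Proof. by rewrite /= orbit_equi (svalP f). Qed.

Definition porbit_act_hom (g : G) u v (f : porbit_hom u v)
    : porbit_hom (porbit_act_obj g u) (porbit_act_obj g v) :=
  exist _ (sval f) (porbit_act_subproof g f).

Lemma porbit_act_hom1 g u :
  porbit_act_hom g (porbit_id u) = porbit_id (porbit_act_obj g u).
Proof. exact: porbit_hom_ext. Qed.

Lemma porbit_act_homM g u v w (q : porbit_hom v w) (f : porbit_hom u v) :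
  porbit_act_hom g (porbit_cmp q f) =
  porbit_cmp (porbit_act_hom g q) (porbit_act_hom g f).
Proof. exact: porbit_hom_ext. Qed.

Definition porbit_act (g : G) : functor porbit_cat porbit_cat :=
  @Functor porbit_cat porbit_cat (porbit_act_obj g) (@porbit_act_hom g)
    (porbit_act_hom1 g) (@porbit_act_homM g).

Lemma porbit_act_obj1 u : porbit_act_obj 1%g u = u.
Proof. by case: u => H A; rewrite /porbit_act_obj /= coset_act1. Qed.

Lemma porbit_act_objM g h u :
  porbit_act_obj (g * h)%g u = porbit_act_obj g (porbit_act_obj h u).
Proof. by rewrite /porbit_act_obj /= coset_actM. Qed.

Lemma porbit_Arr_ext H K (A A' : coset H) (B B' : coset K)
  (f f' : orbit_map H K) pf pf' :
  A = A' -> B = B' -> f = f' ->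
  @Arr porbit_cat (existT _ H A) (existT _ K B) (exist _ f pf) =
  @Arr porbit_cat (existT _ H A') (existT _ K B') (exist _ f' pf').
Proof.
move=> ? ? ?; subst A' B' f'.
by congr Arr; congr exist; exact: Prop_irrelevance.
Qed.

Lemma porbit_opp_act1 :
  functor_opp (porbit_act 1%g) = functor_id (opp_cat porbit_cat).
Proof.
apply: functor_ext => [u|[H A] [K B] [f pf]]; first exact: porbit_act_obj1.
exact: (Arr_opp (@porbit_Arr_ext K H (coset_act 1%g B) B (coset_act 1%g A) A
  f f _ _ (coset_act1 B) (coset_act1 A) erefl)).
Qed.

Lemma porbit_opp_actM g h : functor_opp (porbit_act (g * h)%g) =
  functor_comp (functor_opp (porbit_act g)) (functor_opp (porbit_act h)).
Proof.
apply: functor_ext => [u|[H A] [K B] [f pf]]; first exact: porbit_act_objM.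
exact: (Arr_opp (@porbit_Arr_ext K H
  (coset_act (g * h)%g B) (coset_act g (coset_act h B))
  (coset_act (g * h)%g A) (coset_act g (coset_act h A))
  f f _ _ (coset_actM g h B) (coset_actM g h A) erefl)).
Qed.

Record gcat := GCat {
  gcat_cat :> category;
  gcat_act : G -> functor gcat_cat gcat_cat;
  gcat_act1 : gcat_act 1%g = functor_id gcat_cat;
  gcat_actM : forall g h,
    gcat_act (g * h)%g = functor_comp (gcat_act g) (gcat_act h) }.

Record gsset := GSSet {
  gsset_sset :> sset;
  gsset_act : G -> smap gsset_sset gsset_sset;
  gsset_act1 : forall n (x : gsset_sset n), smap_fun (gsset_act 1%g) x = x;
  gsset_actM : forall g h n (x : gsset_sset n),
    smap_fun (gsset_act (g * h)%g) x =
    smap_fun (gsset_act g) (smap_fun (gsset_act h) x) }.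

Section GNerve.
Variable C : gcat.

Lemma gnerve_act1 n (x : nerve C n) :
  smap_fun (nerve_map (gcat_act C 1%g)) x = x.
Proof. by rewrite gcat_act1; exact: chain_map_id. Qed.

Lemma gnerve_actM g h n (x : nerve C n) :
  smap_fun (nerve_map (gcat_act C (g * h)%g)) x =
  smap_fun (nerve_map (gcat_act C g)) (smap_fun (nerve_map (gcat_act C h)) x).
Proof. by rewrite gcat_actM; exact: chain_map_comp. Qed.

Definition gnerve : gsset := GSSet gnerve_act1 gnerve_actM.

End GNerve.

Section CCat.
Variable X : cat_functor (opp_cat orbit_cat).

Definition cat_Xp : cat_functor (opp_cat porbit_cat) :=
  cat_precomp X (functor_opp porbit_forget).

Definition C_cat_act_obj (g : G) (u : groth cat_Xp) : groth cat_Xp :=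
  existT (fun c : porbit_obj => X (projT1 c))
    (porbit_act_obj g (projT1 u)) (projT2 u).

Definition C_cat_act_hom (g : G) (u v : groth cat_Xp) (p : hom u v)
    : hom (C_cat_act_obj g u) (C_cat_act_obj g v) :=
  existT (fun f : porbit_hom (porbit_act_obj g (projT1 v))
                             (porbit_act_obj g (projT1 u)) =>
      hom (@cf1 _ X (projT1 (projT1 u)) (projT1 (projT1 v)) (sval f) (projT2 u))
          (projT2 v))
    (porbit_act_hom g (projT1 p)) (projT2 p).

Lemma C_cat_act_hom1 g u : C_cat_act_hom g (idc u) = idc (C_cat_act_obj g u).
Proof.
apply: groth_hom_ext; first exact: porbit_act_hom1.
by rewrite /=; congr Arr; congr id_to; exact: Prop_irrelevance.
Qed.

Lemma C_cat_act_homM g u v w (q : hom v w) (p : hom u v) :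
  C_cat_act_hom g (q \oc p) = C_cat_act_hom g q \oc C_cat_act_hom g p.
Proof.
apply: groth_hom_ext; first exact: porbit_act_homM.
by rewrite [RHS]Arr_id_tor [LHS]Arr_id_tor.
Qed.

Definition C_cat_act g : functor (groth cat_Xp) (groth cat_Xp) :=
  @Functor (groth cat_Xp) (groth cat_Xp) (C_cat_act_obj g) (@C_cat_act_hom g)
    (C_cat_act_hom1 g) (@C_cat_act_homM g).

Lemma C_cat_Arr_ext H K (A A' : coset H) (B B' : coset K)
  (x : X H) (y : X K) (f : orbit_map K H) pf pf'
  (h : hom (@cf1 _ X H K f x) y) :
  A = A' -> B = B' ->
  @Arr (groth cat_Xp) (existT _ (existT _ H A) x) (existT _ (existT _ K B) y)
    (existT _ (exist _ f pf) h) =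
  @Arr (groth cat_Xp) (existT _ (existT _ H A') x) (existT _ (existT _ K B') y)
    (existT _ (exist _ f pf') h).
Proof.
move=> ? ?; subst A' B'.
by have -> : pf' = pf by exact: Prop_irrelevance.
Qed.

Lemma C_cat_act1 : C_cat_act 1%g = functor_id (groth cat_Xp).
Proof.
apply: functor_ext => [[[H A] x]|[[H A] x] [[K B] y] [[f pf] h]] /=.
  by rewrite /C_cat_act_obj /porbit_act_obj /= coset_act1.
by apply: C_cat_Arr_ext; exact: coset_act1.
Qed.

Lemma C_cat_actM g h :
  C_cat_act (g * h)%g = functor_comp (C_cat_act g) (C_cat_act h).
Proof.
apply: functor_ext => [[[H A] x]|[[H A] x] [[K B] y] [[f pf] k]] /=.
  by rewrite /C_cat_act_obj /porbit_act_obj /= coset_actM.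
by apply: C_cat_Arr_ext; exact: coset_actM.
Qed.

Definition C_cat : gcat := GCat C_cat_act1 C_cat_actM.

Definition hocolim_act_fun (g : G) n (z : hocolim cat_Xp n) : hocolim cat_Xp n :=
  existT (fun c : chain (opp_cat porbit_cat) n =>
      chain (X (projT1 (cob c ord_max))) n)
    (chain_map (functor_opp (porbit_act g)) (projT1 z)) (projT2 z).

Lemma hocolim_act_nat g p q (a : monotone_map p q) (z : hocolim cat_Xp q) :
  hocolim_act_fun g (sact a z) = sact a (hocolim_act_fun g z).
Proof. exact: hocell_ext (chain_map_nat _ _ _) _ _. Qed.

Definition hocolim_act g : smap (hocolim cat_Xp) (hocolim cat_Xp) :=
  @SMap (hocolim cat_Xp) (hocolim cat_Xp) (@hocolim_act_fun g)
    (@hocolim_act_nat g).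

Lemma cat_Xp_ob_ext H (A A' : coset H) (x : X H) : A = A' ->
  existT (fun u => obj (cat_Xp u)) (existT _ H A) x =
  existT (fun u => obj (cat_Xp u)) (existT _ H A') x.
Proof. by move=> ->. Qed.

Lemma cat_Xp_mor_ext H (A A' : coset H) (f : arrow (X H)) : A = A' ->
  existT (fun u => arrow (cat_Xp u)) (existT _ H A) f =
  existT (fun u => arrow (cat_Xp u)) (existT _ H A') f.
Proof. by move=> ->. Qed.

Lemma cat_Xp_ob_ext1 (u : porbit_obj) (x : X (projT1 u)) :
  existT (fun u => obj (cat_Xp u)) (porbit_act_obj 1%g u) x =
  existT (fun u => obj (cat_Xp u)) u x.
Proof. by case: u x => H A x; exact: cat_Xp_ob_ext (coset_act1 A). Qed.

Lemma cat_Xp_mor_ext1 (u : porbit_obj) (f : arrow (X (projT1 u))) :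
  existT (fun u => arrow (cat_Xp u)) (porbit_act_obj 1%g u) f =
  existT (fun u => arrow (cat_Xp u)) u f.
Proof. by case: u f => H A f; exact: cat_Xp_mor_ext (coset_act1 A). Qed.

Lemma hocolim_act1 n (z : hocolim cat_Xp n) : smap_fun (hocolim_act 1%g) z = z.
Proof.
case: z => c x.
apply: (@hocell_ext _ cat_Xp _ _ (chain_map (functor_opp (porbit_act 1%g)) c) c)
  => [|i|i j le].
- by rewrite porbit_opp_act1 chain_map_id.
- exact: (@cat_Xp_ob_ext1 (cob c ord_max) (cob x i)).
- exact: (@cat_Xp_mor_ext1 (cob c ord_max) (Arr (cmor x le))).
Qed.

Lemma hocolim_actM g h n (z : hocolim cat_Xp n) :
  smap_fun (hocolim_act (g * h)%g) z =
  smap_fun (hocolim_act g) (smap_fun (hocolim_act h) z).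
Proof.
case: z => c x.
apply: (@hocell_ext _ cat_Xp _ _
  (chain_map (functor_opp (porbit_act (g * h)%g)) c)
  (chain_map (functor_opp (porbit_act g))
     (chain_map (functor_opp (porbit_act h)) c))) => [|i|i j le].
- by rewrite porbit_opp_actM chain_map_comp.
- exact: cat_Xp_ob_ext (coset_actM g h (projT2 (cob c ord_max))).
- exact: cat_Xp_mor_ext (coset_actM g h (projT2 (cob c ord_max))).
Qed.

Definition hocolim_gsset : gsset := GSSet hocolim_act1 hocolim_actM.

Lemma eta_fun_equi g n (z : hocolim cat_Xp n) :
  thomason_fun (hocolim_act_fun g z) = chain_map (C_cat_act g) (thomason_fun z).
Proof.
case: z => c x; apply: chain_ext => [i|i j le]; first by [].
congr (Arr _).
apply: groth_hom_ext; first by [].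
by rewrite [LHS]Arr_id_tor [RHS]Arr_id_tor.
Qed.

End CCat.
End Orbit.

Import numFieldTopology.Exports.
Local Open Scope ring_scope.
Local Open Scope quotient_scope.

Record sspace := SSpace {
  tcell :> nat -> topologicalType;
  tact : forall p q, monotone_map p q -> tcell q -> tcell p;
  tact_continuous : forall p q (a : monotone_map p q), continuous (tact a);
  tact_id : forall q (x : tcell q), tact (mono_id q) x = x;
  tact_comp : forall p q r (b : monotone_map q r) (a : monotone_map p q) (x : tcell r),
    tact (mono_comp b a) x = tact a (tact b x) }.
Arguments tact {s p q} _ _ : rename.

Record ssmap (Z W : sspace) := SSMap {
  ssmap_fun : forall n, Z n -> W n;
  ssmap_continuous : forall n, continuous (@ssmap_fun n);
  ssmap_nat : forall p q (a : monotone_map p q) (x : Z q),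
    ssmap_fun (tact a x) = tact a (ssmap_fun x) }.
Arguments ssmap_fun {Z W} s {n} _ : rename.

Lemma discrete_continuous (T : choiceType) (U : topologicalType)
  (f : discrete_topology T -> U) : continuous f.
Proof. by apply/continuousP => A _; exact: discrete_open. Qed.

Lemma discrete_prod_continuous (T : choiceType) (U V : topologicalType)
  (f : T -> U -> V) : (forall x, continuous (f x)) ->
  continuous (fun v : discrete_topology T * U => f v.1 v.2).
Proof.
move=> cf [x u] A /= nA; exists ([set x], f x @^-1` A) => /=.
  by split; [rewrite nbhs_principalE; exact/principal_filterP|exact: cf].
by move=> [y w] /= [-> ].
Qed.

Lemma fst_continuous (T U : topologicalType) : continuous (@fst T U).
Proof. by move=> x; exact: cvg_fst. Qed.

Lemma snd_continuous (T U : topologicalType) : continuous (@snd T U).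
Proof. by move=> x; exact: cvg_snd. Qed.

Lemma pair_continuous (T U V : topologicalType) (f : T -> U) (g : T -> V) :
  continuous f -> continuous g -> continuous (fun x => (f x, g x)).
Proof. by move=> cf cg x; apply: cvg_pair; [exact: cf|exact: cg]. Qed.

Lemma comp_continuous (T U V : topologicalType) (g : U -> V) (f : T -> U) :
  continuous g -> continuous f -> continuous (fun x => g (f x)).
Proof. by move=> cg cf x; apply: continuous_comp; [exact: cf|exact: cg]. Qed.

Section Discrete.
Variable S : sset.

Definition disc_cell (n : nat) : topologicalType :=
  discrete_topology {classic S n}.

Definition disc_act p q (a : monotone_map p q) (x : disc_cell q) : disc_cell p :=
  @sact S p q a x.

Lemma disc_act_continuous p q (a : monotone_map p q) : continuous (disc_act a).
Proof. exact: discrete_continuous. Qed.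

Definition disc : sspace :=
  @SSpace disc_cell disc_act disc_act_continuous
    (fun q x => @sact_id S q x) (fun p q r b a x => @sact_comp S p q r b a x).

End Discrete.

Definition disc_map (S T : sset) (f : smap S T) : ssmap (disc S) (disc T) :=
  @SSMap (disc S) (disc T) (fun n x => @smap_fun S T f n x)
    (fun n => @discrete_continuous _ _ _) (fun p q a x => smap_nat f a x).

Section Realization.
Variable R : realType.

Definition simplex_set (n : nat) : set {ptws 'I_n.+1 -> R} :=
  [set t | (forall i, 0 <= t i) /\ \sum_i t i = 1].

Arguments simplex_set n _ : clear implicits.

Definition simplex (n : nat) : topologicalType := set_type (simplex_set n).

Definition push_fun p q (a : monotone_map p q) (t : 'I_p.+1 -> R) : 'I_q.+1 -> R :=
  fun j => \sum_(i | a i == j) t i.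

Lemma push_subproof p q (a : monotone_map p q) (t : simplex p) :
  (push_fun a (val t) : {ptws 'I_q.+1 -> R}) \in simplex_set q.
Proof.
have /set_mem [t0 t1] := valP t.
apply/mem_set; split => [j|]; first by apply: sumr_ge0 => i _; exact: t0.
by rewrite -t1 (partition_big a predT).
Qed.

Definition push p q (a : monotone_map p q) (t : simplex p) : simplex q :=
  exist (fun u => u \in simplex_set q) _ (push_subproof a t).

Section Real.
Variable Z : sspace.

Definition rcell (n : nat) : topologicalType := (Z n * simplex n)%type.

Definition rcells : topologicalType := {n : nat & rcell n}.

Inductive glue : rcells -> rcells -> Prop :=
  Glue p q (a : monotone_map p q) (z : Z q) (t : simplex p) :
    glue (existT rcell p (tact a z, t)) (existT rcell q (z, push a t)).

Definition glued : rel rcells :=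
  fun u v => `[< clos_refl_sym_trans _ glue u v >].

Lemma glued_refl : reflexive glued.
Proof. by move=> u; apply/asboolP; exact: rst_refl. Qed.

Lemma glued_sym : symmetric glued.
Proof.
by move=> u v; apply/idP/idP => /asboolP e; apply/asboolP; exact: rst_sym.
Qed.

Lemma glued_trans : transitive glued.
Proof.
by move=> v u w /asboolP e /asboolP e'; apply/asboolP; exact: rst_trans e e'.
Qed.

Definition glued_equiv := EquivRel glued glued_refl glued_sym glued_trans.

(* The realization: the quotient of the coproduct of the [Z n * simplex n] by
   the equivalence relation generated by (a^* z, t) ~ (z, a_* t). *)
Definition realization : topologicalType := quotient_topology {eq_quot glued_equiv}.

Definition rpoint (n : nat) (z : Z n) (t : simplex n) : realization :=
  \pi_realization (existT rcell n (z, t)).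

Lemma rpoint_glue p q (a : monotone_map p q) (z : Z q) (t : simplex p) :
  rpoint (tact a z) t = rpoint z (push a t).
Proof.
have : existT rcell p (tact a z, t) = existT rcell q (z, push a t)
    %[mod {eq_quot glued_equiv}].
  by apply/eqmodP/asboolP; apply: rst_step; exact: Glue.
exact.
Qed.

Lemma realization_ind (P : realization -> Prop) :
  (forall n (z : Z n) t, P (rpoint z t)) -> forall u, P u.
Proof. by move=> H; elim/quotW => -[n [z t]]; exact: H. Qed.

Section Lift.
Variables (T : Type) (f : forall n, Z n -> simplex n -> T).

Definition rlift (u : realization) : T :=
  let v := repr u in f (projT2 v).1 (projT2 v).2.

Hypothesis f_glue : forall p q (a : monotone_map p q) (z : Z q) (t : simplex p),
  f (tact a z) t = f z (push a t).

Lemma rliftE n (z : Z n) (t : simplex n) : rlift (rpoint z t) = f z t.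
Proof.
pose g (v : rcells) := f (projT2 v).1 (projT2 v).2.
have g_glued u v : clos_refl_sym_trans _ glue u v -> g u = g v.
  by elim => {u v} [u v []|u|u v _ ->|u v w _ -> _ ->] //= *; exact: f_glue.
apply: (g_glued _ (existT rcell n (z, t))); apply/asboolP.
suff : repr (rpoint z t) = existT rcell n (z, t) %[mod {eq_quot glued_equiv}].
  by move/eqmodP.
exact: reprK.
Qed.

End Lift.

Lemma rlift_continuous (T : topologicalType)
  (f : forall n, Z n -> simplex n -> T) :
  (forall p q (a : monotone_map p q) (z : Z q) (t : simplex p),
    f p (tact a z) t = f q z (push a t)) ->
  (forall n, continuous (fun v : rcell n => f n v.1 v.2)) ->
  continuous (rlift f).
Proof.
move=> f_glue f_cont; apply/quotient_continuous.
have -> : rlift f \o \pi_(quotient_topology {eq_quot glued_equiv}) =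
    (fun v => f (projT1 v) (projT2 v).1 (projT2 v).2).
  by apply: funext => -[n [z t]]; exact: rliftE.
exact: (@sigT_continuous _ rcell _ (fun n v => f n v.1 v.2)).
Qed.

Lemma rpoint_continuous n : continuous (fun v : rcell n => rpoint v.1 v.2).
Proof.
have -> : (fun v : rcell n => rpoint v.1 v.2) =
    \pi_(quotient_topology {eq_quot glued_equiv}) \o existT rcell n.
  by apply: funext => -[z t].
by move=> v; apply: continuous_comp; [exact: existT_continuous|exact: pi_continuous].
Qed.

Lemma rpoint_continuousr n (z : Z n) : continuous (rpoint z).
Proof.
apply: (@comp_continuous _ (rcell n) _ (fun v => rpoint v.1 v.2)
  (fun t => (z, t)) (@rpoint_continuous n)).
by apply: (@pair_continuous _ _ _ (fun=> z) id) ; [exact: cst_continuous|move=> t A; exact].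
Qed.

End Real.
Arguments rpoint {Z n} _ _.

Section RealMap.
Variables (Z W : sspace) (f : ssmap Z W).

Definition realization_map : realization Z -> realization W :=
  rlift (fun n z t => rpoint (ssmap_fun f z) t).

Lemma realization_map_glue p q (a : monotone_map p q) (z : Z q) (t : simplex p) :
  rpoint (ssmap_fun f (tact a z)) t = rpoint (ssmap_fun f z) (push a t).
Proof. by rewrite ssmap_nat rpoint_glue. Qed.

Lemma realization_mapE n (z : Z n) (t : simplex n) :
  realization_map (rpoint z t) = rpoint (ssmap_fun f z) t.
Proof. exact: rliftE realization_map_glue _ _ _. Qed.

Lemma realization_map_continuous : continuous realization_map.
Proof.
apply: rlift_continuous => [|n]; first exact: realization_map_glue.
apply: (@comp_continuous _ (rcell W n) _ (fun v => rpoint v.1 v.2)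
  (fun v => (ssmap_fun f v.1, v.2)) (@rpoint_continuous W n)).
apply: pair_continuous; last exact: snd_continuous.
by apply: comp_continuous; [exact: ssmap_continuous|exact: fst_continuous].
Qed.

End RealMap.
End Realization.
Arguments rpoint {R Z n} _ _.

Lemma realization_map_id (R : realType) (Z : sspace) (f : ssmap Z Z) :
  (forall n (z : Z n), ssmap_fun f z = z) ->
  forall u : realization R Z, realization_map f u = u.
Proof. by move=> H; apply: realization_ind => n z t; rewrite realization_mapE H. Qed.

Lemma realization_map_comp (R : realType) (Z W V : sspace) (f : ssmap Z V)
  (g : ssmap W V) (h : ssmap Z W) :
  (forall n (z : Z n), ssmap_fun f z = ssmap_fun g (ssmap_fun h z)) ->
  forall u : realization R Z, realization_map f u = realization_map g (realization_map h u).
Proof. by move=> H; apply: realization_ind => n z t; rewrite !realization_mapE H. Qed.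

Record gspace (G : groupType) := GSpace {
  gspace_top :> topologicalType;
  gspace_act : G -> gspace_top -> gspace_top;
  gspace_act_continuous : forall g, continuous (gspace_act g);
  gspace_act1 : forall x, gspace_act 1%g x = x;
  gspace_actM : forall g h x,
    gspace_act (g * h)%g x = gspace_act g (gspace_act h x) }.
Arguments gspace_act {G g} _ _ : rename.

Record gmap (G : groupType) (X Y : gspace G) := GMap {
  gmap_fun :> X -> Y;
  gmap_continuous : continuous gmap_fun;
  gmap_equi : forall g x, gmap_fun (gspace_act g x) = gspace_act g (gmap_fun x) }.

Lemma gmap_comp_continuous (G : groupType) (X Y Z : gspace G) (f : gmap Y Z)
  (h : gmap X Y) : continuous (fun x => f (h x)).
Proof. by apply: comp_continuous; exact: gmap_continuous. Qed.

Lemma gmap_comp_equi (G : groupType) (X Y Z : gspace G) (f : gmap Y Z)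
  (h : gmap X Y) g x : f (h (gspace_act g x)) = gspace_act g (f (h x)).
Proof. by rewrite !gmap_equi. Qed.

Definition gmap_comp (G : groupType) (X Y Z : gspace G) (f : gmap Y Z)
    (h : gmap X Y) : gmap X Z :=
  @GMap G X Z (fun x => f (h x)) (@gmap_comp_continuous G X Y Z f h)
    (@gmap_comp_equi G X Y Z f h).

Record gsspace (G : groupType) := GSSpace {
  gsspace_sspace :> sspace;
  gsspace_act : G -> ssmap gsspace_sspace gsspace_sspace;
  gsspace_act1 : forall n (x : gsspace_sspace n),
    ssmap_fun (gsspace_act 1%g) x = x;
  gsspace_actM : forall g h n (x : gsspace_sspace n),
    ssmap_fun (gsspace_act (g * h)%g) x =
    ssmap_fun (gsspace_act g) (ssmap_fun (gsspace_act h) x) }.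
Arguments gsspace_act {G g} _ : rename.

Definition grealization (R : realType) (G : groupType) (Z : gsspace G) : gspace G :=
  @GSpace G (realization R Z) (fun g => realization_map (gsspace_act g))
    (fun g => realization_map_continuous (f := gsspace_act g))
    (realization_map_id (@gsspace_act1 G Z))
    (fun g h => realization_map_comp (@gsspace_actM G Z g h)).

Definition gdisc (G : groupType) (S : gsset G) : gsspace G :=
  @GSSpace G (disc S) (fun g => disc_map (gsset_act S g))
    (@gsset_act1 G S) (@gsset_actM G S).

Definition classifying_gspace (R : realType) (G : groupType) (C : gcat G) : gspace G :=
  grealization R (gdisc (gnerve C)).

Section WeakEquivalence.
Variable R : realType.

Definition unit_interval : topologicalType :=
  set_type [set s : R | 0 <= s <= 1].

Definition cube (n : nat) : topologicalType :=
  set_type [set t : {ptws 'I_n -> R} | forall i, 0 <= t i <= 1].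

Definition cube_boundary (n : nat) : set (cube n) :=
  [set t | exists i, (val t : 'I_n -> R) i = 0 \/ (val t : 'I_n -> R) i = 1].

Definition path_related (X : topologicalType) (x y : X) : Prop :=
  exists gamma : unit_interval -> X,
    [/\ continuous gamma, forall s, val s = 0 :> R -> gamma s = x &
        forall s, val s = 1 :> R -> gamma s = y].

(* Representatives of the elements of pi_n(X, x). *)
Definition spheroid (X : topologicalType) (n : nat) (x : X) (a : cube n -> X) :=
  continuous a /\ forall t, cube_boundary t -> a t = x.

Definition homotopic_rel (X : topologicalType) (n : nat) (x : X)
    (a b : cube n -> X) : Prop :=
  exists h : cube n * unit_interval -> X,
    [/\ continuous h,
        forall t s, val s = 0 :> R -> h (t, s) = a t,
        forall t s, val s = 1 :> R -> h (t, s) = b t &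
        forall t s, cube_boundary t -> h (t, s) = x].

(* Bijectivity on path components, and on pi_n for n >= 1 at every base point
   (the map induced on pi_n is always a homomorphism). *)
Definition weak_equivalence (X Y : topologicalType) (f : X -> Y) : Prop :=
  [/\ continuous f,
      (forall y, exists x, path_related (f x) y) /\
      (forall x x', path_related (f x) (f x') -> path_related x x'),
      (forall n (x : X) (b : cube n.+1 -> Y), spheroid (f x) b ->
        exists2 a, spheroid x a & homotopic_rel (f x) (f \o a) b) &
      (forall n (x : X) (a a' : cube n.+1 -> X), spheroid x a -> spheroid x a' ->
        homotopic_rel (f x) (f \o a) (f \o a') -> homotopic_rel x a a')].

Variable G : groupType.

Definition fixed_set (H : subgroup G) (X : gspace G) : set X :=
  [set x | forall h, subgroup_set H h -> gspace_act h x = x].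

Arguments fixed_set H X _ : clear implicits.

Definition fixed_points (H : subgroup G) (X : gspace G) : topologicalType :=
  set_type (fixed_set H X).

Lemma fixed_map_subproof (H : subgroup G) (X Y : gspace G) (f : gmap X Y)
  (x : fixed_points H X) : f (val x) \in fixed_set H Y.
Proof.
have /set_mem xH := valP x.
by apply/mem_set => h Hh; rewrite -gmap_equi xH.
Qed.

Definition fixed_map (H : subgroup G) (X Y : gspace G) (f : gmap X Y)
    (x : fixed_points H X) : fixed_points H Y :=
  exist (fun y => y \in fixed_set H Y) _ (fixed_map_subproof f x).

Definition weak_G_equivalence (X Y : gspace G) (f : gmap X Y) : Prop :=
  forall H : subgroup G, weak_equivalence (@fixed_map H X Y f).

End WeakEquivalence.

Record top_functor (D : category) := TopFunctor {
  tf0 :> D -> topologicalType;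
  tf1 : forall a b : D, hom a b -> tf0 a -> tf0 b;
  tf1_continuous : forall a b (f : hom a b), continuous (tf1 f);
  tf1_id : forall a x, tf1 (idc a) x = x;
  tf1_cmp : forall a b c (g : hom b c) (f : hom a b) x,
    tf1 (g \oc f) x = tf1 g (tf1 f x) }.
Arguments tf1 {D} t {a b} _ _ : rename.

Section Classifying.
Variables (R : realType) (D : category) (X : cat_functor D).

Definition B_mor (a b : D) (f : hom a b) :
    realization R (disc (nerve (X a))) -> realization R (disc (nerve (X b))) :=
  realization_map (disc_map (nerve_map (cf1 X f))).

Lemma B_mor_continuous a b (f : hom a b) : continuous (B_mor f).
Proof. exact: realization_map_continuous. Qed.

Lemma B_mor_id a x : B_mor (idc a) x = x.
Proof. by apply: realization_map_id => n z; rewrite /= cf1_id; exact: chain_map_id. Qed.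

Lemma B_mor_cmp a b c (g : hom b c) (f : hom a b) x :
  B_mor (g \oc f) x = B_mor g (B_mor f x).
Proof. by apply: realization_map_comp => n z; rewrite /= cf1_cmp; exact: chain_map_comp. Qed.

Definition B_functor : top_functor D :=
  TopFunctor B_mor_continuous B_mor_id B_mor_cmp.

End Classifying.

Section CTop.
Variables (R : realType) (G : groupType) (Y : top_functor (opp_cat (orbit_cat G))).

Definition ctop_summand n (c : chain (opp_cat (orbit_cat G)) n) : topologicalType :=
  (Y (cob c ord_max) * discrete_topology (coset (cob c ord0)))%type.

(* The q-simplices of the bar construction B(Y, O_G, J), as the coproduct over
   the chains G/H_0 -> ... -> G/H_q of the spaces Y(G/H_q) * G/H_0; the factors
   O_G(G/H_{i-1}, G/H_i) are discrete and recorded in the chain. *)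
Definition ctop_cell n : topologicalType :=
  {c : chain (opp_cat (orbit_cat G)) n & ctop_summand c}.

Lemma ctop_cell_ext n (c c' : chain (opp_cat (orbit_cat G)) n)
  (y : Y (cob c ord_max)) (y' : Y (cob c' ord_max))
  (A : coset (cob c ord0)) (A' : coset (cob c' ord0)) :
  c = c' ->
  existT (fun H => Y H : Type) _ y = existT (fun H => Y H : Type) _ y' ->
  existT (fun H => coset H) _ A = existT (fun H => coset H) _ A' ->
  existT (@ctop_summand n) c (y, A) = existT (@ctop_summand n) c' (y', A').
Proof.
move=> ec; subst c' => ey eA.
have -> : y = y' by exact: existT_inj ey.
by have -> : A = A' by exact: existT_inj eA.
Qed.

(* A simplicial operator moves the point of G/H_0 forward along
   G/H_0 -> G/H_{a(0)}, and the point of Y(G/H_q) back along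
   G/H_{a(p)} -> G/H_q. *)
Definition ctop_first p q (a : monotone_map p q) (c : chain (opp_cat (orbit_cat G)) q)
    : coset (cob c ord0) -> coset (cob c (a ord0)) :=
  orbit_fun (cmor c (ord0_le (a ord0)) : orbit_map _ _).

Definition ctop_last p q (a : monotone_map p q) (c : chain (opp_cat (orbit_cat G)) q)
    : Y (cob c ord_max) -> Y (cob c (a ord_max)) :=
  tf1 Y (cmor c (le_ord_max (a ord_max))).

Definition ctop_act p q (a : monotone_map p q) (z : ctop_cell q) : ctop_cell p :=
  existT (@ctop_summand p) (chain_act a (projT1 z))
    (ctop_last a (projT2 z).1, ctop_first a (projT2 z).2).

Lemma ctop_act_continuous p q (a : monotone_map p q) : continuous (ctop_act a).
Proof.
apply: (@sigT_continuous _ (@ctop_summand q) (ctop_cell p)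
  (fun (c : chain (opp_cat (orbit_cat G)) q) (v : ctop_summand c) =>
  existT (@ctop_summand p) (chain_act a c)
    (ctop_last a v.1, ctop_first a v.2))) => c.
apply: (@comp_continuous _ (ctop_summand (chain_act a c)) _
  (existT (@ctop_summand p) (chain_act a c))).
  exact: existT_continuous.
apply: pair_continuous.
  by apply: comp_continuous; [exact: tf1_continuous|exact: fst_continuous].
apply: (@comp_continuous _ (discrete_topology (coset (cob c ord0)))).
  exact: discrete_continuous.
exact: snd_continuous.
Qed.

Lemma ctop_act_id q (z : ctop_cell q) : ctop_act (mono_id q) z = z.
Proof.
case: z => c [y A]; apply: ctop_cell_ext; first exact: chain_act_id.
  by rewrite /ctop_last /= cmor_id tf1_id.
by rewrite /ctop_first /= cmor_id.
Qed.

Lemma ctop_act_comp p q r (b : monotone_map q r) (a : monotone_map p q) (z : ctop_cell r) :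
  ctop_act (mono_comp b a) z = ctop_act a (ctop_act b z).
Proof.
case: z => c [y A]; apply: ctop_cell_ext; first exact: chain_act_comp.
  rewrite /ctop_last /=.
  by rewrite (cmor_cmp c (monoP b (le_ord_max (a ord_max))) (le_ord_max (b ord_max))) tf1_cmp.
rewrite /ctop_first /=.
by rewrite (cmor_cmp c (ord0_le (b ord0)) (monoP b (ord0_le (a ord0)))).
Qed.

Definition ctop_sspace : sspace :=
  SSpace ctop_act_continuous ctop_act_id ctop_act_comp.

Definition ctop_translate (g : G) n (z : ctop_cell n) : ctop_cell n :=
  existT (@ctop_summand n) (projT1 z)
    ((projT2 z).1, coset_act g ((projT2 z).2 : coset _)).

Lemma ctop_translate_continuous g n : continuous (@ctop_translate g n).
Proof.
apply: (@sigT_continuous _ (@ctop_summand n) (ctop_cell n)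
  (fun (c : chain (opp_cat (orbit_cat G)) n) (v : ctop_summand c) =>
  existT (@ctop_summand n) c (v.1, coset_act g (v.2 : coset _)))) => c.
apply: (@comp_continuous _ (ctop_summand c) _ (existT (@ctop_summand n) c)).
  exact: existT_continuous.
apply: pair_continuous; first exact: fst_continuous.
apply: (@comp_continuous _ (discrete_topology (coset (cob c ord0)))).
  exact: discrete_continuous.
exact: snd_continuous.
Qed.

Lemma ctop_translate_nat g p q (a : monotone_map p q) (z : ctop_cell q) :
  ctop_translate g (ctop_act a z) = ctop_act a (ctop_translate g z).
Proof.
case: z => c [y A]; apply: ctop_cell_ext => //.
by rewrite /ctop_first /= orbit_equi.
Qed.

Definition ctop_act_map (g : G) : ssmap ctop_sspace ctop_sspace :=
  @SSMap ctop_sspace ctop_sspace (@ctop_translate g)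
    (@ctop_translate_continuous g) (@ctop_translate_nat g).

Lemma ctop_translate1 n (z : ctop_sspace n) :
  ssmap_fun (ctop_act_map 1%g) z = z.
Proof. by case: z => c [y A]; apply: ctop_cell_ext; rewrite //= coset_act1. Qed.

Lemma ctop_translateM g h n (z : ctop_sspace n) :
  ssmap_fun (ctop_act_map (g * h)%g) z =
  ssmap_fun (ctop_act_map g) (ssmap_fun (ctop_act_map h) z).
Proof. by case: z => c [y A]; apply: ctop_cell_ext; rewrite //= coset_actM. Qed.

Definition ctop_gsspace : gsspace G := GSSpace ctop_translate1 ctop_translateM.

Definition C_top : gspace G := grealization R ctop_gsspace.

End CTop.

Section Thomason.
Variables (R : realType) (G : groupType) (X : cat_functor (opp_cat (orbit_cat G))).

Definition hocolim_gspace : gspace G := grealization R (gdisc (hocolim_gsset X)).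

Lemma realization_eta_equi g (u : hocolim_gspace) :
  realization_map (disc_map (thomason (cat_Xp X))) (gspace_act g u) =
  gspace_act g (realization_map (disc_map (thomason (cat_Xp X))) u : classifying_gspace R (C_cat X)).
Proof.
elim/realization_ind: u => n z t; rewrite /= !realization_mapE.
apply: (congr1 (fun c => rpoint (Z := disc (nerve (groth (cat_Xp X)))) c t)).
exact: eta_fun_equi.
Qed.

Definition thomason_gmap : gmap hocolim_gspace (classifying_gspace R (C_cat X)) :=
  @GMap G hocolim_gspace (classifying_gspace R (C_cat X))
    (realization_map (disc_map (thomason (cat_Xp X))))
    (@realization_map_continuous R _ _ (disc_map (thomason (cat_Xp X)))) realization_eta_equi.

Let BX := B_functor R X.

(* A q-simplex of the homotopy colimit is a chain
   (G/H_0, a_0 H_0) -> ... -> (G/H_q, a_q H_q) and a q-simplex x of the nerve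
   of X(G/H_q); at t it is sent to the class at t of the chain
   G/H_0 -> ... -> G/H_q, the point [x, t] of B X(G/H_q) and a_0 H_0. *)
Definition C_top_ident_cell n (z : hocolim (cat_Xp X) n) (t : simplex R n)
    : ctop_cell BX n :=
  existT (@ctop_summand G BX n)
    (chain_map (functor_opp (porbit_forget G)) (projT1 z))
    (rpoint (Z := disc (nerve (cat_Xp X (cob (projT1 z) ord_max)))) (projT2 z) t,
     projT2 (cob (projT1 z) ord0 : porbit_obj G)).

Definition C_top_ident_fun : hocolim_gspace -> C_top R BX :=
  rlift (Z := disc (hocolim (cat_Xp X)))
    (fun n z t => rpoint (Z := ctop_sspace BX) (C_top_ident_cell z t) t).

Lemma C_top_ident_glue p q (a : monotone_map p q) (z : hocolim (cat_Xp X) q)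
  (t : simplex R p) :
  rpoint (Z := ctop_sspace BX) (C_top_ident_cell (sact a z) t) t =
  rpoint (Z := ctop_sspace BX) (C_top_ident_cell z (push a t)) (push a t).
Proof.
rewrite -rpoint_glue.
apply: (congr1 (fun c => rpoint (Z := ctop_sspace BX) c t)).
case: z => c x; apply: ctop_cell_ext.
- exact: chain_map_nat.
- congr existT; rewrite /ctop_last /= /B_mor realization_mapE.
  by rewrite -(rpoint_glue (Z := disc (nerve _))).
- congr existT; rewrite /ctop_first /=.
  exact/esym/(svalP (cmor c (ord0_le (a ord0)) : porbit_hom _ _)).
Qed.

Lemma C_top_ident_funE n (z : hocolim (cat_Xp X) n) t :
  C_top_ident_fun (rpoint (Z := disc (hocolim (cat_Xp X))) z t) =
  rpoint (Z := ctop_sspace BX) (C_top_ident_cell z t) t.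
Proof. exact: (rliftE (Z := disc (hocolim (cat_Xp X))) C_top_ident_glue). Qed.

Lemma C_top_ident_continuous : continuous C_top_ident_fun.
Proof.
apply: rlift_continuous => [|n]; first exact: C_top_ident_glue.
apply: (@discrete_prod_continuous {classic hocolim (cat_Xp X) n}
  (simplex R n) _ (fun z t => rpoint (Z := ctop_sspace BX) (C_top_ident_cell z t) t))
  => z.
apply: (@comp_continuous _ (rcell R (ctop_sspace BX) n) _
  (fun v => rpoint v.1 v.2) (fun t => (C_top_ident_cell z t, t))).
  exact: rpoint_continuous.
apply: pair_continuous; last by move=> t; exact: cvg_id.
pose c : chain (opp_cat (orbit_cat G)) n :=
  chain_map (functor_opp (porbit_forget G)) (projT1 z).
pose x (t : simplex R n) : BX (cob c ord_max) :=
  rpoint (Z := disc (nerve (cat_Xp X (cob (projT1 z) ord_max)))) (projT2 z) t.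
have x_continuous : continuous x.
  exact: (@rpoint_continuousr R (disc (nerve (cat_Xp X _)))).
apply: (@comp_continuous _ (ctop_summand BX c) (ctop_cell BX n)
  (existT (@ctop_summand G BX n) c)
  (fun t => (x t, projT2 (cob (projT1 z) ord0 : porbit_obj G)))).
  exact: existT_continuous.
by apply: pair_continuous => [//|]; exact: cst_continuous.
Qed.

Lemma C_top_ident_equi g u : C_top_ident_fun (gspace_act g u) = gspace_act g (C_top_ident_fun u).
Proof.
elim/realization_ind: u => n z t.
have -> : gspace_act g (rpoint z t : hocolim_gspace) =
    rpoint (Z := disc (hocolim (cat_Xp X))) (hocolim_act_fun g z) t.
  exact: realization_mapE.
rewrite !C_top_ident_funE.
have -> : C_top_ident_cell (hocolim_act_fun g z) t = ctop_translate g (C_top_ident_cell z t).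
  by apply: ctop_cell_ext => //; exact: chain_ext.
exact/esym/(realization_mapE (ctop_act_map BX g)).
Qed.

Definition C_top_ident : gmap hocolim_gspace (C_top R BX) :=
  GMap C_top_ident_continuous C_top_ident_equi.

End Thomason.

(* Main.v *)
From Pilot Require Import Defs.
From mathcomp Require Import all_boot all_order all_algebra.
From mathcomp Require Import all_classical reals topology.
From mathcomp Require Import normedtype ring lra.
Import Pilot.Defs.

Set Implicit Arguments.
Unset Strict Implicit.
Unset Printing Implicit Defensive.

Import Order.TTheory GRing.Theory Num.Theory.
Import numFieldTopology.Exports.
Local Open Scope classical_set_scope.
Local Open Scope ring_scope.

(** For a subgroup [H], both sides of the claim have the realization of a
    simplicial set of [H]-fixed simplices as their [H]-fixed points, and a
    simplex is [H]-fixed exactly when its vertices lie over objects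
    [(G/K, aK)] of the opposite of the category of pointed orbits with
    [h aK = aK] for all [h] in [H].  On the full subcategory [D] of these objects Thomason's map
    is again Thomason's map, and [D] has a terminal object [(G/H, H)]: there is
    a unique equivariant map [G/H -> G/K] that sends [H] to [aK].  Over a
    category with a terminal object [*] Thomason's theorem is elementary.
    Pushing everything forward to [F *] gives a map back from the nerve of the
    Grothendieck construction to the homotopy colimit, and contracting [D] onto
    [*] gives simplicial homotopies [P] and [Q] from the two composites to the
    identities ([hocolim_contr], [groth_contr]).  So the map on fixed points is
    a homotopy equivalence ([thomason_coherent_equivalence]).

    A homotopy equivalence induces bijections on spheroids only after moving
    base points along the homotopies.  Here [eta \o P = Q \o eta] holds on the
    nose ([groth_contr_thomason]), so that one explicit transport of spheroids
    along paths is enough ([coherent_equivalence_weak]).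

    The rest compares realizations, and rests on one device.  A point of the
    simplex of dimension [n] cuts the interval ]0, 1] into blocks labelled by
    the vertices; sampling the interval at finitely many parameters turns a
    point of a realization into a simplex, in a way that is compatible with the
    gluing ([spanned]).  Samples determine the point
    ([realization_disc_ext]), which replaces the theory of nondegenerate
    representatives: it shows that a fixed point is represented by a fixed
    simplex and that an injective simplicial map realizes to a closed embedding
    ([realization_map_closed]), and it makes the map from the realization of a
    product of two simplices to the product of the simplices injective; a
    common refinement of two subdivisions of the interval makes it surjective,
    and compactness makes it a homeomorphism ([prism_section]).  Together with
    currying ([rlift_prod_continuous]) this realizes simplicial homotopies, and
    defines the continuous inverse of the identification of the bar
    construction with the homotopy colimit ([C_top_inv]). *)

(** * Blocks of a point of a simplex *)
Lemma mono_ext p q (a b : monotone_map p q) : a =1 b -> a = b.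
Proof.
case: a b => [a pa] [b pb] /= /funext e; subst b.
by congr Mono; exact: Prop_irrelevance.
Qed.

Section Weights.
Variable R : realType.

Definition weight n (t : simplex R n) : 'I_n.+1 -> R := val t.

Lemma weight_ge0 n (t : simplex R n) i : 0 <= weight t i.
Proof. by have /set_mem [t0 _] := valP t; exact: t0. Qed.

Lemma weight_sum n (t : simplex R n) : \sum_i weight t i = 1.
Proof. by have /set_mem [_ t1] := valP t. Qed.

Lemma simplex_ext n (t u : simplex R n) : weight t =1 weight u -> t = u.
Proof. by move=> /funext e; exact: val_inj. Qed.

Lemma simplex_of_weight n (w : 'I_n.+1 -> R) : (forall i, 0 <= w i) ->
  \sum_i w i = 1 -> exists t : simplex R n, weight t = w.
Proof.
move=> w0 w1; have wP : (w : {ptws 'I_n.+1 -> R}) \in @simplex_set R n by exact/mem_set.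
by exists (exist (fun u => u \in @simplex_set R n) w wP).
Qed.

Lemma weight_push p q (a : monotone_map p q) (t : simplex R p) j :
  weight (push a t) j = \sum_(i | a i == j) weight t i.
Proof. by []. Qed.

Lemma push_comp p q r (b : monotone_map q r) (a : monotone_map p q)
  (t : simplex R p) : push (mono_comp b a) t = push b (push a t).
Proof.
apply: simplex_ext => k; rewrite !weight_push.
rewrite (partition_big a (fun j => b j == k)) //=; apply: eq_bigr => j /eqP bj.
rewrite weight_push; apply: eq_bigl => i.
by case: (a i =P j) => [->|]; rewrite ?bj ?eqxx ?andbF ?andbT.
Qed.

Lemma push_fixed n (a : monotone_map n n) (t : simplex R n) :
  (forall i, 0 < weight t i -> a i = i) -> push a t = t.
Proof.
move=> fix_a; apply: simplex_ext => j; rewrite weight_push.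
have -> : weight t j = \sum_(i | i == j) weight t i by rewrite big_pred1_eq.
rewrite big_mkcond [RHS]big_mkcond /=; apply: eq_bigr => i _.
have := weight_ge0 t i; rewrite le_eqVlt => /predU1P[<-|/fix_a -> //].
by rewrite !if_same.
Qed.

Lemma push_id n (t : simplex R n) : push (mono_id n) t = t.
Proof. exact: push_fixed. Qed.

(** A point [t] of the simplex cuts the interval ]0, 1] into consecutive blocks
    of lengths [t_0, ..., t_n].  The blocks are half-open so that a vertex of
    weight 0 has an empty block, which is why blocks are compatible with faces
    and degeneracies. *)
Definition in_block n (t : simplex R n) (s : R) (i : 'I_n.+1) : bool :=
  \sum_(j < n.+1 | (j < i)%N) weight t j < s <=
  \sum_(j < n.+1 | (j <= i)%N) weight t j.

Lemma ler_sum_sub n (t : simplex R n) (P Q : pred 'I_n.+1) :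
  (forall i, P i -> Q i) -> \sum_(i | P i) weight t i <= \sum_(i | Q i) weight t i.
Proof.
move=> PQ; rewrite [leRHS](bigID P) /=.
have -> : \sum_(i | Q i && P i) weight t i = \sum_(i | P i) weight t i.
  by apply: eq_bigl => i; case Pi: (P i); rewrite ?andbF ?andbT // PQ.
by rewrite lerDl sumr_ge0 // => i _; exact: weight_ge0.
Qed.

Lemma in_block_le n (t : simplex R n) s s' i i' :
  s <= s' -> in_block t s i -> in_block t s' i' -> (i <= i')%N.
Proof.
move=> ss' /andP[lo _] /andP[_ hi]; rewrite leqNgt; apply/negP => i'i.
suff /le_lt_trans/(_ lo) : s <= \sum_(j < n.+1 | (j < i)%N) weight t j by rewrite ltxx.
apply: le_trans (le_trans ss' hi) _.
by apply: ler_sum_sub => j ji'; exact: leq_ltn_trans i'i.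
Qed.

Lemma in_block_uniq n (t : simplex R n) s i i' :
  in_block t s i -> in_block t s i' -> i = i'.
Proof.
move=> bi bi'; apply/val_inj/anti_leq.
by rewrite (in_block_le (lexx s) bi bi') (in_block_le (lexx s) bi' bi).
Qed.

Lemma in_block_exists n (t : simplex R n) s :
  0 < s <= 1 -> exists i, in_block t s i.
Proof.
move=> /andP[s0 s1].
pose P (i : 'I_n.+1) := s <= \sum_(j < n.+1 | (j <= i)%N) weight t j.
have Pmax : P ord_max.
  rewrite /P; apply: le_trans s1 _; rewrite -(weight_sum t).
  by apply: ler_sum_sub => j _; exact: leq_ord.
case: (arg_minnP (fun i : 'I_n.+1 => i : nat) Pmax) => i Pi imin.
exists i; apply/andP; split; last exact: Pi.
case: (posnP i) => [i0|i_gt0].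
  by rewrite big_pred0 // => j; rewrite i0.
have lt_i : (i.-1 < n.+1)%N by apply: leq_ltn_trans (leq_pred _) (ltn_ord i).
rewrite ltNge; apply/negP => sle.
have /imin /= : P (Ordinal lt_i).
  by apply: le_trans sle _; apply: ler_sum_sub => j ji /=; rewrite -ltnS prednK.
by rewrite leqNgt prednK // leqnn.
Qed.

Lemma in_block_push p q (a : monotone_map p q) (t : simplex R p) s i :
  in_block t s i -> in_block (push a t) s (a i).
Proof.
have sumE (P : pred 'I_q.+1) : \sum_(j | P j) weight (push a t) j =
    \sum_(i | P (a i)) weight t i.
  rewrite (partition_big a P) //=; apply: eq_bigr => j Pj.
  rewrite weight_push; apply: eq_bigl => k.
  by case: (a k =P j) => [->|]; rewrite ?Pj ?andbF ?andbT.
move=> /andP[lo hi]; apply/andP; rewrite !sumE; split.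
  apply: le_lt_trans lo; apply: ler_sum_sub => j.
  by apply: contraTT; rewrite -!leqNgt; exact: monoP.
by apply: le_trans hi _; apply: ler_sum_sub => j; exact: monoP.
Qed.

Definition block n (t : simplex R n) (s : R) : 'I_n.+1 :=
  odflt ord0 [pick i | in_block t s i].

Lemma blockP n (t : simplex R n) s : 0 < s <= 1 -> in_block t s (block t s).
Proof.
move=> /(in_block_exists t)[i bi]; rewrite /block; case: pickP => //= /(_ i).
by rewrite bi.
Qed.

Lemma block_push p q (a : monotone_map p q) (t : simplex R p) s :
  0 < s <= 1 -> block (push a t) s = a (block t s).
Proof.
by move=> sP; apply: in_block_uniq (blockP _ sP) (in_block_push _ (blockP _ sP)).
Qed.

Record sample k := Sample {
  sample_fun :> 'I_k.+1 -> R;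
  sample_mono : forall i j : 'I_k.+1, (i <= j)%N -> sample_fun i <= sample_fun j;
  sample_range : forall i, 0 < sample_fun i <= 1 }.

Lemma blocks_subproof n k (t : simplex R n) (s : sample k) (i j : 'I_k.+1) :
  (i <= j)%N -> (block t (s i) <= block t (s j))%N.
Proof.
move=> ij; apply: (@in_block_le _ t (s i) (s j)).
- exact: sample_mono.
- by apply: blockP; exact: sample_range.
- by apply: blockP; exact: sample_range.
Qed.

Definition blocks n k (t : simplex R n) (s : sample k) : monotone_map k n :=
  Mono (@blocks_subproof n k t s).

Lemma blocks_push p q k (a : monotone_map p q) (t : simplex R p) (s : sample k) :
  blocks (push a t) s = mono_comp a (blocks t s).
Proof. by apply: mono_ext => i; rewrite /= block_push // sample_range. Qed.

(** Sampling at the right ends of the blocks of [t] meets each block of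
    positive length, so that the sampled vertices carry the point [t].  A
    block at the start may be empty with right end 0; its sample is moved to
    the first positive right end. *)
Lemma blocks_supporting n (t : simplex R n) :
  exists s : sample n, push (blocks t s) t = t.
Proof.
pose cum (i : 'I_n.+1) := \sum_(j < n.+1 | (j <= i)%N) weight t j.
have [k0 k0P] : exists k, 0 < weight t k.
  apply/existsP; rewrite -[X in is_true X]negbK negb_exists; apply/negP => /forallP w0.
  have := weight_sum t; rewrite big1 => [/esym/eqP|i _]; first by rewrite oner_eq0.
  by apply/eqP; have := w0 i; rewrite lt_neqAle weight_ge0 andbT negbK eq_sym.
pose pos i := 0 < weight t i.
case: (@arg_minnP _ k0 pos (fun i : 'I_n.+1 => i : nat) k0P) => k kP kmin.
have w_le_cum (i j : 'I_n.+1) : (i <= j)%N -> weight t i <= cum j.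
  move=> ij; have -> : weight t i = \sum_(l | l == i) weight t l by rewrite big_pred1_eq.
  by apply: ler_sum_sub => _ /eqP ->.
have cum_mono (i j : 'I_n.+1) : (i <= j)%N -> cum i <= cum j.
  by move=> ij; apply: ler_sum_sub => l li; exact: leq_trans ij.
have cum1 i : cum i <= 1 by rewrite -(weight_sum t); exact: ler_sum_sub.
pose f i := Num.max (cum i) (weight t k).
have fm (i j : 'I_n.+1) : (i <= j)%N -> f i <= f j.
  by move=> ij; rewrite ge_max !le_max cum_mono // lexx orbT.
have fr i : 0 < f i <= 1.
  by rewrite lt_max (kP : 0 < _) orbT ge_max cum1 (le_trans (w_le_cum k k _) (cum1 k)).
exists (Sample fm fr); apply: push_fixed => i wi.
apply: (@in_block_uniq _ t (f i)); first by apply: blockP; exact: fr.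
have -> : f i = cum i by apply/max_l/w_le_cum/kmin.
rewrite /in_block lexx andbT /cum [ltRHS](bigD1 i) //=.
rewrite (eq_bigl (fun j : 'I_n.+1 => (j <= i)%N && (j != i))).
  by rewrite ltrDr.
by move=> j; rewrite ltn_neqAle andbC.
Qed.

End Weights.

(** * Common refinements *)
Section Refinement.
Variable R : realType.

Let sum_delta n (w : nat -> R) j : (j < n)%N ->
  \sum_(0 <= i < n) w i *+ (i == j) = w j.
Proof.
move=> jn; rewrite big_mkord (bigD1 (Ordinal jn)) //= eqxx big1 ?addr0 // => i.
by rewrite -val_eqE /= => /negbTE ->.
Qed.

Definition refines (p q : nat) (t u w : nat -> R) (a b : nat -> nat) :=
  [/\ forall i, 0 <= w i,
      forall i j, (i <= j)%N -> (a i <= a j)%N /\ (b i <= b j)%N,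
      forall i, (a i <= p)%N /\ (b i <= q)%N,
      forall j, (j <= p)%N -> \sum_(0 <= i < (p + q).+1) w i *+ (a i == j) = t j &
      forall j, (j <= q)%N -> \sum_(0 <= i < (p + q).+1) w i *+ (b i == j) = u j].

Lemma refines_sym p q t u w a b : refines p q t u w a b -> refines q p u t w b a.
Proof.
move=> [w0 mono bd ta ub]; split => // [i j /mono[]//|i|j|j].
- by case: (bd i).
- by rewrite addnC; exact: ub.
- by rewrite addnC; exact: ta.
Qed.

(** The north-west corner rule, read from the last corner: the smaller of the
    two last weights becomes the last weight of the refinement. *)
Lemma refines_exists p q (t u : nat -> R) : (forall i, 0 <= t i) ->
  (forall i, 0 <= u i) ->
  \sum_(0 <= i < p.+1) t i = \sum_(0 <= i < q.+1) u i ->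
  exists w a b, refines p q t u w a b.
Proof.
have [N] := ubnP (p + q); elim: N p q t u => // N IH.
(* exchanging [t] and [u], the smaller last weight is that of [t] *)
suff base_or_step p q t u : (p + q < N.+1)%N -> (forall i, 0 <= t i) ->
    (forall i, 0 <= u i) ->
    \sum_(0 <= i < p.+1) t i = \sum_(0 <= i < q.+1) u i ->
    p = 0%N \/ (p <> 0%N /\ t p <= u q) -> exists w a b, refines p q t u w a b.
  move=> p q t u lt t0 u0 e.
  have [p0|p0] := eqVneq p 0%N; first by apply: base_or_step => //; left.
  have [q0|q0] := eqVneq q 0%N.
    have [|w [a [b r]]] := base_or_step q p u t _ u0 t0 (esym e) (or_introl q0).
      by rewrite addnC.
    by exists w, b, a; exact: refines_sym.
  have [tu|ut] := leP (t p) (u q).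
    by apply: base_or_step => //; right; split => //; exact/eqP.
  have [||w [a [b r]]] := base_or_step q p u t _ u0 t0 (esym e).
  - by rewrite addnC.
  - by right; split; [exact/eqP|exact: ltW].
  - by exists w, b, a; exact: refines_sym.
move=> lt t0 u0 e [p0|[p0 tu]].
  subst p; exists u, (fun=> 0%N), (minn ^~ q).
  split => [//|i j ij|i|[|//] _|j jq].
  - by split => //; rewrite leq_min geq_minr andbT (leq_trans (geq_minl _ _)).
  - by split => //; rewrite geq_minr.
  - by move: e; rewrite add0n big_nat1 => ->; apply: eq_bigr => i _; rewrite eqxx.
  - rewrite -[RHS](@sum_delta q.+1) // add0n.
    by apply: eq_big_nat => i /andP[_]; rewrite ltnS => /minn_idPl ->.
case: p p0 lt t0 e tu => // p _ lt t0 e tu.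
pose u' i := if i == q then u i - t p.+1 else u i.
have [|//|i||w [a [b [w0 mono bd ta ub]]]] := IH p q t u'.
- by rewrite addSn in lt.
- by rewrite /u'; case: eqP => // ->; rewrite subr_ge0.
- move: e; rewrite big_nat_recr //= [in RHS]big_nat_recr //= => e.
  rewrite [RHS]big_nat_recr //= {2}/u' eqxx addrA.
  apply/eqP; rewrite eq_sym subr_eq e; apply/eqP; congr (_ + _).
  by apply: eq_big_nat => i /andP[_ iq]; rewrite /u' ltn_eqF.
pose N' := (p + q).+1.
have tail (c : nat -> nat) m j : \sum_(0 <= i < N'.+1)
    (if i == N' then t p.+1 else w i) *+ ((if (i < N')%N then c i else m) == j) =
    \sum_(0 <= i < N') w i *+ (c i == j) + t p.+1 *+ (m == j).
  rewrite big_nat_recr //= eqxx ltnn; congr (_ + _).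
  by apply: eq_big_nat => i /andP[_ iN]; rewrite ltn_eqF // iN.
exists (fun i => if i == N' then t p.+1 else w i),
  (fun i => if (i < N')%N then a i else p.+1),
  (fun i => if (i < N')%N then b i else q).
split => [i|i j ij|i|j jp|j jq]; rewrite ?addSn ?tail.
- by case: ifP.
- have [lj|lj] := ltnP j N'; first by rewrite (leq_ltn_trans ij lj); exact: mono.
  have [ai bi] := bd i.
  by case: ifP => _ //; split => //; exact: leq_trans ai _.
- have [ai bi] := bd i.
  by case: ifP => _ //; split => //; exact: leq_trans ai _.
- move: jp; rewrite leq_eqVlt => /predU1P[->|jp].
    rewrite eqxx big1 ?add0r // => i _; have [ai _] := bd i.
    by rewrite ltn_eqF.
  by rewrite ta // gtn_eqF ?addr0.
- rewrite ub // /u' (eq_sym q); case: eqP => _; last by rewrite addr0.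
  by rewrite subrK.
Qed.

Lemma simplex_refinement p q (t : simplex R p) (u : simplex R q) :
  exists (w : simplex R (p + q)) (a : monotone_map (p + q) p)
    (b : monotone_map (p + q) q), push a w = t /\ push b w = u.
Proof.
pose ext n (v : simplex R n) (i : nat) := if insub i is Some j then weight v j else 0.
have extE n (v : simplex R n) (j : 'I_n.+1) : ext n v j = weight v j.
  by rewrite /ext valK.
have ext0 n (v : simplex R n) i : 0 <= ext n v i.
  by rewrite /ext; case: insub => // j; exact: weight_ge0.
have ext1 n (v : simplex R n) : \sum_(0 <= i < n.+1) ext n v i = 1.
  by rewrite big_mkord -(weight_sum v); apply: eq_bigr => i _; exact: extE.
have [||/=|w [a [b [w0 mono bd ta ub]]]] := @refines_exists p q (ext p t) (ext q u).
- exact: ext0.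
- exact: ext0.
- by rewrite !ext1.
have am (i j : 'I_(p + q).+1) : (i <= j)%N ->
    ((inord (a i) : 'I_p.+1) <= (inord (a j) : 'I_p.+1))%N.
  move=> ij; rewrite !inordK ?ltnS; first by case: (mono _ _ ij).
    by case: (bd j).
  by case: (bd i).
have bm (i j : 'I_(p + q).+1) : (i <= j)%N ->
    ((inord (b i) : 'I_q.+1) <= (inord (b j) : 'I_q.+1))%N.
  move=> ij; rewrite !inordK ?ltnS; first by case: (mono _ _ ij).
    by case: (bd j).
  by case: (bd i).
have sumE (c : nat -> nat) n (j : 'I_n.+1) : (forall i, (c i <= n)%N) ->
    \sum_(i < (p + q).+1 | inord (c i) == j) w i =
    \sum_(0 <= i < (p + q).+1) w i *+ (c i == j).
  move=> cn; rewrite big_mkord big_mkcond /=; apply: eq_bigr => i _.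
  by rewrite -val_eqE /= inordK ?ltnS //; case: eqP.
have w1 : \sum_(i < (p + q).+1) w i = 1.
  rewrite -(weight_sum t) (partition_big (fun i : 'I__ => inord (a i) : 'I_p.+1) xpredT) //=.
  apply: eq_bigr => j _; rewrite sumE; last by move=> i; case: (bd i).
  by rewrite ta ?leq_ord // extE.
have [v vw] := simplex_of_weight (fun i : 'I_(p + q).+1 => w0 i) w1.
exists v, (Mono am), (Mono bm).
split; apply: simplex_ext => j; rewrite weight_push vw /= sumE.
- by rewrite ta ?leq_ord // extE.
- by move=> i; case: (bd i).
- by rewrite ub ?leq_ord // extE.
- by move=> i; case: (bd i).
Qed.

End Refinement.

(** * Points of a realization are determined by their samples *)
Section Samples.
Variables (R : realType) (S : sset).

(** The simplex of [S] spanned by the vertices whose blocks contain the sample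
    points.  Unlike a representing pair, it depends only on the point of the
    realization. *)
Definition spanned k (s : sample R k) (u : realization R (disc S)) : S k :=
  rlift (Z := disc S) (fun n (z : S n) t => sact (blocks t s) z) u.

Lemma spannedE k (s : sample R k) n (z : S n) t :
  spanned s (rpoint (Z := disc S) z t) = sact (blocks t s) z.
Proof.
apply: (rliftE (Z := disc S) (f := fun n (z : S n) t => sact (blocks t s) z)).
by move=> p q a x v; rewrite blocks_push sact_comp.
Qed.

(** Two representatives are pushed forward from a common refinement [w] of
    their points of simplices.  Then both points lie at [w] on simplices that
    are spanned by the same sample, one that supports [w]. *)
Lemma realization_disc_ext (u v : realization R (disc S)) :
  (forall k (s : sample R k), spanned s u = spanned s v) -> u = v.
Proof.
elim/realization_ind: u => p z t; elim/realization_ind: v => q y r uv.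
have [w [a [b [et er]]]] := simplex_refinement t r.
have [s sw] := blocks_supporting w.
(* [s] depends on [w] only, so this is a normal form for both points *)
have canon n (c : monotone_map (p + q) n) (x : S n) :
    rpoint (Z := disc S) x (push c w) =
    rpoint (Z := disc S) (spanned s (rpoint (Z := disc S) x (push c w))) w.
  rewrite spannedE blocks_push sact_comp.
  by rewrite -[X in X = _](rpoint_glue (Z := disc S)) -{1}sw -[X in X = _](rpoint_glue (Z := disc S)).
by rewrite -et -er canon [in RHS]canon et er uv.
Qed.

(** Hence a property of simplices that a point passes to its samples, such as
    being fixed by a group element, holds for some representative of it. *)
Lemma rpoint_spanned n (z : S n) (t : simplex R n) : exists s : sample R n,
  rpoint (Z := disc S) z t =
  rpoint (Z := disc S) (spanned s (rpoint (Z := disc S) z t)) t.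
Proof.
have [s st] := blocks_supporting t; exists s.
by rewrite spannedE [RHS](rpoint_glue (Z := disc S)) st.
Qed.

End Samples.

(** * Topology of simplices *)
Lemma monotone_map_finite p q : finite_set [set: {classic monotone_map p q}].
Proof.
pose graph (a : {classic monotone_map p q}) : {ffun 'I_p.+1 -> 'I_q.+1} :=
  [ffun i => (a : monotone_map p q) i].
have -> : [set: {classic monotone_map p q}] = graph @^-1` setT by [].
apply: finite_preimage => [a b _ _ /ffunP eab|]; last exact: finite_finset.
by apply: mono_ext => i; have := eab i; rewrite !ffunE.
Qed.

Lemma id_continuous (T : topologicalType) : continuous (@id T).
Proof. by move=> x; exact: cvg_id. Qed.

Lemma ptws_continuous (T : topologicalType) (I : Type) (U : topologicalType)
  (f : T -> {ptws I -> U}) :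
  (forall i, continuous (fun x => f x i)) -> continuous f.
Proof.
move=> cf x; apply/cvg_sup => i; apply/cvg_image.
  by rewrite eqEsubset; split => // y _; exists (fun=> y).
move=> B nB; exists [set g | B (g i)]; first exact: cf.
by rewrite eqEsubset; split => [_ [g Bg <-] //|y By]; exists (fun=> y).
Qed.

Lemma val_continuous (T : topologicalType) (A : set T) :
  continuous (val : set_type A -> T).
Proof. exact: initial_continuous. Qed.

Lemma set_type_continuous (T U : topologicalType) (A : set U) (f : T -> set_type A) :
  continuous (val \o f) -> continuous f.
Proof. exact: continuous_comp_initial. Qed.

Lemma set_type_compact (T : topologicalType) (A : set T) :
  compact A -> compact [set: set_type A].
Proof.
move=> cA F PF _; have [|p [Ap clp]] := cA (val @ F).
  by apply: (@filterS _ F _ setT); [move=> x _; exact: set_mem (valP x)|exact: filterT].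
exists (exist _ p (mem_set Ap)); split => // C B FC.
rewrite nbhsE => -[O [[W oW <-] /= Wp] OB].
have FvC : F (val @^-1` (val @` C)) by apply: (@filterS _ F _ C) => // y Cy; exists y.
have [_ [[y Cy <-] Wy]] := clp _ _ FvC (open_nbhs_nbhs (conj oW Wp)).
by exists y; split => //; exact: OB.
Qed.

Lemma set_type_hausdorff (T : topologicalType) (A : set T) :
  hausdorff_space T -> hausdorff_space (set_type A).
Proof.
move=> hT x y clxy; apply/val_inj/hT => U V nU nV.
have [|z [Uz Vz]] := clxy (val @^-1` U) (val @^-1` V) (val_continuous nU).
  exact: val_continuous.
by exists (val z).
Qed.

Lemma ptws_hausdorff (R : realType) (I : eqType) : hausdorff_space {ptws I -> R}.
Proof. by apply: (@hausdorff_product _ (fun=> R)) => _; exact: Rhausdorff. Qed.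

Lemma pair_hausdorff (T U : topologicalType) :
  hausdorff_space T -> hausdorff_space U -> hausdorff_space (T * U)%type.
Proof.
move=> hT hU [x u] [y v] cl; congr pair.
  apply: hT => A B nA nB.
  have [||[a c] [/= ? ?]] := cl (fst @^-1` A) (fst @^-1` B).
  - by apply: (@fst_continuous T U (x, u)).
  - by apply: (@fst_continuous T U (y, v)).
  by exists a.
apply: hU => A B nA nB.
have [||[a c] [/= ? ?]] := cl (snd @^-1` A) (snd @^-1` B).
- by apply: (@snd_continuous T U (x, u)).
- by apply: (@snd_continuous T U (y, v)).
by exists c.
Qed.

Lemma compact_locally_compact (T : topologicalType) :
  compact [set: T] -> locally_compact [set: T].
Proof.
move=> cT x _; rewrite withinET; exists setT; first exact: filterT.
by split => //; exact: closedT.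
Qed.

Section RealFunctions.
Variable R : realType.

Lemma subr_continuous (T : topologicalType) (f g : T -> R) :
  continuous f -> continuous g -> continuous (fun x => f x - g x).
Proof. by move=> cf cg x; apply: (@cvgB R R^o); [exact: cf|exact: cg]. Qed.

Lemma addr_continuous (T : topologicalType) (f g : T -> R) :
  continuous f -> continuous g -> continuous (fun x => f x + g x).
Proof. by move=> cf cg x; apply: (@cvgD R R^o); [exact: cf|exact: cg]. Qed.

Lemma mulr_continuous (T : topologicalType) (f g : T -> R) :
  continuous f -> continuous g -> continuous (fun x => f x * g x).
Proof. by move=> cf cg x; apply: (@cvgM R); [exact: cf|exact: cg]. Qed.

Lemma normr_continuous (T : topologicalType) (f : T -> R) :
  continuous f -> continuous (fun x => `|f x|).
Proof. by move=> cf x; apply: (@cvg_norm R R^o); exact: cf. Qed.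

Lemma maxr_continuous (T : topologicalType) (f g : T -> R) :
  continuous f -> continuous g -> continuous (fun x => Num.max (f x) (g x)).
Proof. by move=> cf cg x; apply: (@continuous_max R T f g); [exact: cf|exact: cg]. Qed.

Lemma minr_continuous (T : topologicalType) (f g : T -> R) :
  continuous f -> continuous g -> continuous (fun x => Num.min (f x) (g x)).
Proof. by move=> cf cg x; apply: (@continuous_min R T f g); [exact: cf|exact: cg]. Qed.

End RealFunctions.

Section Simplex.
Variable R : realType.

Lemma weight_continuous n i : continuous (fun t : simplex R n => weight t i).
Proof.
apply: (@comp_continuous (simplex R n) {ptws 'I_n.+1 -> R} R (fun w => w i) val).
  exact: (@proj_continuous _ (fun=> R) i).
exact: val_continuous.
Qed.

Lemma simplex_continuous (T : topologicalType) n (f : T -> simplex R n) :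
  (forall i, continuous (fun x => weight (f x) i)) -> continuous f.
Proof. by move=> cf; apply/set_type_continuous/ptws_continuous. Qed.

Lemma sum_continuous (T : topologicalType) (I : Type) (r : seq I) (P : pred I)
  (f : I -> T -> R) : (forall i, P i -> continuous (f i)) ->
  continuous (fun x => \sum_(i <- r | P i) f i x).
Proof.
apply: (@continuous_big R I +%R 0 P) => -[x y].
exact: (@cvgD R R^o _ _ _ fst snd x y cvg_fst cvg_snd).
Qed.

Lemma push_continuous p q (a : monotone_map p q) :
  continuous (push a : simplex R p -> simplex R q).
Proof.
apply: simplex_continuous => j; apply: sum_continuous => i _.
exact: weight_continuous.
Qed.

Lemma simplex_hausdorff n : hausdorff_space (simplex R n).
Proof. exact/set_type_hausdorff/ptws_hausdorff. Qed.

Lemma simplex_compact n : compact [set: simplex R n].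
Proof.
apply: set_type_compact.
pose box := [set t : {ptws 'I_n.+1 -> R} | forall i, (fun=> `[0, 1]%classic) i (t i)].
apply: (@subclosed_compact _ _ box).
- have ci i : continuous (fun t : {ptws 'I_n.+1 -> R} => t i).
    exact: (@proj_continuous _ (fun=> R) i).
  have -> : @simplex_set R n =
      (\bigcap_i ((fun t : {ptws 'I_n.+1 -> R} => t i) @^-1` [set x | 0 <= x])) `&`
      ((fun t : {ptws 'I_n.+1 -> R} => \sum_i t i) @^-1` [set x | x = 1]).
    by apply/seteqP; split => t [t0 t1]; split => // i; [move=> _|]; exact: t0.
  apply: closedI.
    apply: closed_bigI => i _; apply: preimage_closed; first by move=> t _; exact: ci.
    exact: closed_ge.
  apply: preimage_closed; last exact: closed_eq.
  by move=> t _; apply: sum_continuous => i _; exact: ci.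
- by apply: (@tychonoff _ (fun=> R)) => i; exact: segment_compact.
- move=> t [t0 t1] i; rewrite /= in_itv /= t0 -t1 (bigD1 i) //= lerDl.
  by apply: sumr_ge0 => j _; exact: t0.
Qed.

End Simplex.

(** * Maps out of the product with a realization *)
Section Currying.
Variables (R : realType) (Z : sspace) (V W : topologicalType).

(** A quotient map stays a quotient map after a product with a locally compact
    Hausdorff space: a continuous function of two variables is a continuous
    function into the space of maps with the compact-open topology, to which
    the universal property of the quotient applies. *)
Lemma rlift_prod_continuous (f : forall n, Z n -> simplex R n -> V -> W) :
  locally_compact [set: V] -> hausdorff_space V ->
  (forall p q (a : monotone_map p q) (z : Z q) (t : simplex R p) v,
    f p (tact a z) t v = f q z (push a t) v) ->
  (forall n, continuous (fun x : rcell R Z n * V => f n x.1.1 x.1.2 x.2)) ->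
  continuous (fun x : realization R Z * V => rlift f x.1 x.2).
Proof.
move=> lcV hV f_glue f_cont.
have glue p q (a : monotone_map p q) (z : Z q) (t : simplex R p) :
    f p (tact a z) t = f q z (push a t) by apply: funext => v; exact: f_glue.
have cu : continuous (rlift f : _ -> {compact-open, V -> W}).
  apply: (@rlift_continuous R Z {compact-open, V -> W} f glue) => n.
  exact: (continuous_curry_fun (f_cont n)).
have -> : (fun x : realization R Z * V => rlift f x.1 x.2) = uncurry (rlift f).
  by apply: funext => -[].
apply: continuous_uncurry => // u; elim/realization_ind: u => n z t.
rewrite rliftE //.
by have [_ /(_ (z, t))] := continuous_curry (f_cont n).
Qed.

End Currying.

(** * The product of two simplices *)
Section Prism.
Variables (p q : nat).

Definition prism_act m n (c : monotone_map m n)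
    (z : monotone_map n p * monotone_map n q) :=
  (mono_comp z.1 c, mono_comp z.2 c).

Lemma prism_act_id n (z : monotone_map n p * monotone_map n q) :
  prism_act (mono_id n) z = z.
Proof. by case: z => a b; congr pair; exact: mono_ext. Qed.

Lemma prism_act_comp l m n (d : monotone_map m n) (c : monotone_map l m)
    (z : monotone_map n p * monotone_map n q) :
  prism_act (mono_comp d c) z = prism_act c (prism_act d z).
Proof. by congr pair; exact: mono_ext. Qed.

Definition prism : sset := SSet prism_act_id prism_act_comp.

Variable R : realType.

Lemma prism_rpoint_eq m n (a : monotone_map m p) (b : monotone_map m q)
  (a' : monotone_map n p) (b' : monotone_map n q) (w : simplex R m) (w' : simplex R n) :
  push a w = push a' w' -> push b w = push b' w' ->
  rpoint (Z := disc prism) (a, b) w = rpoint (Z := disc prism) (a', b') w'.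
Proof.
move=> ea eb; apply: realization_disc_ext => k s; rewrite !spannedE /=.
by congr pair; rewrite /= -!blocks_push ?ea ?eb.
Qed.

(** The realization of [prism] is the product of simplices: the inverse of
    the bijection [[(a, b), w] |-> (a_* w, b_* w)] is continuous because the
    points with a representative in the finitely many compact simplices of
    dimension [p + q] are all points. *)
Lemma prism_section :
  exists2 f : simplex R p * simplex R q -> realization R (disc prism),
    continuous f &
    forall n (a : monotone_map n p) (b : monotone_map n q) (w : simplex R n),
      f (push a w, push b w) = rpoint (Z := disc prism) (a, b) w.
Proof.
have ex (x : simplex R p * simplex R q) : exists y : realization R (disc prism),
    exists (a : monotone_map (p + q) p) (b : monotone_map (p + q) q) w,
      x = (push a w, push b w) /\ y = rpoint (Z := disc prism) (a, b) w.
  case: x => t u; have [w [a [b [<- <-]]]] := simplex_refinement t u.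
  by exists (rpoint (Z := disc prism) (a, b) w), a, b, w.
have [f fP] := choice ex.
have fE n (a : monotone_map n p) (b : monotone_map n q) (w : simplex R n) :
    f (push a w, push b w) = rpoint (Z := disc prism) (a, b) w.
  have [a' [b' [w' [e ->]]]] := fP (push a w, push b w).
  by apply: prism_rpoint_eq; [exact: (esym (congr1 fst e))|exact: (esym (congr1 snd e))].
exists f => //; apply/continuous_closedP => C cC.
pose piece (i : {classic monotone_map (p + q) p} * {classic monotone_map (p + q) q}) :=
  (fun w => (push i.1 w, push i.2 w)) @`
    (rpoint (Z := disc prism) (i : prism (p + q)) @^-1` C).
have -> : f @^-1` C = \bigcup_(i in setT) piece i.
  apply/seteqP; split => [x Cfx|_ [[a b] _ [w Cw <-]] /=]; last by rewrite fE.
  have [a [b [w [ex' fx]]]] := fP x.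
  by exists (a, b) => //; exists w => //=; rewrite -fx.
apply: closed_bigcup => [|i _].
  by rewrite -setXTT; apply: finite_setX; exact: monotone_map_finite.
apply: compact_closed; first by apply: pair_hausdorff; exact: simplex_hausdorff.
apply: continuous_compact.
  apply: continuous_subspaceT; apply: pair_continuous; exact: push_continuous.
apply: subclosed_compact (@simplex_compact R _) _ => //.
apply: preimage_closed => // w _; exact: rpoint_continuousr.
Qed.

End Prism.

(** * Subcomplexes and fixed points *)
Section Subcomplex.
Variables (R : realType) (T S : sset) (i : smap T S).

Lemma spanned_map k (s : sample R k) (u : realization R (disc T)) :
  spanned s (realization_map (disc_map i) u) = smap_fun i (spanned s u).
Proof.
elim/realization_ind: u => n z t.
by rewrite realization_mapE !spannedE smap_nat.
Qed.

(** The realization of a simplicial set carries the weak topology of its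
    simplices. *)
Lemma realization_closed (C : set (realization R (disc S))) :
  (forall n (z : S n), closed [set t | C (rpoint (Z := disc S) z t)]) -> closed C.
Proof.
move=> cC; rewrite -openC.
suff : open (\pi_(realization R (disc S))%qT @^-1` ~` C) by [].
apply/sigT_openP => n; rewrite openE => -[z t] /= nCzt.
exists ([set z], ~` [set t | C (rpoint (Z := disc S) z t)]) => /=.
  split; first by rewrite nbhs_principalE; exact/principal_filterP.
  by apply: open_nbhs_nbhs; split => //; rewrite openC; exact: cC.
by move=> [y r] [/= -> ].
Qed.

Hypothesis i_inj : forall n, injective (@smap_fun T S i n).

Lemma realization_map_inj :
  injective (realization_map (R := R) (disc_map i)).
Proof.
move=> u v e; apply: realization_disc_ext => k s; apply: i_inj.
by rewrite -!spanned_map e.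
Qed.

(** The trace of the image of a closed set on a simplex [z] is the union, over
    the finitely many operators [a] for which [a^* z] lies in the subcomplex,
    of closed sets of points that are fixed by [a]: such an [a] exists for
    each point, since a point lies on a simplex spanned by its samples. *)
Lemma realization_map_closed (A : set (realization R (disc T))) :
  closed A -> closed (realization_map (disc_map i) @` A).
Proof.
move=> cA; apply: realization_closed => n z.
pose piece (a : {classic monotone_map n n}) := [set t : simplex R n |
  push a t = t /\ exists2 y : T n, smap_fun i y = sact (a : monotone_map n n) z &
    A (rpoint (Z := disc T) y t)].
have -> : [set t | (realization_map (disc_map i) @` A) (rpoint (Z := disc S) z t)] =
    \bigcup_(a in setT) piece a.
  apply/seteqP; split => t /=.
    move=> [u Au eu]; have [s st] := blocks_supporting t.
    exists (blocks t s) => //; split => //.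
    have ez : smap_fun i (spanned s u) = sact (blocks t s) z.
      by rewrite -spanned_map eu spannedE.
    exists (spanned s u) => //.
    suff <- : u = rpoint (Z := disc T) (spanned s u) t by [].
    apply: realization_map_inj; rewrite eu realization_mapE /= ez.
    by rewrite -[in LHS]st -(rpoint_glue (Z := disc S)).
  move=> [a _ [at' [y ey Ay]]]; exists (rpoint (Z := disc T) y t) => //.
  rewrite realization_mapE /= ey -[in RHS]at'.
  exact: (rpoint_glue (Z := disc S)).
apply: closed_bigcup => [|a _]; first exact: monotone_map_finite.
have [[y ey]|ny] := pselect (exists y : T n, smap_fun i y = sact (a : monotone_map n n) z);
  last first.
  suff -> : piece a = set0 by exact: closed0.
  by rewrite -subset0 => t [_ [y ey _]]; apply: ny; exists y.
have -> : piece a = [set t | push a t = t] `&` (rpoint (Z := disc T) y @^-1` A).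
  apply/seteqP; split => t; last by move=> [at' Ay]; split => //; exists y.
  move=> [at' [y' ey' Ay']]; split => //.
  by have <- : y' = y by apply: i_inj; rewrite ey'.
apply: closedI.
  have -> : [set t : simplex R n | push a t = t] = \bigcap_k
      ((fun t => weight (push a t) k - weight t k) @^-1` [set x | x = 0]).
    apply/seteqP; split => t /=; first by move=> at' k _ /=; rewrite at' subrr.
    by move=> at'; apply: simplex_ext => k; apply/eqP; rewrite -subr_eq0; apply/eqP/at'.
  apply: closed_bigI => k _; apply: preimage_closed; last exact: closed_eq.
  move=> t _; apply: (@subr_continuous R _ (fun t => weight (push a t) k)).
    apply: (@comp_continuous _ _ _ (fun t => weight t k)).
      exact: weight_continuous.
    exact: push_continuous.
  exact: weight_continuous.
by apply: preimage_closed => // t _; exact: rpoint_continuousr.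
Qed.

End Subcomplex.

Definition fixed_val (G : groupType) (H : subgroup G) (U : gspace G)
  (x : fixed_points H U) : U := val x.

Section FixedPoints.
Variables (R : realType) (G : groupType) (H : subgroup G) (S : gsset G).
Variables (T : sset) (i : smap T S).
Hypothesis i_inj : forall n, injective (@smap_fun T S i n).
Hypothesis i_fixed : forall n (z : S n),
  (exists y, smap_fun i y = z) <->
  (forall h, subgroup_set H h -> smap_fun (gsset_act S h) z = z).

Local Notation X := (grealization R (gdisc S)).

(** A sample of a fixed point is a fixed simplex, because samples commute with
    simplicial maps. *)
Lemma fixed_set_realization :
  @fixed_set G H X = range (realization_map (disc_map i)).
Proof.
apply/seteqP; split => u.
  elim/realization_ind: u => n z t fixz.
  have [s e] := rpoint_spanned z t; rewrite e.
  have [|y <-] := (i_fixed (spanned s (rpoint (Z := disc S) z t))).2.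
    by move=> h Hh; rewrite -spanned_map (fixz h Hh : realization_map _ _ = _).
  by exists (rpoint (Z := disc T) y t) => //; rewrite realization_mapE.
move=> [v _ <-] h Hh; elim/realization_ind: v => n y t.
rewrite /= !realization_mapE /=.
have -> // : smap_fun (gsset_act S h) (smap_fun i y) = smap_fun i y.
by apply: (i_fixed _).1 h Hh; exists y.
Qed.

Lemma fixed_points_realization :
  exists (e : realization R (disc T) -> fixed_points H X)
    (e' : fixed_points H X -> realization R (disc T)),
    [/\ continuous e, continuous e', cancel e e', cancel e' e &
        forall u, fixed_val (e u) = realization_map (disc_map i) u].
Proof.
have eP u : realization_map (disc_map i) u \in @fixed_set G H X.
  by rewrite fixed_set_realization; apply/mem_set; exists u.
pose e u : fixed_points H X := 
  exist (fun x => x \in @fixed_set G H X) _ (eP u).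
have e_surj x : exists u, e u = x.
  case: x => y yX.
  have [u _ eu] : range (realization_map (disc_map i)) y.
    by rewrite -fixed_set_realization; exact: set_mem.
  by exists u; exact: val_inj.
have [e' e'K] := choice e_surj.
have e_inj : injective e.
  by move=> u v /(congr1 val) /=; exact: realization_map_inj.
exists e, e'; split => //.
- exact/set_type_continuous/realization_map_continuous.
- apply/continuous_closedP => A cA.
  have -> : e' @^-1` A = val @^-1` (realization_map (disc_map i) @` A).
    apply/seteqP; split => x /=.
      by move=> Ax; exists (e' x) => //; rewrite -[in RHS](e'K x).
    by move=> [u Au eu]; have -> : e' x = u by apply/e_inj; rewrite e'K; exact/val_inj/esym.
  apply: preimage_closed; last exact: realization_map_closed.
  by move=> x _; exact: val_continuous.
- by move=> u; exact: e_inj.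
Qed.

End FixedPoints.

(** * Concatenation of paths and homotopies *)
Section Paste.
Variable R : realType.

Lemma paste_continuous (T U : topologicalType) (e : T -> R) (f g : T -> U) :
  continuous e -> continuous f -> continuous g ->
  (forall x, e x = 0 -> f x = g x) ->
  continuous (fun x => if e x <= 0 then f x else g x).
Proof.
move=> ce cf cg fg; apply/continuous_closedP => C cC.
have -> : (fun x => if e x <= 0 then f x else g x) @^-1` C =
    (e @^-1` [set r | r <= 0] `&` f @^-1` C) `|`
    (e @^-1` [set r | 0 <= r] `&` g @^-1` C).
  apply/seteqP; split => x /=.
    by case: (leP (e x) 0) => [|/ltW]; [left|right].
  case; first by move=> [-> ].
  move=> [e0 Cg]; case: ifP => // e0'.
  by rewrite fg //; apply/eqP; rewrite eq_le e0 e0'.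
apply: closedU; apply: closedI.
- by apply: preimage_closed => [x _|]; [exact: ce|exact: closed_le].
- by apply: preimage_closed => // x _; exact: cf.
- by apply: preimage_closed => [x _|]; [exact: ce|exact: closed_ge].
- by apply: preimage_closed => // x _; exact: cg.
Qed.

Definition clamp01 (s : R) : R := Num.max 0 (Num.min s 1).

Lemma clamp01P s : 0 <= clamp01 s <= 1.
Proof. by rewrite le_max lexx ge_max ler01 ge_min lexx orbT. Qed.

Lemma clamp01_id s : 0 <= s <= 1 -> clamp01 s = s.
Proof. by move=> /andP[s0 s1]; rewrite /clamp01 min_l // max_r. Qed.

Lemma clamp01_ge1 s : 1 <= s -> clamp01 s = 1.
Proof. by move=> s1; rewrite /clamp01 min_r // max_r. Qed.

Lemma clamp01_le0 s : s <= 0 -> clamp01 s = 0.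
Proof. by move=> s0; rewrite /clamp01 max_l // ge_min s0. Qed.

Lemma clamp01_continuous (T : topologicalType) (f : T -> R) :
  continuous f -> continuous (fun x => clamp01 (f x)).
Proof.
move=> cf; apply: (@maxr_continuous R T (fun=> 0)); first exact: cst_continuous.
by apply: (@minr_continuous R T f (fun=> 1)) => //; exact: cst_continuous.
Qed.

Local Notation I := (unit_interval R).

Definition ival (s : I) : R := val s.

Lemma ivalP s : 0 <= ival s <= 1.
Proof. exact: (set_mem (valP s)). Qed.

Lemma ival_inj : injective ival.
Proof. exact: val_inj. Qed.

Lemma ival_continuous : continuous ival.
Proof. exact: val_continuous. Qed.

Definition clamp (s : R) : I :=
  exist (fun s => s \in [set s : R | 0 <= s <= 1]) _ (mem_set (clamp01P s)).

Lemma clamp_ival s : clamp (ival s) = s.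
Proof. by apply: ival_inj; exact: clamp01_id (ivalP s). Qed.

Lemma clamp_continuous (T : topologicalType) (f : T -> R) :
  continuous f -> continuous (fun x => clamp (f x)).
Proof. by move=> cf; apply: set_type_continuous; exact: clamp01_continuous. Qed.

Lemma ival0 s : val s = 0 :> R -> s = clamp 0.
Proof. by move=> s0; rewrite -[LHS]clamp_ival; congr clamp. Qed.

Lemma ival1 s : val s = 1 :> R -> s = clamp 1.
Proof. by move=> s0; rewrite -[LHS]clamp_ival; congr clamp. Qed.

Lemma val_clamp0 : val (clamp 0) = 0 :> R.
Proof. by apply: clamp01_le0. Qed.

Lemma val_clamp1 : val (clamp 1) = 1 :> R.
Proof. by apply: clamp01_ge1. Qed.

Section Homotopies.
Variables (T X : topologicalType).

Lemma homotopy_concat (h k : T * I -> X) : continuous h -> continuous k ->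
  (forall t, h (t, clamp 1) = k (t, clamp 0)) ->
  exists l : T * I -> X, [/\ continuous l,
    forall t, l (t, clamp 0) = h (t, clamp 0),
    forall t, l (t, clamp 1) = k (t, clamp 1) &
    forall t x, (forall s, h (t, s) = x) -> (forall s, k (t, s) = x) ->
      forall s, l (t, s) = x].
Proof.
move=> ch ck hk.
have cs : continuous (fun v : T * I => ival v.2).
  by apply: comp_continuous; [exact: ival_continuous|exact: snd_continuous].
have cst (r : R) : continuous (fun _ : T * I => r) by exact: cst_continuous.
have cm (m r : R) : continuous (fun v : T * I => m * ival v.2 - r).
  apply: (@subr_continuous R _ (fun v : T * I => m * ival v.2)) => //.
  exact: (@mulr_continuous R _ (fun=> m)).
exists (fun v => if ival v.2 - 2^-1 <= 0 then h (v.1, clamp (2 * ival v.2 - 0))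
  else k (v.1, clamp (2 * ival v.2 - 1))); split => [|t|t|t x hx kx s] /=.
- apply: paste_continuous.
  + exact: (@subr_continuous R _ (fun v : T * I => ival v.2)).
  + apply: comp_continuous => //; apply: pair_continuous; first exact: fst_continuous.
    exact: clamp_continuous.
  + apply: comp_continuous => //; apply: pair_continuous; first exact: fst_continuous.
    exact: clamp_continuous.
  + move=> [t s] /= s0.
    have -> : 2 * ival s - 0 = 1 by lra.
    by have -> : 2 * ival s - 1 = 0 by lra.
- by rewrite /ival val_clamp0 ifT ?mulr0 ?subr0 //; lra.
- rewrite /ival val_clamp1 ifF ?mulr1; last by apply/negbTE; rewrite -ltNge; lra.
  by congr (k (_, clamp _)); lra.
- by case: ifP.
Qed.

Lemma homotopy_reverse (h : T * I -> X) : continuous h ->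
  continuous (fun v : T * I => h (v.1, clamp (1 - ival v.2))).
Proof.
move=> ch; apply: comp_continuous => //.
apply: pair_continuous; first exact: fst_continuous.
apply: clamp_continuous; apply: (@subr_continuous R _ (fun=> 1)).
  exact: cst_continuous.
by apply: comp_continuous; [exact: ival_continuous|exact: snd_continuous].
Qed.

End Homotopies.

Section Paths.
Variable X : topologicalType.
Implicit Types x y z : X.

Lemma path_relatedE x y : path_related R x y <->
  exists h : I * I -> X, [/\ continuous h, forall t, h (t, clamp 0) = x &
    forall t, h (t, clamp 1) = y].
Proof.
split=> [[c [cc c0 c1]]|[h [ch h0 h1]]].
  exists (fun v => c v.2); split => [|_|_] /=.
  - by apply: comp_continuous => //; exact: snd_continuous.
  - by apply: c0; exact: val_clamp0.
  - by apply: c1; exact: val_clamp1.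
exists (fun s => h (clamp 0, s)); split => [|s /ival0 ->|s /ival1 ->] //.
apply: comp_continuous => //.
by apply: (@pair_continuous _ _ _ (fun=> clamp 0) id);
  [exact: cst_continuous|exact: id_continuous].
Qed.

Lemma path_related_sym x y : path_related R x y -> path_related R y x.
Proof.
move=> /path_relatedE[h [ch h0 h1]]; apply/path_relatedE.
exists (fun v => h (v.1, clamp (1 - ival v.2))); split => [|t|t].
- exact: homotopy_reverse.
- by rewrite /= /ival val_clamp0 subr0.
- by rewrite /= /ival val_clamp1 subrr.
Qed.

Lemma path_related_trans y x z :
  path_related R x y -> path_related R y z -> path_related R x z.
Proof.
move=> /path_relatedE[h [ch h0 h1]] /path_relatedE[k [ck k0 k1]].
have [t|l [cl l0 l1 _]] := homotopy_concat ch ck; first by rewrite h1 k0.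
by apply/path_relatedE; exists l; split => // t; rewrite ?l0 ?l1.
Qed.

Lemma path_related_homotopy (T : topologicalType) (h : T * I -> X) t :
  continuous h -> path_related R (h (t, clamp 0)) (h (t, clamp 1)).
Proof.
move=> ch; exists (fun s => h (t, s)); split => [|s /ival0 ->|s /ival1 ->] //.
apply: comp_continuous => //.
by apply: (@pair_continuous _ _ _ (fun=> t) id);
  [exact: cst_continuous|exact: id_continuous].
Qed.

Lemma homotopic_relE n x (a b : cube R n -> X) : homotopic_rel x a b <->
  exists h : cube R n * I -> X, [/\ continuous h,
    forall t, h (t, clamp 0) = a t, forall t, h (t, clamp 1) = b t &
    forall t, cube_boundary t -> forall s, h (t, s) = x].
Proof.
split=> -[h [ch h0 h1 hb]]; exists h; split => //.
- by move=> t; apply: h0; exact: val_clamp0.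
- by move=> t; apply: h1; exact: val_clamp1.
- by move=> t tb s; exact: hb.
- by move=> t s /ival0 ->.
- by move=> t s /ival1 ->.
- by move=> t s tb; exact: hb.
Qed.

Lemma homotopic_rel_sym n x (a b : cube R n -> X) :
  homotopic_rel x a b -> homotopic_rel x b a.
Proof.
move=> /homotopic_relE[h [ch h0 h1 hb]]; apply/homotopic_relE.
exists (fun v => h (v.1, clamp (1 - ival v.2))); split => [|t|t|t tb s].
- exact: homotopy_reverse.
- by rewrite /= /ival val_clamp0 subr0.
- by rewrite /= /ival val_clamp1 subrr.
- exact: hb.
Qed.

Lemma homotopic_rel_trans n x (b a c : cube R n -> X) :
  homotopic_rel x a b -> homotopic_rel x b c -> homotopic_rel x a c.
Proof.
move=> /homotopic_relE[h [ch h0 h1 hb]] /homotopic_relE[k [ck k0 k1 kb]].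
have [t|l [cl l0 l1 lx]] := homotopy_concat ch ck; first by rewrite h1 k0.
apply/homotopic_relE; exists l; split => // [t|t|t tb s]; rewrite ?l0 ?l1 //.
by apply: lx => r; [exact: hb|exact: kb].
Qed.

End Paths.

(** * Transport of spheroids along paths *)
Section Transport.
Variable n : nat.

Definition cval (t : cube R n) : 'I_n -> R := val t.

Lemma cvalP t i : 0 <= cval t i <= 1.
Proof. exact: (set_mem (valP t)). Qed.

Lemma cval_continuous i : continuous (cval^~ i).
Proof.
apply: (@comp_continuous (cube R n) {ptws 'I_n -> R} R (fun w => w i) val).
  exact: (@proj_continuous _ (fun=> R) i).
exact: val_continuous.
Qed.

Lemma cclamp_subproof (v : 'I_n -> R) :
  ((fun i => clamp01 (v i)) : {ptws 'I_n -> R}) \in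
  [set t : {ptws 'I_n -> R} | forall i, 0 <= t i <= 1].
Proof. by apply/mem_set => i; exact: clamp01P. Qed.

Definition cclamp (v : 'I_n -> R) : cube R n :=
  exist (fun t => t \in [set t : {ptws 'I_n -> R} | forall i, 0 <= t i <= 1])
    _ (cclamp_subproof v).

Lemma cclamp_cval t : cclamp (cval t) = t.
Proof. by apply: val_inj; apply: funext => i; exact: clamp01_id (cvalP t i). Qed.

Lemma cclamp_continuous (T : topologicalType) (v : T -> 'I_n -> R) :
  (forall i, continuous (fun x => v x i)) -> continuous (fun x => cclamp (v x)).
Proof.
move=> cv; apply/set_type_continuous/ptws_continuous => i.
exact: clamp01_continuous.
Qed.

(** The distance to the boundary of the unit cube in the supremum norm, negative
    inside: with a sign, vanishing forces a point onto the boundary, and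
    [transport] can be pasted along the zero set. *)
Definition excess (v : 'I_n -> R) : R := \big[Num.max/0]_i `|v i - 2^-1| - 2^-1.

Lemma excess_continuous (T : topologicalType) (v : T -> 'I_n -> R) :
  (forall i, continuous (fun x => v x i)) -> continuous (fun x => excess (v x)).
Proof.
move=> cv; apply: (@subr_continuous R _ (fun x => \big[Num.max/0]_i `|v x i - 2^-1|));
  last exact: cst_continuous.
apply: continuous_big => [|i _].
  by apply: maxr_continuous; [exact: fst_continuous|exact: snd_continuous].
apply: normr_continuous; apply: (@subr_continuous R _ (fun x => v x i)) => //.
exact: cst_continuous.
Qed.

Lemma excess_le0 v : (excess v <= 0) <-> (forall i, 0 <= v i <= 1).
Proof.
rewrite subr_le0; split => [/bigmax_leP[_ le_v] i|vP].
  by have := le_v i isT; rewrite ler_norml => /andP[? ?]; apply/andP; split; lra.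
apply/bigmax_leP; split => [|i _]; first lra.
by have /andP[? ?] := vP i; rewrite ler_norml; apply/andP; split; lra.
Qed.

Lemma cclamp_boundary v : 0 <= excess v -> cube_boundary (cclamp v).
Proof.
rewrite subr_ge0 leNgt => /negP; apply: contra_notP => nb.
apply/bigmax_ltP; split => [|i _]; first lra.
rewrite ltNge; apply/negP => le_vi; apply: nb; exists i.
suff : clamp01 (v i) = 0 \/ clamp01 (v i) = 1 by [].
have [vi|vi] := leP (v i) 2^-1; [left|right].
  apply: clamp01_le0; move: le_vi; rewrite ler0_norm; lra.
apply: clamp01_ge1; move: le_vi; rewrite ger0_norm; lra.
Qed.

Definition stretch (c : R) (t : cube R n) (i : 'I_n) : R := 2^-1 + c * (cval t i - 2^-1).

Lemma stretch1 t : stretch 1 t = cval t.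
Proof. by apply: funext => i; rewrite /stretch; lra. Qed.

Lemma excess_stretch c t : 0 <= c -> cube_boundary t ->
  (c - 1) / 2 <= excess (stretch c t).
Proof.
move=> c0 [i ti]; rewrite /excess lerBrDr.
suff e : `|stretch c t i - 2^-1| = c / 2.
  have -> : (c - 1) / 2 + 2^-1 = `|stretch c t i - 2^-1| by rewrite e; lra.
  exact: (le_bigmax _ (fun i => `|stretch c t i - 2^-1|)).
have -> : stretch c t i - 2^-1 = c * (cval t i - 2^-1) by rewrite /stretch; lra.
rewrite normrM (ger0_norm c0); congr (_ * _).
have [ti0|ti1] : cval t i = 0 \/ cval t i = 1 by [].
  by rewrite ti0 sub0r normrN ger0_norm // invr_ge0.
by rewrite ti1 ger0_norm; lra.
Qed.

Lemma stretch_continuous (T : topologicalType) (c : T -> R) (t : T -> cube R n) i :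
  continuous c -> continuous t -> continuous (fun x => stretch (c x) (t x) i).
Proof.
move=> cc ct; apply: (@addr_continuous R _ (fun=> 2^-1)); first exact: cst_continuous.
apply: mulr_continuous => //.
apply: (@subr_continuous R _ (fun x => cval (t x) i)); last exact: cst_continuous.
by apply: (@comp_continuous _ _ _ (cval^~ i)) => //; exact: cval_continuous.
Qed.

Section InSpace.
Variable X : topologicalType.

(** The homotopy extension property of the cube and its boundary, by a formula
    so that it is natural in the space and continuous in [a]: the middle half
    of the cube is filled by [a], and the rays from there to the boundary by
    the path [c]. *)
Definition transport (c : I -> X) (a : cube R n -> X) (t : cube R n) : X :=
  if excess (stretch 2 t) <= 0 then a (cclamp (stretch 2 t))
  else c (clamp (2 * excess (stretch 2 t))).

Lemma transport_boundary c a t : cube_boundary t -> transport c a t = c (clamp 1).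
Proof.
move=> tb; have ge : (2 - 1) / 2 <= excess (stretch 2 t) by exact: excess_stretch.
rewrite /transport ifF; last by apply/negbTE; rewrite -ltNge; lra.
congr c; apply: ival_inj; rewrite [LHS]clamp01_ge1 ?[RHS]clamp01_ge1 //; lra.
Qed.

Lemma transport_family_continuous (T : topologicalType) (c : I -> X)
  (a : cube R n * T -> X) : continuous c -> continuous a ->
  (forall t s, cube_boundary t -> a (t, s) = c (clamp 0)) ->
  continuous (fun v : cube R n * T => transport c (fun t => a (t, v.2)) v.1).
Proof.
move=> cc ca a_bd.
have cs i : continuous (fun v : cube R n * T => stretch 2 v.1 i).
  by apply: (@stretch_continuous _ (fun=> 2)); [exact: cst_continuous|exact: fst_continuous].
apply: paste_continuous.
- exact: excess_continuous.
- apply: (@comp_continuous _ _ _ a (fun v => (cclamp (stretch 2 v.1), v.2))) => //.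
  by apply: pair_continuous; [exact: cclamp_continuous|exact: snd_continuous].
- apply: comp_continuous => //; apply: clamp_continuous.
  apply: (@mulr_continuous R _ (fun=> 2)); first exact: cst_continuous.
  exact: excess_continuous.
- move=> v ev; rewrite a_bd ?ev ?mulr0 //.
  by apply: cclamp_boundary; rewrite ev.
Qed.

Lemma transport_spheroid (c : I -> X) (a : cube R n -> X) : continuous c ->
  spheroid (c (clamp 0)) a -> spheroid (c (clamp 1)) (transport c a).
Proof.
move=> cc [ca a_bd]; split; last by move=> t; exact: transport_boundary.
have ca' : continuous (fun v : cube R n * I => a v.1).
  by apply: comp_continuous => //; exact: fst_continuous.
have ct := transport_family_continuous cc ca' (fun t _ => a_bd t).
apply: (@comp_continuous _ (cube R n * I)%type _ (fun v => transport c a v.1)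
  (fun t => (t, clamp 0))) => //.
by apply: pair_continuous; [exact: id_continuous|exact: cst_continuous].
Qed.

Lemma transport_homotopic (c : I -> X) (a b : cube R n -> X) : continuous c ->
  homotopic_rel (c (clamp 0)) a b ->
  homotopic_rel (c (clamp 1)) (transport c a) (transport c b).
Proof.
move=> cc /homotopic_relE[h [ch h0 h1 hb]]; apply/homotopic_relE.
exists (fun v => transport c (fun t => h (t, v.2)) v.1); split => [|t|t|t tb s].
- by apply: transport_family_continuous => // t s tb; exact: hb.
- by congr transport; apply: funext.
- by congr transport; apply: funext.
- exact: transport_boundary.
Qed.

(** If the boundary of the cube moves along [c] during a homotopy, transport
    along [c] undoes the homotopy: the stretching factor decreases from 2 to 1
    while the part of [c] that is run shrinks to its end point. *)
Lemma transport_free_homotopy (c : I -> X) (h : cube R n * I -> X) :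
  continuous h -> (forall t s, cube_boundary t -> h (t, s) = c s) ->
  homotopic_rel (c (clamp 1)) (transport c (fun t => h (t, clamp 0)))
    (fun t => h (t, clamp 1)).
Proof.
move=> ch hb; apply/homotopic_relE.
pose st (v : cube R n * I) := stretch (2 - ival v.2) v.1.
pose level (v : cube R n * I) := ival v.2 + 2 * Num.max 0 (excess (st v)).
have ci : continuous (fun v : cube R n * I => ival v.2).
  by apply: comp_continuous; [exact: ival_continuous|exact: snd_continuous].
have cst (T : topologicalType) (r : R) : continuous (fun _ : T => r) by exact: cst_continuous.
have cs i : continuous (fun v => st v i).
  apply: stretch_continuous; last exact: fst_continuous.
  exact: (@subr_continuous R _ (fun=> 2)).
exists (fun v => h (cclamp (st v), clamp (level v))); split => [|t|t|t tb s].
- apply: comp_continuous => //; apply: pair_continuous; first exact: cclamp_continuous.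
  apply: clamp_continuous; apply: addr_continuous => //.
  apply: (@mulr_continuous R _ (fun=> 2)) => //.
  apply: (@maxr_continuous R _ (fun=> 0)) => //.
  exact: excess_continuous.
- rewrite /transport /level /st /= /ival val_clamp0 subr0 add0r.
  case: (leP (excess _) 0) => [_|e0]; first by rewrite mulr0.
  by rewrite hb //; apply: cclamp_boundary; exact: ltW.
- rewrite /level /st /= /ival val_clamp1.
  have -> : 2 - 1 = 1 :> R by lra.
  rewrite stretch1 cclamp_cval max_l; first by rewrite mulr0 addr0.
  by apply/excess_le0 => i; exact: cvalP.
- have /andP[s0 s1] := ivalP s.
  have ge : (2 - ival s - 1) / 2 <= excess (st (t, s)).
    by apply: excess_stretch => //; rewrite /=; lra.
  rewrite hb; last by apply: cclamp_boundary; lra.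
  congr c; apply: ival_inj; rewrite [LHS]clamp01_ge1 ?[RHS]clamp01_ge1 //.
  by rewrite /level max_r /=; lra.
Qed.

End InSpace.

Lemma transport_comp (X Y : topologicalType) (f : X -> Y) (c : I -> X) a t :
  f (transport c a t) = transport (f \o c) (f \o a) t.
Proof. by rewrite /transport; case: ifP. Qed.

End Transport.

(** * Coherent homotopy equivalences *)

(** Half of the coherence of an adjoint equivalence, on the nose: the path
    [f \o ceq_P (x, _)] and the path [ceq_Q (f x, _)] agree. *)
Record coherent_equivalence (X Y : topologicalType) (f : X -> Y) := CoherentEquivalence {
  ceq_inv : Y -> X;
  ceq_P : X * I -> X;
  ceq_Q : Y * I -> Y;
  ceq_continuous : continuous f;
  ceq_inv_continuous : continuous ceq_inv;
  ceq_P_continuous : continuous ceq_P;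
  ceq_Q_continuous : continuous ceq_Q;
  ceq_P0 : forall x, ceq_P (x, clamp 0) = ceq_inv (f x);
  ceq_P1 : forall x, ceq_P (x, clamp 1) = x;
  ceq_Q0 : forall y, ceq_Q (y, clamp 0) = f (ceq_inv y);
  ceq_Q1 : forall y, ceq_Q (y, clamp 1) = y;
  ceq_coherent : forall x s, f (ceq_P (x, s)) = ceq_Q (f x, s) }.

(** Both homotopies contribute a way of moving the base point [f (g (f x))] to
    [f x], and the coherence makes them agree.  So an inverse to the
    action of [f] on spheroids is [g] followed by transport along [P]. *)
Lemma coherent_equivalence_weak (X Y : topologicalType) (f : X -> Y) :
  coherent_equivalence f -> weak_equivalence R f.
Proof.
move=> [g P Q cf cg cP cQ P0 P1 Q0 Q1 fP].
pose c x s := P (x, s).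
have cc x : continuous (c x).
  apply: comp_continuous => //.
  by apply: (@pair_continuous _ _ _ (fun=> x) id);
    [exact: cst_continuous|exact: id_continuous].
(* a homotopy from [g \o f \o a] to [a] is undone by transport along [c x] *)
have back n x (a : cube R n -> X) : spheroid x a ->
    homotopic_rel x (transport (c x) (g \o f \o a)) a.
  move=> [ca a_bd].
  have ch : continuous (fun v : cube R n * I => P (a v.1, v.2)).
    apply: comp_continuous => //; apply: pair_continuous; last exact: snd_continuous.
    by apply: comp_continuous => //; exact: fst_continuous.
  have H := @transport_free_homotopy n X (c x) _ ch
    (fun t s tb => congr1 (fun y => P (y, s)) (a_bd t tb)).
  have e0 : (fun t => P (a t, clamp 0)) = g \o f \o a by apply: funext => t; exact: P0.
  have e1 : (fun t => P (a t, clamp 1)) = a by apply: funext => t; exact: P1.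
  by rewrite /= e0 e1 [c x _]P1 in H.
split => //.
- split=> [y|x x' ff'].
    by exists (g y); rewrite -Q0 -[X in path_related _ _ X]Q1; exact: path_related_homotopy.
  apply: (@path_related_trans _ (g (f x))).
    apply: path_related_sym; rewrite -P0 -[X in path_related _ _ X]P1.
    exact: path_related_homotopy.
  apply: (@path_related_trans _ (g (f x'))).
    have [d [cd d0 d1]] := ff'.
    exists (g \o d); split => [|s /d0 /= ->|s /d1 /= ->] //.
    exact: comp_continuous.
  rewrite -P0 -[X in path_related _ _ X]P1; exact: path_related_homotopy.
- move=> n x b [cb b_bd]; exists (transport (c x) (g \o b)).
    rewrite -{1}(P1 x); apply: transport_spheroid => //; split.
      exact: comp_continuous.
    by move=> t tb; rewrite /= b_bd // /c P0.
  have ch : continuous (fun v : cube R n.+1 * I => Q (b v.1, v.2)).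
    apply: comp_continuous => //; apply: pair_continuous; last exact: snd_continuous.
    by apply: comp_continuous => //; exact: fst_continuous.
  have H := @transport_free_homotopy _ Y (f \o c x) _ ch (fun t s tb =>
    etrans (congr1 (fun y => Q (y, s)) (b_bd t tb)) (esym (fP x s))).
  have e0 : (fun t => Q (b t, clamp 0)) = f \o (g \o b) by apply: funext => t; exact: Q0.
  have e1 : (fun t => Q (b t, clamp 1)) = b by apply: funext => t; exact: Q1.
  rewrite /= e0 e1 [c x _]P1 in H.
  have -> // : f \o transport (c x) (g \o b) = transport (f \o c x) (f \o (g \o b)).
  by apply: funext => t; exact: transport_comp.
- move=> n x a a' sa sa' faa'.
  apply: homotopic_rel_trans (back _ _ _ sa').
  apply: homotopic_rel_trans (homotopic_rel_sym (back _ _ _ sa)) _.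
  rewrite -{1}(P1 x); apply: transport_homotopic => //.
  have [h [ch h0 h1 hb]] := faa'.
  exists (g \o h); split => [|t s s0|t s s1|t s tb] /=.
  + exact: comp_continuous.
  + by rewrite h0.
  + by rewrite h1.
  + by rewrite hb // /c P0.
Qed.

Lemma coherent_equivalence_homeo (T S X Y : topologicalType) (f : T -> S)
  (d : X -> T) (d' : T -> X) (e : S -> Y) (e' : Y -> S) :
  continuous d -> continuous d' -> cancel d d' -> cancel d' d ->
  continuous e -> continuous e' -> cancel e e' -> cancel e' e ->
  coherent_equivalence f -> coherent_equivalence (fun x => e (f (d x))).
Proof.
move=> cd cd' dK d'K ce ce' eK e'K [g P Q cf cg cP cQ P0 P1 Q0 Q1 fP].
apply: (@CoherentEquivalence _ _ _ (fun y => d' (g (e' y)))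
  (fun v => d' (P (d v.1, v.2))) (fun v => e (Q (e' v.1, v.2)))) => //=.
- by apply: comp_continuous => //; apply: comp_continuous.
- by apply: comp_continuous => //; apply: comp_continuous.
- apply: comp_continuous => //; apply: comp_continuous => //.
  apply: pair_continuous; last exact: snd_continuous.
  by apply: comp_continuous => //; exact: fst_continuous.
- apply: comp_continuous => //; apply: comp_continuous => //.
  apply: pair_continuous; last exact: snd_continuous.
  by apply: comp_continuous => //; exact: fst_continuous.
- by move=> x; rewrite eK P0.
- by move=> x; rewrite P1 dK.
- by move=> y; rewrite d'K Q0.
- by move=> y; rewrite Q1 e'K.
- by move=> x s; rewrite d'K eK fP.
Qed.

End Paste.

Lemma mono_const_subproof p q (k : 'I_q.+1) (i j : 'I_p.+1) : (i <= j)%N -> (k <= k)%N.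
Proof. by []. Qed.

Definition mono_const p q (k : 'I_q.+1) : monotone_map p q :=
  Mono (@mono_const_subproof p q k).

(** * Thomason's map over a category with a terminal object *)
Definition const_chain (C : category) (c : C) q : chain C q :=
  @Chain C q (fun=> c) (fun _ _ _ => idc c) (fun _ _ => erefl)
    (fun _ _ _ _ _ _ => esym (cmp1f (idc c))).

Section Terminal.
Variables (D : category) (F : cat_functor D) (star : D).
Variable term : forall c : D, hom c star.
Hypothesis term_uniq : forall (c : D) (f g : hom c star), f = g.

(** The values on objects and morphisms of a functor on [D * [1]] that contracts
    [D] onto [star].  The coordinate in [1] is a flag, because a simplex of the
    nerve of [1] is a monotone sequence of flags. *)
Definition contr (e : bool) (c : D) : D := if e then c else star.

Definition to_contr (e : bool) (c : D) : hom c (contr e c) :=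
  match e with true => idc c | false => term c end.

Definition contr_mor (e e' : bool) (c c' : D) (le : e' ==> e) (f : hom c c') :
    hom (contr e c) (contr e' c') :=
  match e', e return e' ==> e -> hom (contr e c) (contr e' c') with
  | false, e => fun=> term (contr e c)
  | true, true => fun=> f
  | true, false => fun le => False_rect _ (notF le)
  end le.

Lemma contr_mor_nat e e' c c' (le : e' ==> e) (f : hom c c') :
  contr_mor le f \oc to_contr e c = to_contr e' c' \oc f.
Proof.
by case: e' e le => [] [] //= le; [rewrite cmpf1 cmp1f|exact: term_uniq..].
Qed.

Lemma contr_mor_id e c (le : e ==> e) : contr_mor le (idc c) = idc (contr e c).
Proof. by case: e le => //= le; exact: term_uniq. Qed.

Lemma contr_mor_cmp e e' e'' c c' c'' (le : e' ==> e) (le' : e'' ==> e')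
  (le'' : e'' ==> e) (g : hom c' c'') (f : hom c c') :
  contr_mor le'' (g \oc f) = contr_mor le' g \oc contr_mor le f.
Proof. by case: e'' e' e le le' le'' => [] [] [] //= *; exact: term_uniq. Qed.

Lemma cf_contr e e' c c' (le : e' ==> e) (f : hom c c') :
  functor_comp (cf1 F (contr_mor le f)) (cf1 F (to_contr e c)) =
  functor_comp (cf1 F (to_contr e' c')) (cf1 F f).
Proof. by rewrite -!cf1_cmp contr_mor_nat. Qed.

Lemma cf_contrE e e' c c' (le : e' ==> e) (f : hom c c') (x : F c) :
  cf1 F (contr_mor le f) (cf1 F (to_contr e c) x) =
  cf1 F (to_contr e' c') (cf1 F f x).
Proof. by rewrite -!cf1_cmpE contr_mor_nat. Qed.

(** A simplex of the standard 1-simplex selects a final segment of the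
    vertices; those stay in place, and the others move to [star]. *)
Definition flag q (b : monotone_map q 1) (i : 'I_q.+1) : bool := (0 < b i)%N.

Lemma flag_le q (b : monotone_map q 1) (i j : 'I_q.+1) :
  (i <= j)%N -> flag b i ==> flag b j.
Proof. by move=> ij; apply/implyP => /leq_trans; apply; exact: monoP. Qed.

Definition contr_chain q (c : chain D q) (b : monotone_map q 1) : chain D q.
Proof.
refine (@Chain D q (fun i => contr (flag b i) (cob c i))
  (fun i j le => contr_mor (flag_le b le) (cmor c le)) _ _).
- abstract (by move=> i le; rewrite cmor_id; exact: contr_mor_id).
- abstract (by move=> i j k ij jk ik; rewrite (cmor_cmp c ij jk ik);
    exact: contr_mor_cmp).
Defined.

Lemma contr_chain_nat p q (a : monotone_map p q) (c : chain D q) b :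
  contr_chain (chain_act a c) (mono_comp b a) = chain_act a (contr_chain c b).
Proof.
apply: chain_ext => // i j le /=.
by rewrite (Prop_irrelevance (flag_le (mono_comp b a) le) (flag_le b (monoP a le))).
Qed.

Lemma contr_chain1 q (c : chain D q) : contr_chain c (mono_const q ord_max) = c.
Proof. exact: chain_ext. Qed.

Lemma contr_chain0 q (c : chain D q) :
  contr_chain c (mono_const q ord0) = const_chain star q.
Proof. by apply: chain_ext => // i j le; congr Arr; exact: term_uniq. Qed.

(** The simplex of [F (c_q)] moves to [F star] only if the last vertex does. *)
Definition hocolim_contr q (z : hocolim F q) (b : monotone_map q 1) : hocolim F q :=
  existT (fun c : chain D q => chain (F (cob c ord_max)) q)
    (contr_chain (projT1 z) b)
    (chain_map (cf1 F (to_contr (flag b ord_max) (cob (projT1 z) ord_max))) (projT2 z)).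

Lemma Arr_functor_eq (C E : category) (G G' : functor C E) (c c' : C) (f : hom c c') :
  G = G' -> Arr (fmor G f) = Arr (fmor G' f).
Proof. by move=> ->. Qed.

Lemma hocolim_contr_nat p q (a : monotone_map p q) (z : hocolim F q) b :
  hocolim_contr (sact a z) (mono_comp b a) = sact a (hocolim_contr z b).
Proof.
case: z => c x; apply: hocell_ext => [|i|i j le]; first exact: contr_chain_nat.
  by congr existT; exact/esym/cf_contrE.
congr existT; rewrite /=.
exact: (Arr_functor_eq (cmor x (monoP a le)) (esym (cf_contr _ _))).
Qed.

Lemma hocolim_contr1 q (z : hocolim F q) :
  hocolim_contr z (mono_const q ord_max) = z.
Proof.
case: z => c x; apply: hocell_ext => [|i|i j le]; first exact: contr_chain1.
  by rewrite /= cf1_id.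
by rewrite /= cf1_id.
Qed.

(** The same contraction on the Grothendieck construction; there it is the
    natural transformation from the identity to the pushforward to
    [F star]. *)
Section GrothContr.
Variables (q : nat) (v : chain (groth F) q) (b : monotone_map q 1).

Definition groth_contr_ob (i : 'I_q.+1) : groth F :=
  existT _ (contr (flag b i) (projT1 (cob v i)))
    (cf1 F (to_contr (flag b i) (projT1 (cob v i))) (projT2 (cob v i))).

Definition groth_contr_mor (i j : 'I_q.+1) (le : (i <= j)%N) :
    hom (groth_contr_ob j) (groth_contr_ob i) :=
  existT _ (contr_mor (flag_le b le) (projT1 (cmor v le)))
    (fmor (cf1 F (to_contr (flag b i) (projT1 (cob v i)))) (projT2 (cmor v le))
       \oc id_to (cf_contrE (flag_le b le) (projT1 (cmor v le)) (projT2 (cob v j)))).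

Lemma groth_contr_id (i : 'I_q.+1) (le : (i <= i)%N) :
  groth_contr_mor le = idc (groth_contr_ob i).
Proof.
apply: groth_hom_ext; rewrite /= cmor_id; first exact: contr_mor_id.
rewrite Arr_id_tor (Arr_fmor erefl (Arr_id_to _)) fmor1.
exact/esym/Arr_id_to.
Qed.

Lemma groth_contr_cmp (i j k : 'I_q.+1) (ij : (i <= j)%N) (jk : (j <= k)%N)
  (ik : (i <= k)%N) : groth_contr_mor ik = groth_contr_mor ij \oc groth_contr_mor jk.
Proof.
apply: groth_hom_ext; first by rewrite /= (cmor_cmp v ij jk ik); exact: contr_mor_cmp.
rewrite /= !Arr_id_tor (cmor_cmp v ij jk ik) /=.
rewrite (Arr_fmor erefl (Arr_id_tor _ _)) fmorM.
apply: Arr_cmp; first by rewrite Arr_id_tor.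
rewrite (Arr_fmor erefl (Arr_id_tor _ _)).
exact: (Arr_functor_eq (projT2 (cmor v jk)) (esym (cf_contr _ _))).
Qed.

Definition groth_contr : chain (groth F) q := Chain groth_contr_id groth_contr_cmp.

End GrothContr.

Lemma groth_contr_nat p q (a : monotone_map p q) (v : chain (groth F) q) b :
  groth_contr (chain_act a v) (mono_comp b a) = chain_act a (groth_contr v b).
Proof.
apply: chain_ext => // i j le; apply: groth_Arr_ext => //.
  by rewrite (Prop_irrelevance (flag_le (mono_comp b a) le) (flag_le b (monoP a le))).
by rewrite !Arr_id_tor.
Qed.

Lemma groth_obj_eta (u : groth F) x : x = projT2 u -> existT _ (projT1 u) x = u.
Proof. by case: u x => c y x /= ->. Qed.

Lemma groth_Arr_eta (u v : groth F) (m : hom u v) x y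
  (h : hom (cf1 F (projT1 m) x) y) : x = projT2 u -> y = projT2 v ->
  Arr h = Arr (projT2 m) ->
  @Arr (groth F) (existT _ (projT1 u) x) (existT _ (projT1 v) y)
    (existT _ (projT1 m) h) = Arr m.
Proof.
by case: u v m x y h => c x [c' y] [f h] x' y' h' /= ? ?; exact: groth_Arr_ext.
Qed.

Lemma groth_contr1 q (v : chain (groth F) q) :
  groth_contr v (mono_const q ord_max) = v.
Proof.
apply: chain_ext => [i|i j le]; first by apply: groth_obj_eta; exact: cf1_idE.
apply: groth_Arr_eta; [exact: cf1_idE..|].
rewrite Arr_id_tor; exact: (Arr_functor_eq (projT2 (cmor v le)) (cf1_id F _)).
Qed.

(** This strict compatibility is what makes the homotopy equivalence
    coherent: in both composites the point of [F c_q] is pushed forward to the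
    same place, by naturality of [to_contr]. *)
Lemma groth_contr_thomason q (z : hocolim F q) b :
  thomason_fun (hocolim_contr z b) = groth_contr (thomason_fun z) b.
Proof.
case: z => c x; apply: chain_ext => [i|i j le].
  by congr existT; exact: cf_contrE.
apply: groth_Arr_ext; [exact: cf_contrE..|by []|].
rewrite !Arr_id_tor (Arr_fmor erefl (Arr_id_tor _ _)).
exact: (Arr_functor_eq (cmor x le) (cf_contr _ _)).
Qed.

Lemma cf_termE c c' (f : hom c c') (x : F c) :
  cf1 F (term c) x = cf1 F (term c') (cf1 F f x).
Proof. by rewrite -cf1_cmpE; congr (cf1 F _ x); exact: term_uniq. Qed.

Lemma cf_term c c' (f : hom c c') :
  cf1 F (term c) = functor_comp (cf1 F (term c')) (cf1 F f).
Proof. by rewrite -cf1_cmp; congr (cf1 F _); exact: term_uniq. Qed.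

Definition to_star_mor (u v : groth F) (m : hom u v) :
    hom (cf1 F (term (projT1 u)) (projT2 u)) (cf1 F (term (projT1 v)) (projT2 v)) :=
  fmor (cf1 F (term (projT1 v))) (projT2 m) \oc id_to (cf_termE (projT1 m) (projT2 u)).

Lemma to_star_mor1 u : to_star_mor (idc u) = idc _.
Proof.
apply: Arr_inj; rewrite Arr_id_tor (Arr_fmor erefl (Arr_id_to _)) fmor1.
by apply: Arr_idc.
Qed.

Lemma to_star_morM u v w (m' : hom v w) (m : hom u v) :
  to_star_mor (m' \oc m) = to_star_mor m' \oc to_star_mor m.
Proof.
apply: Arr_inj; rewrite Arr_id_tor (Arr_fmor erefl (Arr_id_tor _ _)) fmorM.
apply: Arr_cmp; first by rewrite Arr_id_tor.
rewrite Arr_id_tor.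
exact: (Arr_functor_eq (projT2 m) (esym (cf_term _))).
Qed.

Definition to_star : functor (groth F) (F star) :=
  @Functor (groth F) (F star) (fun u => cf1 F (term (projT1 u)) (projT2 u))
    to_star_mor to_star_mor1 to_star_morM.

Definition thomason_inv_fun q (v : nerve (groth F) q) : hocolim F q :=
  existT (fun c : chain D q => chain (F (cob c ord_max)) q)
    (const_chain star q) (chain_map to_star v).

Lemma thomason_inv_nat p q (a : monotone_map p q) (v : nerve (groth F) q) :
  thomason_inv_fun (sact a v) = sact a (thomason_inv_fun v).
Proof.
apply: hocell_ext => [|i|i j le]; first exact: chain_ext.
  by rewrite /= cf1_id.
by rewrite /= cf1_id.
Qed.

Definition thomason_inv : smap (nerve (groth F)) (hocolim F) := SMap thomason_inv_nat.

Lemma hocolim_contr0 q (z : hocolim F q) :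
  hocolim_contr z (mono_const q ord0) = thomason_inv_fun (thomason_fun z).
Proof.
case: z => c x; apply: hocell_ext => [|i|i j le]; first exact: contr_chain0.
  by congr existT; exact: cf_termE.
congr existT; rewrite [RHS]Arr_id_tor [RHS](Arr_fmor erefl (Arr_id_tor _ _)).
exact: (Arr_functor_eq (cmor x le) (cf_term _)).
Qed.

Lemma groth_contr0 q (v : chain (groth F) q) :
  groth_contr v (mono_const q ord0) = thomason_fun (thomason_inv_fun v).
Proof.
apply: chain_ext => [i|i j le]; first by congr existT; exact/esym/cf1_idE.
apply: groth_Arr_ext; [exact/esym/cf1_idE|exact/esym/cf1_idE|exact: term_uniq|].
rewrite Arr_id_tor [RHS]Arr_id_tor.
rewrite [RHS](Arr_functor_eq _ (cf1_id F _)) [RHS]Arr_id_tor //.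
Qed.

End Terminal.

(** * Realization of simplicial homotopies *)
Section PrismSection.
Variable R : realType.

Definition prism_inv p q : simplex R p * simplex R q -> realization R (disc (prism p q)) :=
  s2val (cid2 (prism_section p q R)).

Lemma prism_inv_continuous p q : continuous (@prism_inv p q).
Proof. exact: s2valP (cid2 (prism_section p q R)). Qed.

Lemma prism_invE p q n (a : monotone_map n p) (b : monotone_map n q) (w : simplex R n) :
  prism_inv (push a w, push b w) = rpoint (Z := disc (prism p q)) (a, b) w.
Proof. exact: (s2valP' (cid2 (prism_section p q R))). Qed.

Lemma unit_interval_compact : compact [set: unit_interval R].
Proof.
apply: set_type_compact.
have -> : [set s : R | 0 <= s <= 1] = `[0, 1]%classic.
  by apply/seteqP; split => s; rewrite /= in_itv.
exact: segment_compact.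
Qed.

Lemma unit_interval_hausdorff : hausdorff_space (unit_interval R).
Proof. exact/set_type_hausdorff/Rhausdorff. Qed.

(** The time [s] is the weight of the vertex 1, so that the constant map to the
    vertex 0 is the start of a homotopy. *)
Definition edge_weight (s : unit_interval R) (i : 'I_2) : R :=
  if i == ord0 then 1 - ival s else ival s.

Lemma edge_subproof s : (edge_weight s : {ptws 'I_2 -> R}) \in @simplex_set R 1.
Proof.
have /andP[s0 s1] := ivalP s.
apply/mem_set; split => [i|].
  by rewrite /edge_weight; case: ifP => //; rewrite subr_ge0.
by rewrite !big_ord_recl big_ord0 /edge_weight /= addr0 subrK.
Qed.

Definition edge (s : unit_interval R) : simplex R 1 :=
  exist (fun u => u \in @simplex_set R 1) _ (edge_subproof s).

Lemma edge_continuous : continuous edge.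
Proof.
apply: simplex_continuous => i.
rewrite /weight /= /edge_weight; case: (i == ord0); last exact: ival_continuous.
apply: (@subr_continuous R _ (fun=> 1)); first exact: cst_continuous.
exact: ival_continuous.
Qed.

Lemma push_mono_const p q (k : 'I_q.+1) (t : simplex R p) j :
  weight (push (mono_const p k) t) j = (k == j)%:R.
Proof.
rewrite weight_push /=; have [_|_] := eqVneq k j; first by rewrite weight_sum.
by rewrite big_pred0.
Qed.

Lemma edge0 p (t : simplex R p) : push (mono_const p ord0) t = edge (clamp 0).
Proof.
apply: simplex_ext => i; rewrite push_mono_const eq_sym.
rewrite /weight /= /edge_weight /ival val_clamp0 subr0.
by case: ifP.
Qed.

Lemma edge1 p (t : simplex R p) : push (mono_const p ord_max) t = edge (clamp 1).
Proof.
apply: simplex_ext => i; rewrite push_mono_const eq_sym.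
rewrite /weight /= /edge_weight /ival val_clamp1 subrr.
have [->//|] := eqVneq i ord0; have [->//|] := eqVneq i ord_max.
by case: i => -[|[|]].
Qed.

End PrismSection.

Section Homotopy.
Variables (R : realType) (T S : sset).
Variable H : forall n, T n -> monotone_map n 1 -> S n.
Hypothesis H_nat : forall p q (a : monotone_map p q) (z : T q) b,
  H (sact a z) (mono_comp b a) = sact a (H z b).

Lemma simplex_homotopy_nat n (z : T n) p q (c : monotone_map p q) (ab : prism n 1 q) :
  H (sact (sact c ab).1 z) (sact c ab).2 = sact c (H (sact ab.1 z) ab.2).
Proof. by rewrite /= sact_comp H_nat. Qed.

Definition simplex_homotopy n (z : T n) : smap (prism n 1) S :=
  @SMap (prism n 1) S (fun m ab => H (sact ab.1 z) ab.2) (@simplex_homotopy_nat n z).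

(** The points of [|T|] on [z] at time [s] run through the product of two
    simplices, whose simplices [(a, b)] are sent to [H (a^* z) b]. *)
Definition cell_homotopy n (z : T n) (t : simplex R n) (s : unit_interval R) :
    realization R (disc S) :=
  realization_map (disc_map (simplex_homotopy z)) (prism_inv (t, edge s)).

Lemma cell_homotopyE m n (z : T n) (a : monotone_map m n) b (w : simplex R m) s :
  push b w = edge s ->
  cell_homotopy z (push a w) s = rpoint (Z := disc S) (H (sact a z) b) w.
Proof. by rewrite /cell_homotopy => <-; rewrite prism_invE realization_mapE. Qed.

Lemma cell_homotopy_glue p q (a : monotone_map p q) (z : T q) (t : simplex R p) s :
  cell_homotopy (sact a z) t s = cell_homotopy z (push a t) s.
Proof.
have [w [c [b [<- bw]]]] := simplex_refinement t (edge s).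
by rewrite -push_comp !(cell_homotopyE _ _ bw) sact_comp.
Qed.

Definition realized_homotopy (x : realization R (disc T) * unit_interval R) :
    realization R (disc S) :=
  rlift (Z := disc T) cell_homotopy x.1 x.2.

Lemma realized_homotopyE m n (z : T n) (a : monotone_map m n) b (w : simplex R m) s :
  push b w = edge s ->
  realized_homotopy (rpoint (Z := disc T) z (push a w), s) =
  rpoint (Z := disc S) (H (sact a z) b) w.
Proof.
move=> bw; rewrite /realized_homotopy rliftE; first exact: cell_homotopyE.
by move=> p q c y t; apply: funext => r; exact: cell_homotopy_glue.
Qed.

Lemma realized_homotopy_cst n (z : T n) k (t : simplex R n) s :
  push (mono_const n k) t = edge s ->
  realized_homotopy (rpoint (Z := disc T) z t, s) =
  rpoint (Z := disc S) (H z (mono_const n k)) t.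
Proof.
by move=> e; have := realized_homotopyE z (mono_id n) e; rewrite push_id sact_id.
Qed.

Lemma realized_homotopy_continuous : continuous realized_homotopy.
Proof.
apply: (@rlift_prod_continuous R (disc T) _ _ cell_homotopy).
- exact/compact_locally_compact/unit_interval_compact.
- exact: unit_interval_hausdorff.
- exact: cell_homotopy_glue.
move=> n.
apply: (@comp_continuous _ (disc_cell T n * (simplex R n * unit_interval R))%type _
  (fun x => cell_homotopy (x.1 : T n) x.2.1 x.2.2) (fun x => (x.1.1, (x.1.2, x.2)))).
  apply: (@discrete_prod_continuous {classic T n} _ _
    (fun z x => cell_homotopy (z : T n) x.1 x.2)) => z.
  apply: comp_continuous; first exact: realization_map_continuous.
  apply: comp_continuous; first exact: prism_inv_continuous.
  apply: pair_continuous; first exact: fst_continuous.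
  by apply: comp_continuous; [exact: edge_continuous|exact: snd_continuous].
apply: pair_continuous; first by apply: comp_continuous; exact: fst_continuous.
apply: pair_continuous; last exact: snd_continuous.
by apply: comp_continuous; [exact: snd_continuous|exact: fst_continuous].
Qed.

End Homotopy.

Lemma realized_homotopy_map (R : realType) (T S T' S' : sset) H H' H_nat H'_nat
  (f : smap T S) (f' : smap T' S') :
  (forall n (z : T n) b, smap_fun f' (H n z b) = H' n (smap_fun f z) b) ->
  forall u s,
  realization_map (disc_map f') (@realized_homotopy R T T' H H_nat (u, s)) =
  @realized_homotopy R S S' H' H'_nat (realization_map (disc_map f) u, s).
Proof.
move=> fH u s; elim/realization_ind: u => n z t.
have [w [a [b [<- bw]]]] := simplex_refinement t (edge s).
rewrite (realized_homotopyE H_nat _ _ bw) !realization_mapE /=.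
by rewrite (realized_homotopyE H'_nat _ _ bw) fH smap_nat.
Qed.

(** * The inverse of the identification of the bar construction *)
Section PorbitEta.
Variables (G : groupType) (X : cat_functor (opp_cat (orbit_cat G))).

Lemma cat_Xp_ob_eta (v : porbit_obj G) (B : coset (projT1 v)) (y : X (projT1 v)) :
  B = projT2 v ->
  existT (fun u => obj (cat_Xp X u)) (existT (fun H => coset H) (projT1 v) B) y =
  existT (fun u => obj (cat_Xp X u)) v y.
Proof. by case: v B y => H C B y /= ->. Qed.

Lemma cat_Xp_mor_eta (v : porbit_obj G) (B : coset (projT1 v)) (y : arrow (X (projT1 v))) :
  B = projT2 v ->
  existT (fun u => arrow (cat_Xp X u)) (existT (fun H => coset H) (projT1 v) B) y =
  existT (fun u => arrow (cat_Xp X u)) v y.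
Proof. by case: v B y => H C B y /= ->. Qed.

Lemma porbit_Arr_eta (u v : porbit_obj G) (f : porbit_hom u v) A B
  (g : porbit_hom (existT _ (projT1 u) A) (existT _ (projT1 v) B)) :
  A = projT2 u -> B = projT2 v -> sval g = sval f ->
  @Arr (porbit_cat G) _ _ g = @Arr (porbit_cat G) u v f.
Proof.
case: u v f A B g => H A [K B] f A' B' g /= ? ?; subst A' B' => e.
by congr (Arr _); exact: porbit_hom_ext.
Qed.

End PorbitEta.

Lemma sigT_prod_continuous (I : choiceType) (X : I -> topologicalType)
  (U V : topologicalType) (f : forall i, X i * U -> V) :
  (forall i, continuous (f i)) ->
  continuous (fun x : {i & X i} * U => f (projT1 x.1) (projT2 x.1, x.2)).
Proof.
move=> cf [[i x] u] A /= /(cf i (x, u)) [[P Q] /= [nP nQ] PQA].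
exists (existT _ i @` P, Q) => /=; first by split => //; exact: existT_nbhs.
by move=> [_ v] [/= [y Py <-] Qv]; exact: (PQA (y, v)).
Qed.

(** The map from a product of two simplices to the diagonal that corresponds to
    a bisimplex, by the Yoneda lemma. *)
Section Bisimplex.
Variables (B : bisset) (n p : nat) (z : B n p).

Lemma bisimplex_nat k l (d : monotone_map k l) (ab : prism p n l) :
  sact (sact d ab).1 (smap_fun (bface B (sact d ab).2) z) =
  sact d (sact ab.1 (smap_fun (bface B ab.2) z) : diag B l).
Proof. by rewrite /= /diag_act bface_comp sact_comp !smap_nat. Qed.

Definition bisimplex : smap (prism p n) (diag B) :=
  @SMap (prism p n) (diag B)
    (fun l ab => sact ab.1 (smap_fun (bface B ab.2) z) : diag B l) bisimplex_nat.

End Bisimplex.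

Section CTopInverse.
Variables (R : realType) (G : groupType) (X : cat_functor (opp_cat (orbit_cat G))).

Local Notation OG := (opp_cat (orbit_cat G)).
Local Notation BX := (B_functor R X).
Local Notation hoc := (hocolim (cat_Xp X)).

(** A point of the first orbit is carried to all other orbits by the maps of
    the chain; this lifts the chain to the category of pointed orbits. *)
Section Pointing.
Variables (n : nat) (c : chain OG n) (A : coset (cob c ord0)).

Definition pointed_ob (i : 'I_n.+1) : opp_cat (porbit_cat G) :=
  existT (fun H : subgroup G => coset H) (cob c i)
    ((cmor c (ord0_le i) : orbit_map _ _) A).

Lemma pointed_mor_subproof (i j : 'I_n.+1) (le : (i <= j)%N) :
  (cmor c le : orbit_map _ _) (projT2 (pointed_ob i)) = projT2 (pointed_ob j).
Proof. by rewrite /= (cmor_cmp c (ord0_le i) le (ord0_le j)). Qed.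

Definition pointed_mor (i j : 'I_n.+1) (le : (i <= j)%N) :
    @hom (opp_cat (porbit_cat G)) (pointed_ob j) (pointed_ob i) :=
  exist _ (cmor c le : orbit_map _ _) (pointed_mor_subproof le).

Lemma pointed_mor_id (i : 'I_n.+1) (le : (i <= i)%N) : pointed_mor le = idc (pointed_ob i).
Proof. by apply: porbit_hom_ext; exact: (cmor_id c le). Qed.

Lemma pointed_mor_cmp (i j k : 'I_n.+1) (ij : (i <= j)%N) (jk : (j <= k)%N)
  (ik : (i <= k)%N) : pointed_mor ik = pointed_mor ij \oc pointed_mor jk.
Proof. by apply: porbit_hom_ext; exact: (cmor_cmp c ij jk ik). Qed.

Definition pointed_chain : chain (opp_cat (porbit_cat G)) n :=
  Chain pointed_mor_id pointed_mor_cmp.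

End Pointing.

Lemma pointed_chain_act p q (a : monotone_map p q) (c : chain OG q) (A : coset (cob c ord0)) :
  @pointed_chain p (chain_act a c) (ctop_first a A) = chain_act a (pointed_chain A).
Proof.
have e (i : 'I_p.+1) : (cmor (chain_act a c) (ord0_le i) : orbit_map _ _) (ctop_first a A) =
    (cmor c (ord0_le (a i)) : orbit_map _ _) A.
  by rewrite (cmor_cmp c (ord0_le (a ord0)) (monoP a (ord0_le i)) (ord0_le (a i))).
apply: chain_ext => [i|i j le]; first by rewrite /= /pointed_ob /= e.
exact: (Arr_opp (porbit_Arr_ext _ _ (e i) (e j) erefl)).
Qed.

Lemma pointed_chain_forget n (c : chain (opp_cat (porbit_cat G)) n) :
  pointed_chain (c := chain_map (functor_opp (porbit_forget G)) c)
    (projT2 (cob c ord0 : porbit_obj G)) = c.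
Proof.
have e (i : 'I_n.+1) : sval (cmor c (ord0_le i) : porbit_hom _ _)
    (projT2 (cob c ord0 : porbit_obj G)) = projT2 (cob c i : porbit_obj G).
  exact: (svalP (cmor c (ord0_le i) : porbit_hom _ _)).
apply: chain_ext => [i|i j le].
  by rewrite /= /pointed_ob /= e; case: (cob c i).
apply: Arr_opp; exact: (@porbit_Arr_eta _ _ _ (cmor c le)).
Qed.

Definition pointed_cell n p (c : chain OG n) (A : coset (cob c ord0))
    (x : nerve (X (cob c ord_max)) p) : hocolim_bisset (cat_Xp X) n p :=
  existT (fun c => chain (cat_Xp X (cob c ord_max)) p) (pointed_chain A) x.

Lemma pointed_cell_face p q (a : monotone_map p q) m (c : chain OG q)
  (A : coset (cob c ord0)) (x : nerve (X (cob c ord_max)) m) :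
  @pointed_cell p m (chain_act a c) (ctop_first a A)
    (chain_map (cf1 X (cmor c (le_ord_max (a ord_max)))) x : nerve (X (cob (chain_act a c) ord_max)) m) =
  smap_fun (bface (hocolim_bisset (cat_Xp X)) a) (pointed_cell A x).
Proof.
have e : (cmor (chain_act a c) (ord0_le ord_max) : orbit_map _ _) (ctop_first a A) =
    (cmor c (ord0_le (a ord_max)) : orbit_map _ _) A.
  by rewrite (cmor_cmp c (ord0_le (a ord0)) (monoP a (ord0_le ord_max)) (ord0_le (a ord_max))).
apply: hocell_ext => [|i|i j le]; first exact: pointed_chain_act.
- exact: (cat_Xp_ob_ext _ e).
- exact: (cat_Xp_mor_ext _ e).
Qed.

(** A point of the bar construction over a chain of length [n] is a pair of
    points of the simplices of dimensions [p] and [n], hence a point of the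
    realization of their product. *)
Definition ctop_inv_simplex n p (c : chain OG n) (A : coset (cob c ord0))
    (x : nerve (X (cob c ord_max)) p) (s : simplex R p) (t : simplex R n) :
    hocolim_gspace R X :=
  realization_map (disc_map (bisimplex (pointed_cell A x))) (prism_inv (s, t)).

Lemma ctop_inv_simplexE m n p (c : chain OG n) (A : coset (cob c ord0))
    (x : nerve (X (cob c ord_max)) p) (a : monotone_map m p) (b : monotone_map m n)
    (w : simplex R m) :
  ctop_inv_simplex A x (push a w) (push b w) = rpoint (Z := disc hoc)
    (sact a (smap_fun (bface (hocolim_bisset (cat_Xp X)) b) (pointed_cell A x))) w.
Proof. by rewrite /ctop_inv_simplex prism_invE realization_mapE. Qed.

Definition ctop_inv_summand n (c : chain OG n) (A : coset (cob c ord0))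
    (yt : BX (cob c ord_max) * simplex R n) : hocolim_gspace R X :=
  rlift (Z := disc (nerve (X (cob c ord_max)))) (fun p => @ctop_inv_simplex n p c A)
    yt.1 yt.2.

Lemma ctop_inv_simplex_glue n (c : chain OG n) (A : coset (cob c ord0)) p q
    (a : monotone_map p q) (x : nerve (X (cob c ord_max)) q) (s : simplex R p) t :
  ctop_inv_simplex A (sact a x) s t = ctop_inv_simplex A x (push a s) t.
Proof.
have [w [d [b [<- <-]]]] := simplex_refinement s t.
by rewrite -push_comp !ctop_inv_simplexE sact_comp -(smap_nat _ a).
Qed.

Lemma ctop_inv_summandE m n p (c : chain OG n) (A : coset (cob c ord0))
    (x : nerve (X (cob c ord_max)) p) (a : monotone_map m p) (b : monotone_map m n)
    (w : simplex R m) :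
  ctop_inv_summand A
    (rpoint (Z := disc (nerve (X (cob c ord_max)))) x (push a w) : BX (cob c ord_max),
     push b w) = rpoint (Z := disc hoc)
    (sact a (smap_fun (bface (hocolim_bisset (cat_Xp X)) b) (pointed_cell A x))) w.
Proof.
rewrite /ctop_inv_summand rliftE; first exact: ctop_inv_simplexE.
by move=> k l d y s; apply: funext => t; exact: ctop_inv_simplex_glue.
Qed.

Lemma ctop_inv_summand_continuous n (c : chain OG n) (A : coset (cob c ord0)) :
  continuous (@ctop_inv_summand n c A).
Proof.
apply: (@rlift_prod_continuous R (disc (nerve (X (cob c ord_max)))) _ _
  (fun p => @ctop_inv_simplex n p c A)).
- exact/compact_locally_compact/simplex_compact.
- exact: simplex_hausdorff.
- exact: ctop_inv_simplex_glue.
move=> p.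
pose N := nerve (X (cob c ord_max)).
apply: (@comp_continuous _ (disc_cell N p * (simplex R p * simplex R n))%type _
  (fun x => ctop_inv_simplex A (x.1 : N p) x.2.1 x.2.2) (fun x => (x.1.1, (x.1.2, x.2)))).
  apply: (@discrete_prod_continuous {classic N p} _ _
    (fun z x => ctop_inv_simplex A (z : N p) x.1 x.2)) => z.
  apply: comp_continuous; first exact: realization_map_continuous.
  apply: (@comp_continuous _ _ _ (@prism_inv R p n) (fun x => (x.1, x.2))).
    exact: prism_inv_continuous.
  by apply: pair_continuous; [exact: fst_continuous|exact: snd_continuous].
apply: pair_continuous; first by apply: comp_continuous; exact: fst_continuous.
apply: pair_continuous; last exact: snd_continuous.
by apply: comp_continuous; [exact: snd_continuous|exact: fst_continuous].
Qed.

Definition ctop_inv_cell n (z : ctop_cell BX n) (t : simplex R n) : hocolim_gspace R X :=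
  ctop_inv_summand ((projT2 z).2 : coset (cob (projT1 z) ord0)) ((projT2 z).1, t).

Lemma ctop_inv_cell_glue p q (a : monotone_map p q) (z : ctop_cell BX q) (t : simplex R p) :
  ctop_inv_cell (ctop_act a z) t = ctop_inv_cell z (push a t).
Proof.
case: z => c [y A]; rewrite /ctop_inv_cell /=.
elim/realization_ind: y => m x s.
have [w [d [b [<- <-]]]] := simplex_refinement s t.
rewrite -push_comp ctop_inv_summandE bface_comp -pointed_cell_face.
rewrite -(@ctop_inv_summandE _ p m (chain_act a c)).
by congr (ctop_inv_summand _ (_, _)); rewrite /ctop_last /= /B_mor realization_mapE.
Qed.

Definition C_top_inv_fun : C_top R BX -> hocolim_gspace R X :=
  rlift (Z := ctop_sspace BX) ctop_inv_cell.

Lemma C_top_inv_funE n (z : ctop_cell BX n) t :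
  C_top_inv_fun (rpoint (Z := ctop_sspace BX) z t) = ctop_inv_cell z t.
Proof. exact: (rliftE (Z := ctop_sspace BX) ctop_inv_cell_glue). Qed.

Lemma C_top_inv_continuous : continuous C_top_inv_fun.
Proof.
apply: rlift_continuous => [|n]; first exact: ctop_inv_cell_glue.
apply: (@sigT_prod_continuous _ (@ctop_summand G BX n) (simplex R n) _
  (fun c x => ctop_inv_summand (x.1.2 : coset (cob c ord0)) (x.1.1, x.2))) => c.
apply: (@comp_continuous _
  (discrete_topology (coset (cob c ord0)) * (BX (cob c ord_max) * simplex R n))%type _
  (fun x => ctop_inv_summand (x.1 : coset (cob c ord0)) x.2)
  (fun x => (x.1.2, (x.1.1, x.2)))).
  apply: (@discrete_prod_continuous (coset (cob c ord0)) _ _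
    (fun A x => ctop_inv_summand A x)) => A.
  exact: ctop_inv_summand_continuous.
apply: pair_continuous.
  by apply: comp_continuous; [exact: snd_continuous|exact: fst_continuous].
apply: pair_continuous; last exact: snd_continuous.
by apply: comp_continuous; exact: fst_continuous.
Qed.

Lemma C_top_identK : cancel (C_top_ident R X) C_top_inv_fun.
Proof.
move=> u; elim/realization_ind: u => n z t.
rewrite /= C_top_ident_funE C_top_inv_funE /ctop_inv_cell /=.
rewrite -{1 2}(push_id t) ctop_inv_summandE; congr (rpoint (Z := disc hoc) _ _).
rewrite bface_id [LHS](sact_id (s := hocolim_level (cat_Xp X) n)).
case: z => c x; rewrite /pointed_cell /=.
have e : (cmor (chain_map (functor_opp (porbit_forget G)) c) (ord0_le ord_max)
    : orbit_map _ _) (projT2 (cob c ord0 : porbit_obj G)) =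
    projT2 (cob c ord_max : porbit_obj G).
  exact: (svalP (cmor c (ord0_le ord_max) : porbit_hom _ _)).
apply: hocell_ext => [|i|i j le]; first exact: pointed_chain_forget.
- exact: (cat_Xp_ob_eta _ e).
- exact: (cat_Xp_mor_eta _ e).
Qed.

Lemma C_top_invK : cancel C_top_inv_fun (C_top_ident R X).
Proof.
move=> u; elim/realization_ind: u => n [c [y A]] t.
rewrite C_top_inv_funE /ctop_inv_cell /=.
elim/realization_ind: y => p x s.
have [w [a [b [<- <-]]]] := simplex_refinement s t.
rewrite ctop_inv_summandE C_top_ident_funE -(rpoint_glue (Z := ctop_sspace BX)).
congr (rpoint (Z := ctop_sspace BX) _ _); apply: ctop_cell_ext => //=.
- exact: chain_ext.
- congr existT; rewrite /ctop_last /= /B_mor realization_mapE /=.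
  by rewrite -(rpoint_glue (Z := disc (nerve _))) /=.
Qed.

Lemma C_top_inv_equi g u : C_top_inv_fun (gspace_act g u) = gspace_act g (C_top_inv_fun u).
Proof. by rewrite -{1}[u]C_top_invK -gmap_equi C_top_identK. Qed.

Definition C_top_inv : gmap (C_top R BX) (hocolim_gspace R X) :=
  GMap C_top_inv_continuous C_top_inv_equi.

End CTopInverse.

(** * Full subcategories *)
Section FullSub.
Variables (D : category) (P : D -> Prop).

Definition full_sub : category :=
  @Category {c : D | P c} (fun c d => hom (sval c) (sval d)) (fun c => idc (sval c))
    (fun a b c g f => g \oc f) (fun a b f => cmp1f f) (fun a b f => cmpf1 f)
    (fun a b c d h g f => cmpA h g f).

Definition full_incl : functor full_sub D :=
  @Functor full_sub D (fun c => sval c) (fun a b f => f) (fun=> erefl)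
    (fun _ _ _ _ _ => erefl).

Lemma full_sub_ob_inj (c d : full_sub) : sval c = sval d -> c = d.
Proof. by apply: eq_sig_hprop => x p q; exact: Prop_irrelevance. Qed.

Lemma full_sub_Arr_inj (a b a' b' : full_sub) (f : hom a b) (f' : hom a' b') :
  Arr (fmor full_incl f) = Arr (fmor full_incl f') -> Arr f = Arr f'.
Proof.
move=> e.
have ea : a = a' by apply: full_sub_ob_inj; exact: (projT1_eq e).
have eb : b = b' by apply: full_sub_ob_inj; exact: (f_equal (fun z => projT1 (projT2 z)) e).
by subst a' b'; congr Arr; exact: (Arr_inj e).
Qed.

Lemma full_incl_chain_inj q : injective (chain_map full_incl (q := q)).
Proof.
move=> c c' e; apply: chain_ext => [i|i j le].
  by apply: full_sub_ob_inj; exact: (congr1 (fun c => cob c i) e).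
by apply: full_sub_Arr_inj; exact: (congr1 (fun c => Arr (cmor c le)) e).
Qed.

Variable F : cat_functor D.

Definition full_restr : cat_functor full_sub := cat_precomp F full_incl.

Definition hocolim_incl_fun q (z : hocolim full_restr q) : hocolim F q :=
  existT (fun c : chain D q => chain (F (cob c ord_max)) q)
    (chain_map full_incl (projT1 z)) (projT2 z).

Lemma hocolim_incl_nat p q (a : monotone_map p q) (z : hocolim full_restr q) :
  hocolim_incl_fun (sact a z) = sact a (hocolim_incl_fun z).
Proof. by apply: hocell_ext => //; exact: chain_map_nat. Qed.

Definition hocolim_incl : smap (hocolim full_restr) (hocolim F) := SMap hocolim_incl_nat.

Lemma hocolim_incl_inj q : injective (@smap_fun _ _ hocolim_incl q).
Proof.
move=> [c x] [c' x'] /= e.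
have ec : c = c' by apply: full_incl_chain_inj; exact: (projT1_eq e).
by subst c'; congr existT; exact: existT_inj e.
Qed.

Lemma hocolim_incl_image q (z : hocolim F q) :
  (exists y, smap_fun hocolim_incl y = z) <-> (forall i, P (cob (projT1 z) i)).
Proof.
split=> [[y <-] i|Pz]; first exact: (svalP (cob (projT1 y) i)).
case: z Pz => c x /= Pc.
pose c' : chain full_sub q := @Chain full_sub q (fun i => exist _ (cob c i) (Pc i))
  (fun i j le => cmor c le) (fun i le => cmor_id c le)
  (fun i j k ij jk ik => cmor_cmp c ij jk ik).
exists (existT (fun c => chain (full_restr (cob c ord_max)) q) c' x).
by apply: hocell_ext => //; exact: chain_ext.
Qed.

Definition groth_incl_mor (u v : groth full_restr) (m : hom u v) :
    @hom (groth F) (existT _ (sval (projT1 u)) (projT2 u)) (existT _ (sval (projT1 v)) (projT2 v)) :=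
  existT _ (projT1 m) (projT2 m).

Lemma groth_incl_mor1 u : groth_incl_mor (idc u) = idc _.
Proof.
by apply: groth_hom_ext => //; rewrite /= Arr_id_to [RHS]Arr_id_to.
Qed.

Lemma groth_incl_morM u v w (m' : hom v w) (m : hom u v) :
  groth_incl_mor (m' \oc m) = groth_incl_mor m' \oc groth_incl_mor m.
Proof. by apply: groth_hom_ext => //; rewrite [LHS]Arr_id_tor [RHS]Arr_id_tor. Qed.

Definition groth_incl : functor (groth full_restr) (groth F) :=
  @Functor (groth full_restr) (groth F)
    (fun u => existT _ (sval (projT1 u)) (projT2 u)) groth_incl_mor
    groth_incl_mor1 groth_incl_morM.

Lemma groth_incl_ob_inj : injective (fobj groth_incl).
Proof.
move=> [[c pc] x] [[d pd] y] /= e; have ec : c = d := projT1_eq e.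
subst d; have -> : pd = pc by exact: Prop_irrelevance.
by rewrite (existT_inj e).
Qed.

Lemma groth_incl_mor_inj u v : injective (@groth_incl_mor u v).
Proof.
move=> [f h] [f' h'] e; have ef : f = f' := projT1_eq e.
by subst f'; congr existT; exact: existT_inj e.
Qed.

Lemma groth_incl_nerve_inj q : injective (@smap_fun _ _ (nerve_map groth_incl) q).
Proof.
move=> c c' e; apply: chain_ext => [i|i j le].
  by apply: groth_incl_ob_inj; exact: (congr1 (fun c => cob c i) e).
have := congr1 (fun c => Arr (cmor c le)) e => /=.
have [e1 e2] : cob c j = cob c' j /\ cob c i = cob c' i.
  by split; apply: groth_incl_ob_inj; exact: (congr1 (fun c => cob c _) e).
move: (cmor c le) (cmor c' le); rewrite e1 e2 => m m' em.
by congr Arr; apply: groth_incl_mor_inj; exact: Arr_inj em.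
Qed.

Lemma groth_incl_nerve_image q (v : nerve (groth F) q) :
  (exists y, smap_fun (nerve_map groth_incl) y = v) <->
  (forall i, P (projT1 (cob v i))).
Proof.
split=> [[y <-] i|Pv]; first exact: (svalP (projT1 (cob y i))).
pose ob (i : 'I_q.+1) : groth full_restr := existT (fun c : full_sub => F (sval c))
  (exist _ (projT1 (cob v i)) (Pv i)) (projT2 (cob v i)).
pose mor (i j : 'I_q.+1) (le : (i <= j)%N) : hom (ob j) (ob i) :=
  existT _ (projT1 (cmor v le)) (projT2 (cmor v le)).
have mor1 (i : 'I_q.+1) (le : (i <= i)%N) : mor i i le = idc (ob i).
  apply: groth_hom_ext; rewrite /mor /= cmor_id //.
  by rewrite /= Arr_id_to [RHS]Arr_id_to.
have morM (i j k : 'I_q.+1) (ij : (i <= j)%N) (jk : (j <= k)%N) (ik : (i <= k)%N) :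
    mor i k ik = mor i j ij \oc mor j k jk.
  apply: groth_hom_ext; rewrite /mor /= (cmor_cmp v ij jk ik) //.
  by rewrite [LHS]Arr_id_tor [RHS]Arr_id_tor.
exists (Chain mor1 morM); apply: chain_ext => [i|i j le] /=.
  by case: (cob v i).
exact: (@groth_Arr_eta _ F _ _ (cmor v le) _ _ (projT2 (cmor v le))).
Qed.

Lemma thomason_incl q (z : hocolim full_restr q) :
  smap_fun (nerve_map groth_incl) (smap_fun (thomason full_restr) z) =
  smap_fun (thomason F) (smap_fun hocolim_incl z).
Proof.
case: z => c x; apply: chain_ext => [//|i j le].
by apply: groth_Arr_ext => //; rewrite [LHS]Arr_id_tor [RHS]Arr_id_tor.
Qed.

End FullSub.

(** * The fixed objects of the category of pointed orbits *)
Section FixedObjects.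
Variables (G : groupType) (H : subgroup G).

Definition fixed_object (u : opp_cat (porbit_cat G)) : Prop :=
  forall h, subgroup_set H h -> coset_act h (projT2 (u : porbit_obj G)) = projT2 (u : porbit_obj G).

Lemma fixed_objectE u : fixed_object u <->
  (forall h, subgroup_set H h -> porbit_act_obj h u = u).
Proof.
case: u => K A; split=> fixA h Hh.
  by rewrite /porbit_act_obj /= (fixA h Hh).
exact: existT_inj (fixA h Hh).
Qed.

Definition unit_coset : coset H := Coset (ex_intro _ 1%g (esym (translate1 H))).

Lemma unit_coset_fixed : fixed_object (existT _ H unit_coset).
Proof.
move=> h Hh; apply: coset_ext; rewrite /= /translate eqEsubset; split.
  by move=> _ [x Hx <-]; exact: subgroupM.
move=> x Hx; exists (h^-1 * x)%g; last by rewrite mulgA mulgV mul1g.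
by apply: subgroupM => //; exact: subgroupV.
Qed.

Lemma coset_repr (B : coset H) : exists a, B = coset_act a unit_coset.
Proof. by have [a Ba] := cosetP B; exists a; exact: coset_ext. Qed.

Definition fixed_star : full_sub fixed_object :=
  exist _ (existT (fun K : subgroup G => coset K) H unit_coset) unit_coset_fixed.

(** The map is [a H |-> a A]; it is well defined because [H] fixes [A]. *)
Lemma fixed_term_inhabited (u : full_sub fixed_object) :
  inhabited (hom u fixed_star).
Proof.
case: u => -[K A] fixA.
have [r rP] := choice coset_repr.
have actE a b : coset_act a unit_coset = coset_act b unit_coset ->
    coset_act a A = coset_act b A.
  move=> e; have [x Hx xb] : translate a H b.
    have -> : translate a H = translate b H := congr1 (@coset_set _ _) e.
    by exists 1%g; [exact: subgroup1|rewrite mulg1].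
  by rewrite -xb coset_actM (fixA x Hx).
have f_equi g B : coset_act (r (coset_act g B)) A = coset_act g (coset_act (r B) A).
  by rewrite -coset_actM; apply: actE; rewrite -rP coset_actM -rP.
have f1 : OrbitMap f_equi unit_coset = A.
  by rewrite /= -[RHS]coset_act1; apply: actE; rewrite -rP coset_act1.
by constructor; exact: (exist _ (OrbitMap f_equi) f1).
Qed.

Definition fixed_term (u : full_sub fixed_object) : hom u fixed_star :=
  inhabited_witness (fixed_term_inhabited u).

Lemma fixed_term_uniq (u : full_sub fixed_object) (f g : hom u fixed_star) : f = g.
Proof.
move: f g => [f f1] [g g1]; apply: porbit_hom_ext; apply: orbit_map_ext => B /=.
have [a ->] := coset_repr B; rewrite !orbit_equi; congr coset_act.
exact: etrans f1 (esym g1).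
Qed.

Variable X : cat_functor (opp_cat (orbit_cat G)).

Lemma hocolim_fixed n (z : hocolim_gsset X n) :
  (exists y, smap_fun (hocolim_incl fixed_object (cat_Xp X)) y = z) <->
  (forall h, subgroup_set H h -> smap_fun (gsset_act (hocolim_gsset X) h) z = z).
Proof.
apply: (iff_trans (hocolim_incl_image fixed_object z)).
split=> [fixz h Hh|fixz i]; last first.
  apply/fixed_objectE => h Hh.
  exact: (congr1 (fun z : hocolim (cat_Xp X) n => cob (projT1 z) i) (fixz h Hh)).
case: z fixz => c x fixc.
have e i : coset_act h (projT2 (cob c i : porbit_obj G)) = projT2 (cob c i : porbit_obj G).
  exact: fixc.
apply: hocell_ext => [|i|i j le].
- apply: chain_ext => [i|i j le].
    by apply: (fixed_objectE _).1 => //; exact: fixc.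
  by apply: Arr_opp; exact: (@porbit_Arr_eta _ _ _ (cmor c le)).
- exact: (@cat_Xp_ob_eta _ X (cob c ord_max)).
- exact: (@cat_Xp_mor_eta _ X (cob c ord_max)).
Qed.

Lemma nerve_fixed n (v : gnerve (C_cat X) n) :
  (exists y, smap_fun (nerve_map (groth_incl fixed_object (cat_Xp X))) y = v) <->
  (forall h, subgroup_set H h -> smap_fun (gsset_act (gnerve (C_cat X)) h) v = v).
Proof.
apply: (iff_trans (groth_incl_nerve_image fixed_object v)).
split=> [fixv h Hh|fixv i]; last first.
  apply/fixed_objectE => h Hh.
  exact: (congr1 (fun v : nerve (groth (cat_Xp X)) n => projT1 (cob v i)) (fixv h Hh)).
apply: chain_ext => [i|i j le] /=.
  have := fixv i; case: (cob v i) => -[K A] x /= fixA.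
  by rewrite /C_cat_act_obj /porbit_act_obj /= (fixA h Hh).
have := fixv i; have := fixv j.
case: (cob v i) (cob v j) (cmor v le) => -[K A] x [[L B] y] [[f pf] k] /= fixB fixA.
by apply: C_cat_Arr_ext; [exact: fixB|exact: fixA].
Qed.

End FixedObjects.

(** * Thomason's map on fixed points *)
Section Weak.
Variables (R : realType) (G : groupType) (X : cat_functor (opp_cat (orbit_cat G))).

Lemma fixed_map_continuous (H : subgroup G) (U V : gspace G) (f : gmap U V) :
  continuous (@fixed_map G H U V f).
Proof.
apply: set_type_continuous; apply: (@comp_continuous (fixed_points H U) U V f val).
  exact: gmap_continuous.
exact: val_continuous.
Qed.

Lemma fixed_map_cancel (H : subgroup G) (U V : gspace G) (f : gmap U V) (g : gmap V U) :
  cancel f g -> cancel (@fixed_map G H U V f) (@fixed_map G H V U g).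
Proof. by move=> fK x; apply: val_inj; exact: fK. Qed.

Lemma fixed_mapE (H : subgroup G) (U V : gspace G) (f : gmap U V) x :
  fixed_val (@fixed_map G H U V f x) = f (fixed_val x).
Proof. by []. Qed.

Lemma fixed_map_ext (H : subgroup G) (U V : gspace G) (f : gmap U V)
  (f' : fixed_points H U -> fixed_points H V) :
  (forall x, f (fixed_val x) = fixed_val (f' x)) -> @fixed_map G H U V f = f'.
Proof. by move=> ff'; apply: funext => x; apply: val_inj; exact: ff'. Qed.

Section Terminal.
Variables (D : category) (F : cat_functor D) (star : D).
Variable term : forall c : D, hom c star.
Hypothesis term_uniq : forall (c : D) (f g : hom c star), f = g.

Lemma thomason_coherent_equivalence :
  coherent_equivalence R (realization_map (R := R) (disc_map (thomason F))).
Proof.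
pose P := realized_homotopy (R := R) (@hocolim_contr_nat D F star term term_uniq).
pose Q := @realized_homotopy R (nerve (groth F)) (nerve (groth F))
  (fun n v b => groth_contr term term_uniq v b) (@groth_contr_nat D F star term term_uniq).
apply: (@CoherentEquivalence R _ _ _
  (realization_map (disc_map (thomason_inv F term term_uniq))) P Q).
- exact: realization_map_continuous.
- exact: realization_map_continuous.
- exact: realized_homotopy_continuous.
- exact: realized_homotopy_continuous.
- move=> u; elim/realization_ind: u => n z t.
  by rewrite /P (realized_homotopy_cst _ _ (edge0 t)) hocolim_contr0 !realization_mapE.
- move=> u; elim/realization_ind: u => n z t.
  by rewrite /P (realized_homotopy_cst _ _ (edge1 t)) hocolim_contr1.
- move=> u; elim/realization_ind: u => n z t.
  by rewrite /Q (realized_homotopy_cst _ _ (edge0 t)) groth_contr0 !realization_mapE.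
- move=> u; elim/realization_ind: u => n z t.
  by rewrite /Q (realized_homotopy_cst _ _ (edge1 t)) groth_contr1.
- move=> u s; apply: realized_homotopy_map => n z b.
  exact: groth_contr_thomason.
Qed.

End Terminal.

Lemma thomason_fixed (H : subgroup G)
  (u : realization R (disc (hocolim (full_restr (fixed_object H) (cat_Xp X))))) :
  realization_map (disc_map (nerve_map (groth_incl (fixed_object H) (cat_Xp X))))
    (realization_map (disc_map (thomason (full_restr (fixed_object H) (cat_Xp X)))) u) =
  realization_map (disc_map (thomason (cat_Xp X)))
    (realization_map (disc_map (hocolim_incl (fixed_object H) (cat_Xp X))) u).
Proof.
elim/realization_ind: u => n z t; rewrite !realization_mapE.
congr (rpoint (Z := disc (nerve (groth (cat_Xp X)))) _ t).
exact: thomason_incl.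
Qed.

Lemma thomason_weak_G_equivalence :
  weak_G_equivalence R (gmap_comp (thomason_gmap R X) (C_top_inv R X)).
Proof.
move=> H.
pose F' := full_restr (fixed_object H) (cat_Xp X).
have [e1 [e1' [ce1 ce1' e1K e1'K e1E]]] := @fixed_points_realization R G H
  (hocolim_gsset X) _ (hocolim_incl (fixed_object H) (cat_Xp X))
  (@hocolim_incl_inj _ (fixed_object H) (cat_Xp X)) (@hocolim_fixed G H X).
have [e2 [e2' [ce2 ce2' e2K e2'K e2E]]] := @fixed_points_realization R G H
  (gnerve (C_cat X)) _ (nerve_map (groth_incl (fixed_object H) (cat_Xp X)))
  (@groth_incl_nerve_inj _ (fixed_object H) (cat_Xp X)) (@nerve_fixed G H X).
pose jH := @fixed_map G H _ _ (C_top_inv R X).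
pose iH := @fixed_map G H _ _ (C_top_ident R X).
have cj : continuous jH by exact: fixed_map_continuous.
have ci : continuous iH by exact: fixed_map_continuous.
have iHK : cancel iH jH by apply: fixed_map_cancel; exact: C_top_identK.
have jHK : cancel jH iH by apply: fixed_map_cancel; exact: C_top_invK.
pose eta := realization_map (R := R) (disc_map (thomason F')).
pose d (x : fixed_points H (C_top R (B_functor R X))) := e1' (jH x).
pose d' u : fixed_points H (C_top R (B_functor R X)) := iH (e1 u).
have -> : @fixed_map G H _ _ (gmap_comp (thomason_gmap R X) (C_top_inv R X)) =
    fun x => e2 (eta (d x)).
  by apply: fixed_map_ext => x; rewrite e2E thomason_fixed -e1E /d e1'K fixed_mapE.
have cd : continuous d by exact: comp_continuous.
have cd' : continuous d' by exact: comp_continuous.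
have dK : cancel d d' by move=> x; rewrite /d /d' e1'K jHK.
have d'K : cancel d' d by move=> u; rewrite /d /d' iHK e1K.
apply: coherent_equivalence_weak.
apply: (coherent_equivalence_homeo cd cd' dK d'K ce2 ce2' e2K e2'K).
exact: (thomason_coherent_equivalence F' (@fixed_term G H) (@fixed_term_uniq G H)).
Qed.

End Weak.

(* [j] is the inverse of the G-map [C_top_ident], so the first two conjuncts
   say that [C_top_ident] is a G-homeomorphism; the map |eta| of the claim is
   [thomason_gmap] read through this identification of its source. *)
Theorem theorem3p2 (R : realType) (G : groupType)
  (X : cat_functor (opp_cat (orbit_cat G))) :
  exists j : gmap (C_top R (B_functor R X)) (hocolim_gspace R X),
    [/\ cancel (C_top_ident R X) j, cancel j (C_top_ident R X) &
        weak_G_equivalence R (gmap_comp (thomason_gmap R X) j)].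
Proof.
exists (C_top_inv R X); split.
- exact: C_top_identK.
- exact: C_top_invK.
- exact: thomason_weak_G_equivalence.
Qed.
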